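(* Let $g:\mathbb{R}\to\mathbb{R}$ be Lipschitz continuous, $\mathbb{Z}$-periodic and such that $g(y)>0$ for every $y$, let $0<\alpha<1$, and let $u_0:\mathbb{R}^n\to\mathbb{R}$ be Lipschitz continuous. For $\varepsilon>0$ let $u^\varepsilon_\alpha$ be the solution to $$u^\varepsilon_t-\varepsilon^\alpha\Delta u^\varepsilon-g\left(\frac{u^\varepsilon}{\varepsilon}\right)=0\ \text{ in }\mathbb{R}^n\times(0,+\infty),\qquad u^\varepsilon(x,0)=u_0(x)\ \text{ in }\mathbb{R}^n.$$ Assume that either $u_0$ is convex and nonconstant, or $u_0$ is unbounded from above and there exists $\eta\in\mathbb{R}^n$ with $|\eta|=1$ such that $$\nabla u_0(x)\cdot\eta\ge\delta\qquad\text{for some }\delta>0\text{ and for a.e. }x\in\mathbb{R}^n.$$ Then, as $\varepsilon\to0$, the solutions $u^\varepsilon_\alpha$ converge locally uniformly to the function $$u(x,t)=u_0(x)+t\int_0^1 g(s)\,ds.$$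
   Context: $\nabla$ and $\Delta$ are the gradient and Laplacian in $x$. The solution $u^\varepsilon_\alpha$ is the unique (classical) solution, of class $C^{2+\gamma,1+\gamma/2}$ for all $\gamma\in(0,1)$. Locally uniform convergence is on $\mathbb{R}^n\times[0,+\infty)$. *)

(* Defs.v *)
From HB Require Import structures.
From mathcomp Require Import all_boot all_order all_algebra.
From mathcomp Require Import all_classical all_reals all_analysis.
Set Implicit Arguments.
Unset Strict Implicit.
Unset Printing Implicit Defensive.
Import Order.TTheory GRing.Theory Num.Theory.
Import numFieldNormedType.Exports.
Local Open Scope classical_set_scope.
Local Open Scope ring_scope.

Section EuclideanSpace.
Context {R : realType} {n : nat}.
Implicit Types (x y a b : 'rV[R]_n) (f : 'rV[R]_n -> R) (N : set 'rV[R]_n).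

Definition dot x y : R := \sum_(i < n) x 0 i * y 0 i.

(* The norm `|x| of 'rV[R]_n is the maximum norm, hence this definition. *)
Definition euclidean_norm x : R := Num.sqrt (dot x x).

Definition basis_vec (i : 'I_n) : 'rV[R]_n := delta_mx 0 i.

Definition grad f x : 'rV[R]_n := \row_(i < n) 'D_(basis_vec i) f x.

Definition box a b : set 'rV[R]_n :=
  [set x | forall i, a 0 i <= x 0 i <= b 0 i].

Definition box_volume a b : R := \prod_(i < n) (b 0 i - a 0 i).

(* Sets of n-dimensional Lebesgue (outer) measure zero: countable covers by
   boxes of arbitrarily small total volume. *)
Definition null_set N : Prop :=
  forall e : R, 0 < e ->
  exists a b : nat -> 'rV[R]_n,
    [/\ forall k i, a k 0 i <= b k 0 i,
        N `<=` \bigcup_k box (a k) (b k) &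
        (\sum_(0 <= k <oo) (box_volume (a k) (b k))%:E <= e%:E)%E].

Definition almost_everywhere_Rn (P : 'rV[R]_n -> Prop) : Prop :=
  null_set [set x | ~ P x].

End EuclideanSpace.

(* Space-time functions are functions of p = (x, t) : 'rV[R]_n * R. *)
Section SpaceTime.
Context {R : realType} {n : nat}.
Implicit Types (f : 'rV[R]_n * R -> R) (p : 'rV[R]_n * R).

Definition open_halfspace : set ('rV[R]_n * R) := [set p | 0 < p.2].

Definition closed_halfspace : set ('rV[R]_n * R) := [set p | 0 <= p.2].

Definition dt f p : R := derive1 (fun s : R => f (p.1, s)) p.2.

Definition dx (i : 'I_n) f p : R :=
  'D_(basis_vec i) (fun y : 'rV[R]_n => f (y, p.2)) p.1.

Definition laplacian f p : R := \sum_(i < n) dx i (dx i f) p.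

Definition dt_exists f p : Prop := derivable (fun s : R => f (p.1, s)) p.2 1.

Definition dx_exists (i : 'I_n) f p : Prop :=
  derivable (fun y : 'rV[R]_n => f (y, p.2)) p.1 (basis_vec i).

(* Local C^{gamma, gamma/2} regularity: Hoelder continuity of exponent gamma
   in x and gamma/2 in t, on each compact subset of t > 0. *)
Definition parabolic_holder (gamma : R) f : Prop :=
  forall K : set ('rV[R]_n * R), compact K -> K `<=` open_halfspace ->
  exists C : R, forall p q, K p -> K q ->
    `|f p - f q| <=
      C * (`|p.1 - q.1| `^ gamma + `|p.2 - q.2| `^ (gamma / 2)).

(* Local C^{2 + gamma, 1 + gamma/2} regularity in t > 0. *)
Definition parabolic_C2 (gamma : R) f : Prop :=
  [/\ forall p, open_halfspace p ->
        [/\ dt_exists f p,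
            forall i, dx_exists i f p &
            forall i j, dx_exists j (dx i f) p],
      parabolic_holder gamma f,
      forall i, parabolic_holder gamma (dx i f),
      forall i j, parabolic_holder gamma (dx j (dx i f)) &
      parabolic_holder gamma (dt f)].

(* The Cauchy problem on the whole space has a unique classical solution only
   within a growth class (already for the heat equation, Tychonoff's example
   gives nonzero solutions with zero initial datum). This is the classical
   uniqueness class |f(x, t)| <= A exp(a |x|^2), locally uniformly in time. *)
Definition tychonoff_growth f : Prop :=
  forall T : R, 0 < T ->
  exists A a : R, forall p, 0 <= p.2 <= T ->
    `|f p| <= A * expR (a * euclidean_norm p.1 ^+ 2).

(* f is the solution of  f_t - eps^alpha Lap f - g(f / eps) = 0  in t > 0,
   f(., 0) = u0. *)
Definition is_solution (g : R -> R) (alpha eps : R) (u0 : 'rV[R]_n -> R) f :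
    Prop :=
  [/\ forall gamma : R, 0 < gamma < 1 -> parabolic_C2 gamma f,
      {within closed_halfspace, continuous f},
      forall p, open_halfspace p ->
        dt f p - eps `^ alpha * laplacian f p - g (f p / eps) = 0,
      forall x, f (x, 0) = u0 x &
      tychonoff_growth f].

(* On the locally compact set t >= 0, locally uniform convergence is uniform
   convergence on compact subsets. *)
Definition locally_uniform_cvg (u : R -> 'rV[R]_n * R -> R) f : Prop :=
  forall K : set ('rV[R]_n * R), compact K -> K `<=` closed_halfspace ->
  {uniform K, u @ 0^'+ --> f}.

End SpaceTime.

(* Main.v *)
Require Import Defs.
From HB Require Import structures.
From mathcomp Require Import all_boot all_order all_algebra.
From mathcomp Require Import all_classical all_reals all_analysis.
From mathcomp Require Import measurable_realfun.
From mathcomp Require Import ring lra.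
Set Implicit Arguments.
Unset Strict Implicit.
Unset Printing Implicit Defensive.
Import Order.TTheory GRing.Theory Num.Theory.
Import numFieldNormedType.Exports.
Local Open Scope classical_set_scope.
Local Open Scope ring_scope.

(** Write [kappa = eps ^ alpha], [theta = kappa / eps], which blows up since
    [alpha < 1], and [m] for the mean of [g].

    Where the gradient of the limit does not vanish, the solution crosses one
    period of [g] over a spatial distance of order [eps]; diffusion is so
    strong at that scale that the solution only sees the mean of [g].  Where
    the gradient vanishes, diffusion may be negligible and the solution follows
    the ordinary differential equation, whose speed is the harmonic mean of
    [g].  Two facts make [m] the speed nevertheless.

    Upper bound, for every Lipschitz datum.  A travelling profile of squared
    gradient [q] (in units of [1 / theta]) is an increasing change of variable
    [S] of density [r = S'], with [r] periodic of mean 1, and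
    [r g - q r' / r ^ 2] is the speed of [S u].  With [p = 1 / r] the speed is
    [g / p + q p'].  If it is a constant [c], multiplying by [p] and integrating
    over a period gives [c * mean p = m], so [mean p <= 1] as soon as
    [c >= m]; then [mean (1 / p) >= 2 - mean p >= 1], and adding a positive
    constant to [p] normalizes [r] while only decreasing the speed.  Hence for
    every [q >= 0] there is a profile of speed at most [m] up to an error
    ([positive_profile]).

    Lower bound.  It is an upper bound for [- u], with reaction [- g (- s)].
    Now only large [q] are available ([steep_profile]), so that the comparison
    function must have a gradient bounded away from 0.  This is where the
    hypothesis on the datum enters, in the form [tilted]: from each point the
    datum stays above a surface which rises at a positive rate in some direction
    [eta], and loses at most a cone in the directions orthogonal to [eta].  A
    nonconstant convex function has it because it is a supremum of affine
    functions of nonzero slope ([convex_tilted]); in the other case the datum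
    grows at rate [delta] along [eta] ([ae_monotone], [monotone_tilted]).

    Both bounds come from one comparison lemma, [doubling_comparison].  The
    profile has to follow the gradient of the comparison function [phi], but
    its dependence on [q] is not controlled.  The spatial variable is therefore
    doubled: one maximizes
    [eps S_y (u (x, t) / eps) - D |x - y| ^ 2 - phi x - speed * t]
    over [x], [t] and [y], where [S_y] is a profile for the gradient of [phi]
    at [y].  No derivative in [y] is needed, and with [D] of order [kappa] the
    penalization brings [x] so close to [y] that [S_y] is still a good profile
    at [x].

    The comparison takes place on the whole space.  The growth condition first
    gives, by Tychonoff's maximum principle for the heat equation
    ([heat_max]) and the boundedness of [g], that the solution stays within a
    constant of the datum on bounded time intervals ([solves_growth]); maxima
    are then attained. *)

(** * Calculus of functions of one real variable *)

Lemma lipschitz_le (R : realType) (V : normedModType R) (f : V -> R) : lipschitz f ->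
  exists2 l : R, 0 < l & forall x y, `|f x - f y| <= l * `|x - y|.
Proof.
move=> [M [Mr HM]]; exists (`|M| + 1); first by rewrite ltr_wpDl.
move=> x y; apply: (HM (`|M| + 1) _ (x, y)) => //.
by rewrite (le_lt_trans (ler_norm M))// ltrDl.
Qed.

Lemma dist_le_continuous (R : realType) (V : normedModType R) (f : V -> R) (l : R) :
  (forall x y, `|f x - f y| <= l * `|x - y|) -> continuous f.
Proof.
move=> fl x; apply/cvgrPdist_le => e e0.
have l1 : 0 < `|l| + 1 by rewrite ltr_wpDl.
near=> y; apply: (le_trans (fl x y)).
apply: (@le_trans _ _ ((`|l| + 1) * `|x - y|)).
  by rewrite ler_wpM2r// (le_trans (ler_norm l))// lerDl.
rewrite mulrC -ler_pdivlMr//.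
near: y; apply: cvgr_dist_le; first exact: cvg_id.
by rewrite divr_gt0.
Unshelve. all: by end_near. Qed.

Section OneVariable.
Context {R : realType}.
Implicit Types (f k df : R -> R).

Lemma is_derive_approx f (x d e : R) : is_derive x 1 f d -> 0 < e ->
  exists2 r : R, 0 < r &
    forall h, `|h| < r -> `|f (x + h) - f x - d * h| <= e * `|h|.
Proof.
move=> [df <-] e0.
have /cvgrPdist_le/(_ e e0) := df.
move=> [r /= r0 rP]; exists r => // h hr.
have [->|h0] := eqVneq h 0; first by rewrite addr0 subrr mulr0 subrr normr0 mulr0.
have := rP h; rewrite /= sub0r normrN => /(_ hr h0).
rewrite -[in X in X -> _](@ler_pM2r _ `|h|) ?normr_gt0// -normrM mulrBl.
rewrite [_%:A]mulr1 [h + x]addrC distrC; congr (`|_ - _| <= _).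
by rewrite [_ *: _]mulrC mulfVK.
Qed.

Lemma is_derive_shiftP f (x d : R) :
  is_derive (0 : R) 1 (fun h => f (x + h)) d <-> is_derive x 1 f d.
Proof.
have E (c : R) (u : R -> R) : is_derive c 1 u d <->
    (fun h => h^-1 *: (u (h *: 1 + c) - u c)) @ 0^' --> d.
  split; first by move=> [du <-].
  move=> ud; apply: DeriveDef; first by apply/cvg_ex; exists d.
  exact: cvg_lim ud.
rewrite !E; suff -> : (fun h => h^-1 *: (f (x + (h *: 1 + 0)) - f (x + 0))) =
   (fun h => h^-1 *: (f (h *: 1 + x) - f x)) by [].
by apply/funext => h; rewrite !addr0 [x + _]addrC.
Qed.

Lemma is_derive_comp_shift f (x c d : R) :
  is_derive (x + c) 1 f d -> is_derive x 1 (fun h => f (h + c)) d.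
Proof.
move/is_derive_shiftP => H; apply/is_derive_shiftP.
by rewrite (_ : (fun h => _) = (fun h => f (x + c + h)))//; apply/funext => h; rewrite addrAC.
Qed.

Lemma is_derive_continuous f (x d : R) : is_derive x 1 f d -> {for x, continuous f}.
Proof. by move=> [df _]; apply/differentiable_continuous/derivable1_diffP. Qed.

Lemma MVT_global f df (a b : R) : (forall x : R, is_derive x 1 f (df x)) ->
  exists c, f b - f a = df c * (b - a).
Proof.
move=> H.
have cf (u v : R) : {within `[u, v], continuous f}.
  by apply: continuous_subspaceT => x; exact: is_derive_continuous (H x).
have [ab|ba|->] := ltgtP a b.
- by have [c _ ->] := MVT ab (fun x _ => H x) (cf a b); exists c.
- have [c _ E] := MVT ba (fun x _ => H x) (cf b a); exists c.
  by rewrite -opprB E -mulrN opprB.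
- by exists b; rewrite !subrr mulr0.
Qed.

Lemma derive_ge0_homo f df : (forall x : R, is_derive x 1 f (df x)) ->
  (forall x, 0 <= df x) -> {homo f : x y / x <= y}.
Proof.
move=> H H0 x y xy; have [c E] := MVT_global x y H.
by rewrite -subr_ge0 E mulr_ge0// subr_ge0.
Qed.

Lemma derive0_cst f : (forall x : R, is_derive x 1 f 0) -> forall x y, f x = f y.
Proof.
move=> H x y; have [c E] := @MVT_global _ (fun=> 0) x y H.
by move: E; rewrite mul0r => /eqP; rewrite subr_eq0 => /eqP.
Qed.

(** One-sided in time, because a maximum over a time strip may be reached at
    the final time. *)
Lemma derive_at_right_end_max f (a t d : R) : a < t -> is_derive t 1 f d ->
  (forall s, a <= s <= t -> f s <= f t) -> 0 <= d.
Proof.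
move=> at0 H M; apply/ler_addgt0Pr => e e0.
have [r r0 rP] := is_derive_approx H e0.
pose h := Num.min (r / 2) (t - a).
have h0 : 0 < h by rewrite lt_min subr_gt0 at0 divr_gt0.
have hr : h < r by rewrite /h gt_min ltr_pdivrMr// ltr_pMr// ltr1n.
have ht : h <= t - a by rewrite /h ge_min lexx orbT.
have := rP (- h); rewrite normrN gtr0_norm// => /(_ hr).
rewrite ler_norml => /andP[A _].
have := M (t - h); rewrite lerBrDr addrC -lerBrDr ht gerBl ltW// => /(_ isT) B.
by rewrite -(@pmulr_lge0 _ h)//; lra.
Qed.

Lemma second_derivative_max f df (d2 : R) : (forall h : R, is_derive h 1 f (df h)) ->
  is_derive (0 : R) 1 df d2 -> (forall h, f h <= f 0) -> df 0 = 0 /\ d2 <= 0.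
Proof.
move=> H H2 M.
have E0 : df 0 = 0.
  have := @derive1_at_max _ f (-1) 1 0 => /(_ _ _ _ (fun t _ => M t)).
  case; [lra| |by rewrite in_itv/=; lra|].
    by move=> t _; have [] := H t.
  by move=> _ E; have [_ <-] := H 0; rewrite E.
split=> //; rewrite leNgt; apply/negP => d0.
have [r r0 rP] := is_derive_approx H2 (divr_gt0 d0 (ltr0Sn R 1)).
have h0 : 0 < r / 2 by rewrite divr_gt0.
have cf : {within `[0, r / 2], continuous f}.
  by apply: continuous_subspaceT => x; exact: is_derive_continuous (H x).
have [c] := MVT h0 (fun x _ => H x) cf; rewrite in_itv/= => /andP[c0 cr] E.
have := rP c; rewrite gtr0_norm//.
have cr' : c < r by rewrite (lt_trans cr)// ltr_pdivrMr// ltr_pMr// ltr1n.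
move=> /(_ cr'); rewrite add0r E0 subr0 ler_norml => /andP[A _].
have dc : 0 < df c.
  have : 0 < d2 / 2 * c by rewrite mulr_gt0// divr_gt0.
  lra.
have := M (r / 2); have : 0 < df c * (r / 2 - 0) by rewrite subr0 mulr_gt0.
lra.
Qed.

(** The integrals from the base points [- N] differ by constants, so those
    normalized at 0 glue to a primitive on the whole line. *)
Lemma primitive_exists k : continuous k ->
  exists K : R -> R, K 0 = 0 /\ forall x : R, is_derive x 1 K (k x).
Proof.
move=> ck.
have itg (a b : R) : lebesgue_measure.-integrable `[a, b] (EFin \o k).
  apply: continuous_compact_integrable; first exact: segment_compact.
  exact: continuous_subspaceT.
pose F (N x : R) := \int[lebesgue_measure]_(t in `[- N, x]) k t.
have dF (N x : R) : - N < x -> is_derive x 1 (F N) (k x).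
  move=> Nx; have [] := @continuous_FTC1_closed _ k (- N) x (x + 1) _ (itg _ _) Nx (ck x).
    by rewrite ltrDl.
  by move=> D E; split; [exact: D|rewrite -derive1E; exact: E].
have cst (N M x : R) : 0 < N -> N <= M -> - N < x -> F M x - F M 0 = F N x - F N 0.
  move=> N0 NM Nx; pose G y := F M y - F N y.
  have dG y : - N < y -> is_derive y 1 G 0.
    move=> Ny; have My : - M < y by lra.
    have := dF _ _ Ny; have := dF _ _ My => h1 h2.
    by rewrite -(subrr (k y)); exact: is_deriveB.
  suff GE a b : - N < a -> a <= b -> G b = G a.
    have : G x = G 0.
      by case: (leP 0 x) => x0; [apply: GE; lra|apply/esym/GE => //; exact: ltW].
    rewrite /G; move: (F M x) (F M 0) (F N x) (F N 0) => p q r s; lra.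
  move=> Na; rewrite le_eqVlt => /predU1P[-> //|ab].
  have [] := @MVT _ G (fun=> 0) a b ab.
    by move=> y; rewrite in_itv/= => /andP[ay _]; apply: dG; lra.
    apply: derivable_within_continuous => y; rewrite in_itv/= => /andP[ay _].
    by have [] : is_derive y 1 G 0 by apply: dG; lra.
  by move=> c _; rewrite mul0r => /eqP; rewrite subr_eq0 => /eqP.
exists (fun x => F (`|x| + 1) x - F (`|x| + 1) 0); split; first by rewrite subrr.
move=> x; pose N := `|x| + 2.
have xN : - N < x by have := lerNnormlW (lexx `|x|); rewrite /N; lra.
apply: (@near_eq_is_derive _ _ _ (fun y => F N y - F N 0)).
  exists 1 => //= y; rewrite /ball_/= => xy.
  have H1 := lerNnormlW (lexx `|y|).
  have H2 : `|y| <= `|x| + `|x - y|.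
    by rewrite distrC -[leLHS](_ : `|x + (y - x)| = _) ?ler_normD// addrCA subrr addr0.
  by rewrite [LHS](cst (`|y| + 1))// /N ?addr_gt0 //; try lra; have := normr_ge0 y; lra.
by have := is_deriveB (dF N x xN) (is_derive_cst (F N 0) x 1); rewrite subr0.
Qed.

Lemma integral01_primitive k (K : R -> R) : continuous k ->
  (forall x : R, is_derive x 1 K (k x)) ->
  \int[lebesgue_measure]_(s in `[0, 1]) k s = K 1 - K 0.
Proof.
move=> ck dK; rewrite /Rintegral (@continuous_FTC2 _ k K 0 1)//.
- exact: continuous_subspaceT.
- have cK : continuous K by move=> x; exact: is_derive_continuous (dK x).
  split.
  + by move=> x _; have [] := dK x.
  + exact/cvg_at_right_filter/cK.
  + exact/cvg_at_left_filter/cK.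
- by move=> x _; rewrite derive1E; have [_ ->] := dK x.
Qed.

End OneVariable.

(** * Periodic functions and profiles *)

Section Periodic.
Context {R : realType}.
Implicit Types (f k K y w p g : R -> R).

Definition periodic f := forall (x : R) (i : int), f (x + i%:~R) = f x.

(** The mean over a period, read off a primitive: it is additive, and zero on
    the derivative of a periodic function, without integrability conditions. *)
Definition has_mean k (a : R) :=
  exists2 K : R -> R, forall x : R, is_derive x 1 K (k x) & K 1 - K 0 = a.

Lemma periodic1 f : (forall x, f (x + 1) = f x) -> periodic f.
Proof.
move=> f1 x i; elim: i x => [|n IH|n IH] x; first by rewrite addr0.
  by rewrite -addn1 PoszD intrD addrA f1 IH.
rewrite -[RHS]IH -[LHS]f1 -addrA -[X in _ + (_ + X)]/(1%:~R) -intrD.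
by rewrite -addn1 PoszD opprD subrK.
Qed.

Lemma periodic_frac f (x : R) : periodic f ->
  exists2 z : R, 0 <= z <= 1 & f z = f x.
Proof.
move=> fp; exists (x - (Num.floor x)%:~R).
  by rewrite subr_ge0 floor_le_tmp/= lerBlDl ltW// -intrD1 floorD1_gt.
by rewrite -[LHS](fp _ (Num.floor x)) subrK.
Qed.

Lemma periodic_max f : continuous f -> periodic f ->
  exists c, forall x, f x <= f c.
Proof.
move=> cf fp; have [c _ cM] := @EVT_max _ f 0 1 ler01 (continuous_subspaceT cf).
by exists c => x; have [z z01 <-] := periodic_frac x fp; apply: cM; rewrite in_itv.
Qed.

Lemma periodic_min f : continuous f -> periodic f ->
  exists c, forall x, f c <= f x.
Proof.
move=> cf fp; have [c _ cM] := @EVT_min _ f 0 1 ler01 (continuous_subspaceT cf).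
by exists c => x; have [z z01 <-] := periodic_frac x fp; apply: cM; rewrite in_itv.
Qed.

Lemma periodic_bounded f : continuous f -> periodic f ->
  exists2 B, 1 <= B & forall x, `|f x| <= B.
Proof.
move=> cf fp; have [c cM] := periodic_max cf fp; have [d dM] := periodic_min cf fp.
exists (`|f c| + `|f d| + 1); first by rewrite lerDr addr_ge0.
move=> x; rewrite ler_norml; have := ler_norm (f c); have := lerNnormlW (lexx `|f d|).
have := normr_ge0 (f c); have := normr_ge0 (f d); have := cM x; have := dM x.
move: (f c) (f d) (f x) `|f c| `|f d| => a b e A B *; apply/andP; split; lra.
Qed.

Lemma has_mean_le k1 k2 a1 a2 : has_mean k1 a1 -> has_mean k2 a2 ->
  (forall x, k1 x <= k2 x) -> a1 <= a2.
Proof.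
move=> [K1 d1 <-] [K2 d2 <-] k12.
have H : K2 0 - K1 0 <= K2 1 - K1 1.
  apply: (@derive_ge0_homo R (fun x => K2 x - K1 x) (fun x => k2 x - k1 x)) => // x.
  by rewrite subr_ge0.
move: H; move: (K1 0) (K1 1) (K2 0) (K2 1) => a b c d; lra.
Qed.

Lemma has_mean_uniq k a1 a2 : has_mean k a1 -> has_mean k a2 -> a1 = a2.
Proof. by move=> h1 h2; apply/eqP; rewrite eq_le !(has_mean_le h1 h2, has_mean_le h2 h1). Qed.

Lemma has_mean_cst (a : R) : has_mean (fun=> a) a.
Proof.
exists (fun x => a * x); last by rewrite mulr1 mulr0 subr0.
by move=> x; apply: is_derive_eq; rewrite /GRing.scale/= !mulr1.
Qed.

Lemma has_meanD k1 k2 a1 a2 : has_mean k1 a1 -> has_mean k2 a2 ->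
  has_mean (fun x => k1 x + k2 x) (a1 + a2).
Proof.
move=> [K1 d1 <-] [K2 d2 <-]; exists (fun x => K1 x + K2 x); last lra.
by move=> x; exact: (is_deriveD (d1 x) (d2 x)).
Qed.

Lemma has_meanZ k a (c : R) : has_mean k a -> has_mean (fun x => c * k x) (c * a).
Proof.
move=> [K d <-]; exists (fun x => c * K x); last by rewrite mulrBr.
by move=> x; exact: (is_deriveZ c (d x)).
Qed.

Lemma has_mean_derive y dy : periodic y -> (forall x : R, is_derive x 1 y (dy x)) ->
  has_mean dy 0.
Proof. by move=> yp dY; exists y => //; rewrite -(yp 0 1%:Z) add0r subrr. Qed.

Lemma continuous_has_mean k : continuous k ->
  has_mean k (\int[lebesgue_measure]_(s in `[0, 1]) k s).
Proof.
move=> ck; have [K [_ dK]] := primitive_exists ck.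
by exists K => //; rewrite (integral01_primitive ck dK).
Qed.

Lemma periodic_primitive k K : periodic k -> has_mean k 0 ->
  (forall x : R, is_derive x 1 K (k x)) -> periodic K.
Proof.
move=> kp k0 dK; apply: periodic1 => x.
have h : has_mean k (K 1 - K 0) by exists K.
have K10 := has_mean_uniq h k0.
have := @derive0_cst R (fun x => K (x + 1) - K x) _ x 0.
rewrite add0r K10 => H; apply/eqP; rewrite -subr_eq0; apply/eqP/H => z.
have dK1 : is_derive z 1 (fun h => K (h + 1)) (k z).
  by apply: is_derive_comp_shift; rewrite -[k z](kp z 1%:Z).
by have := is_deriveB dK1 (dK z); rewrite subrr.
Qed.

(** Read [s = u / eps] and [q = theta |G| ^ 2], where [G] is the gradient of
    [eps S (u / eps)].  Then the gradient of [u] is [G / r], and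
    [r g - q rho / r ^ 2] is the reaction term of the equation that
    [eps S (u / eps)] satisfies.  The band around [q0] is relative for large
    [q0] and absolute for small [q0], like the variation of [q] over the distance
    on which one profile is used. *)
Definition profile g (c eta q0 : R) (S r rho : R -> R) :=
  [/\ forall s : R, is_derive s 1 S (r s), forall s : R, is_derive s 1 r (rho s),
      forall s, 0 < r s, forall s, `|S s - s| <= 1 &
      forall q s, 0 <= q -> `|q - q0| <= eta * (1 + q0) ->
        r s * g s - q * (rho s / r s ^+ 2) <= c].

(** [S] is the primitive of [r] that vanishes at 0.  As [r] has mean 1,
    [S s - s] is periodic, and on [0, 1] both [S s] and [s] lie in [0, 1]. *)
Lemma profile_of_density g (c eta q0 : R) (r rho : R -> R) :
  (forall s : R, is_derive s 1 r (rho s)) -> periodic r -> has_mean r 1 ->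
  (forall s, 0 < r s) ->
  (forall q s, 0 <= q -> `|q - q0| <= eta * (1 + q0) ->
     r s * g s - q * (rho s / r s ^+ 2) <= c) ->
  exists S, profile g c eta q0 S r rho.
Proof.
move=> dr rp r1 r0 H.
have cr : continuous r by move=> x; exact: is_derive_continuous (dr x).
have [S [S0 dS]] := primitive_exists cr; exists S; split => //.
have S1 : S 1 = 1.
  have h : has_mean r (S 1 - S 0) by exists S.
  by have := has_mean_uniq h r1; rewrite S0 subr0.
have dT (x : R) : is_derive x 1 (fun s => S s - s) (r x - 1) by exact: (is_deriveB (dS x) (is_derive_id x 1)).
have Tp : periodic (fun s => S s - s).
  apply: (@periodic_primitive (fun x => r x - 1)) => //.
    by move=> x i; rewrite rp.
  by have := has_meanD r1 (has_mean_cst (- 1)); rewrite subrr.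
move=> s; have [z /andP[z0 z1] <-] := periodic_frac s Tp.
have Smono := derive_ge0_homo dS (fun x => ltW (r0 x)).
have := Smono _ _ z0; have := Smono _ _ z1; rewrite S0 S1 => a b.
by rewrite ler_norml; apply/andP; split; lra.
Qed.

End Periodic.

(** * Profiles for steep gradients *)

Section Profiles.
Context {R : realType}.
Implicit Types (g k y w p : R -> R).

Lemma inverse_square_error (x a e eta : R) : e <= 1 / 4 -> 0 <= eta ->
  `|x - 1| <= e -> `|a - 1| <= 2 * eta -> `|1 - a / x ^+ 2| <= 2 * (3 * e + 2 * eta).
Proof.
move=> e4 eta0; rewrite !ler_norml => /andP[x1 x2] /andP[a1 a2].
have x2p : 1 / 2 <= x ^+ 2 by rewrite expr2; nra.
have x20 : 0 < x ^+ 2 by lra.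
have -> : 1 - a / x ^+ 2 = (x ^+ 2 - a) / x ^+ 2 by rewrite mulrBl divff// gt_eqF.
have h1 : `|x ^+ 2 - a| <= 3 * e + 2 * eta.
  by rewrite ler_norml; apply/andP; split; rewrite expr2; nra.
rewrite -ler_norml normrM [`|(x ^+ 2)^-1|]gtr0_norm ?invr_gt0// ler_pdivrMr//.
have : 0 <= (3 * e + 2 * eta) * (x ^+ 2 - 1 / 2) by rewrite mulr_ge0; lra.
lra.
Qed.

(** At leading order in [1 / q0] the density [r = 1 + j / q0] with
    [j' = g - m] has speed [g - j' = m], whatever the sign of [g]. *)
Lemma steep_profile g (m sigma : R) : continuous g -> periodic g -> has_mean g m ->
  0 < sigma -> exists eta Q : R, [/\ 0 < eta, 0 < Q &
    forall q0, Q <= q0 -> exists S r rho, profile g (m + sigma) eta q0 S r rho].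
Proof.
move=> cg gp gm s0.
have [B B1 gB] := periodic_bounded cg gp.
have mB : `|m| <= B.
  rewrite ler_norml; apply/andP; split.
    by apply: (has_mean_le (has_mean_cst (- B)) gm) => x; have := gB x; rewrite ler_norml => /andP[].
  by apply: (has_mean_le gm (has_mean_cst B)) => x; have := gB x; rewrite ler_norml => /andP[].
have ck : continuous (fun x => g x - m).
  by move=> x; apply: cvgB; [exact: cg|exact: cvg_cst].
have kp : periodic (fun x => g x - m) by move=> x i; rewrite gp.
have k0 : has_mean (fun x => g x - m) 0.
  by have := has_meanD gm (has_mean_cst (- m)); rewrite subrr.
have [J [_ dJ]] := primitive_exists ck.
have Jp := periodic_primitive kp k0 dJ.
have cJ : continuous J by move=> x; exact: is_derive_continuous (dJ x).
have Jm := continuous_has_mean cJ.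
set j0 := (X in has_mean J X) in Jm.
have [A A1 JA] : exists2 A, 1 <= A & forall x, `|J x - j0| <= A.
  apply: (@periodic_bounded _ (fun x => J x - j0)).
    by move=> x; apply: cvgB; [exact: cJ|exact: cvg_cst].
  by move=> x i; rewrite Jp.
pose Q := 4 * A + 26 * (A * B) / sigma + 1.
pose eta := Num.min (sigma / (16 * B)) (1 / 8).
have A0 : 0 < A by lra.
have B0 : 0 < B by lra.
have eta0 : 0 < eta by rewrite lt_min !divr_gt0// mulr_gt0.
exists eta, Q; split => //.
  by rewrite /Q !addr_gt0// ?divr_gt0// !mulr_gt0.
move=> q0 Qq.
have AB : 0 <= 26 * (A * B) / sigma by rewrite divr_ge0 ?(ltW s0)// !mulr_ge0// ltW.
have q1 : 1 <= q0 by move: Qq; rewrite /Q; lra.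
have q00 : 0 < q0 by lra.
have e4 : A / q0 <= 1 / 4.
  by rewrite ler_pdivrMr//; move: Qq; rewrite /Q; lra.
pose r x := 1 + (J x - j0) / q0.
have re x : `|r x - 1| <= A / q0.
  by rewrite /r addrC addKr normrM [`|q0^-1|]gtr0_norm ?invr_gt0// ler_pM2r ?invr_gt0.
suff [S HS] : exists S, profile g (m + sigma) eta q0 S r (fun x => (g x - m) / q0) by exists S, r, (fun x => (g x - m) / q0).
apply: profile_of_density.
- move=> s; rewrite /r.
  have h := is_deriveD (is_derive_cst (1 : R) s 1) (is_deriveZ (q0^-1) (is_deriveB (dJ s) (is_derive_cst j0 s 1))).
  rewrite (_ : (fun x => _) = (cst 1 + q0^-1 *: (J - cst j0))); last first.
    by apply/funext => x; rewrite /= !fctE /GRing.scale/= mulrC.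
  by apply: is_derive_eq; rewrite add0r subr0 /GRing.scale/= mulrC.
- by move=> x i; rewrite /r Jp.
- have := has_meanD (has_mean_cst 1) (has_meanZ q0^-1 (has_meanD Jm (has_mean_cst (- j0)))).
  rewrite subrr mulr0 addr0; rewrite (_ : (fun x => _) = r)//.
  by apply/funext => x; rewrite /r mulrC.
- by move=> s; have := re s; rewrite ler_norml => /andP[]; lra.
move=> q s q_ge0 Hq.
have := re s; have := gB s; have := mB; have := JA s.
set a := q / q0.
have Ha : `|a - 1| <= 2 * eta.
  have -> : a - 1 = (q - q0) / q0 by rewrite /a mulrBl divff// gt_eqF.
  rewrite normrM [`|q0^-1|]gtr0_norm ?invr_gt0// ler_pdivrMr// (le_trans Hq)//.
  by rewrite -mulrA [2 * _]mulrC -mulrA ler_pM2l//; lra.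
have -> : q * ((g s - m) / q0 / r s ^+ 2) = a * (g s - m) / r s ^+ 2.
  by rewrite /a; ring.
have rsE : r s * g s = g s + (J s - j0) * (g s / q0).
  by rewrite /r mulrDl mul1r; congr (_ + _); rewrite mulrAC -mulrA.
rewrite rsE => jA mB' GB _.
have q26 : 13 * (A * B) / q0 <= sigma / 2.
  rewrite ler_pdivrMr// mulrAC ler_pdivlMr//.
  have := Qq; rewrite /Q => H.
  have : 26 * (A * B) / sigma <= q0 by lra.
  by rewrite ler_pdivrMr// [q0 * _]mulrC; lra.
have eta16 : 8 * B * eta <= sigma / 2.
  have : eta <= sigma / (16 * B) by rewrite /eta ge_min lexx.
  by rewrite ler_pdivlMr ?mulr_gt0//; lra.
have jG : (J s - j0) * (g s / q0) <= A * B / q0.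
  rewrite mulrA ler_pM2r ?invr_gt0// (le_trans (ler_norm _))// normrM.
  by rewrite ler_pM.
set e := A / q0 in e4 re.
have xa : `|1 - a / r s ^+ 2| <= 2 * (3 * e + 2 * eta).
  exact: inverse_square_error e4 (ltW eta0) (re s) Ha.
have gm2 : `|g s - m| <= 2 * B.
  by rewrite (le_trans (ler_normB _ _))// mulr_natl mulr2n lerD.
have : (g s - m) * (1 - a / r s ^+ 2) <= 2 * B * (2 * (3 * e + 2 * eta)).
  by rewrite (le_trans (ler_norm _))// normrM ler_pM.
have -> : (g s - m) * (1 - a / r s ^+ 2) = g s - m - a * (g s - m) / r s ^+ 2 by ring.
have eE : 13 * (A * B) / q0 = 13 * B * e by rewrite /e; ring.
have eE' : A * B / q0 = B * e by rewrite /e; ring.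
move: jG q26 eta16; rewrite eE eE'; move: s0; clear; lra.
Qed.

End Profiles.

(** * Profiles for positive reactions: the linear resolvent and flat gradients *)

Section PositiveProfiles.
Context {R : realType}.
Implicit Types (g k p dp : R -> R).

Definition resolves (nu : R) k (y : R -> R) :=
  periodic y /\ forall x : R, is_derive x 1 y ((y x - k x) / nu).

Lemma resolves_continuous (nu : R) k (y : R -> R) : resolves nu k y -> continuous y.
Proof. by move=> [_ dy] x; exact: is_derive_continuous (dy x). Qed.

(** Where the periodic function [y] is maximal its derivative vanishes, so
    there [y = k]. *)
Lemma resolves_le (nu : R) k (y : R -> R) (M : R) : 0 < nu -> resolves nu k y ->
  (forall x, k x <= M) -> forall x, y x <= M.
Proof.
move=> nu0 ry kM x; have [yp dy] := ry.
have [c cM] := periodic_max (resolves_continuous ry) yp.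
apply: le_trans (cM x) _.
have : is_derive c 1 y 0.
  apply: (@derive1_at_max _ y (c - 1) (c + 1)).
  - lra.
  - by move=> t _; have [] := dy t.
  - by rewrite in_itv/=; lra.
  - by move=> t _; exact: cM.
move=> [_ E0]; have [_] := dy c; rewrite E0 => /esym/eqP.
rewrite mulf_eq0 invr_eq0 [nu == 0]gt_eqF// orbF subr_eq0 => /eqP ->.
exact: kM.
Qed.

Lemma resolvesN (nu : R) k (y : R -> R) : resolves nu k y -> resolves nu (fun x => - k x) (fun x => - y x).
Proof.
move=> [yp dy]; split=> [x i|x]; first by rewrite yp.
by have := is_deriveN (dy x); rewrite -mulNr opprB addrC opprK.
Qed.

Lemma resolves_ge (nu : R) k (y : R -> R) (M : R) : 0 < nu -> resolves nu k y ->
  (forall x, M <= k x) -> forall x, M <= y x.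
Proof.
move=> nu0 ry kM x; rewrite -lerN2.
by apply: (resolves_le nu0 (resolvesN ry)) => z; rewrite lerN2.
Qed.

Lemma resolves_dist (nu : R) k1 (y1 : R -> R) k2 (y2 : R -> R) (e : R) : 0 < nu ->
  resolves nu k1 y1 -> resolves nu k2 y2 ->
  (forall x, `|k1 x - k2 x| <= e) -> forall x, `|y1 x - y2 x| <= e.
Proof.
move=> nu0 [y1p dy1] [y2p dy2] ke x.
have rB : resolves nu (fun x => k1 x - k2 x) (fun x => y1 x - y2 x).
  split=> [z i|z]; first by rewrite y1p y2p.
  by apply: (is_derive_eq (is_deriveB (dy1 z) (dy2 z))); ring.
rewrite ler_norml; apply/andP; split.
  by apply: (resolves_ge nu0 rB) => z; have := ke z; rewrite ler_norml => /andP[].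
by apply: (resolves_le nu0 rB) => z; have := ke z; rewrite ler_norml => /andP[].
Qed.

Lemma is_derive_exp_lin (a x : R) :
  is_derive x 1 (fun s => expR (a * s)) (a * expR (a * x)).
Proof.
have h : is_derive x 1 (fun s : R => a * s) a.
  by apply: is_derive_eq; rewrite /GRing.scale/= mulr1.
by have := is_derive1_comp (is_derive_expR (a * x)) h; rewrite mulrC.
Qed.

(** Variation of constants, the constant being the one for which the solution
    takes the same value at 0 and 1. *)
Lemma resolves_exists (nu : R) k : 0 < nu -> continuous k -> periodic k ->
  exists y, resolves nu k y.
Proof.
move=> nu0 ck kp.
pose b := nu^-1; have b0 : 0 < b by rewrite invr_gt0.
have ch : continuous (fun s => b * expR (- b * s) * k s).
  move=> x; apply: cvgM; last exact: ck.
  apply: cvgM; first exact: cvg_cst.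
  exact: (is_derive_continuous (is_derive_exp_lin (- b) x)).
have [H [H0 dH]] := primitive_exists ch.
have E1 : expR b - 1 != 0.
  by rewrite subr_eq0 gt_eqF// -expR0 ltr_expR.
pose C := expR b * H 1 / (expR b - 1).
pose y x := expR (b * x) * (C - H x).
have dy (x : R) : is_derive x 1 y ((y x - k x) / nu).
  apply: (is_derive_eq (is_deriveM (is_derive_exp_lin b x) (is_deriveB (is_derive_cst C x 1) (dH x)))); rewrite /GRing.scale/= sub0r /y -/b.
  have e : expR (b * x) * expR (- b * x) = 1 by rewrite mulNr expRxMexpNx_1.
  rewrite /cst mulrN mulrBl; have -> : expR (b * x) * (b * expR (- b * x) * k x) = b * (expR (b * x) * expR (- b * x)) * k x by ring.
  by rewrite e; ring.
exists y; split => //; apply: periodic1 => x.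
pose z s := y (s + 1) - y s.
have dz (s : R) : is_derive s 1 z (b * z s).
  have h1 : is_derive s 1 (fun h => y (h + 1)) ((y (s + 1) - k (s + 1)) / nu).
    exact: is_derive_comp_shift.
  apply: (is_derive_eq (is_deriveB h1 (dy s))).
  by rewrite (kp s 1%:Z) /z -/b; ring.
have z0 : z 0 = 0.
  rewrite /z /y add0r mulr1 mulr0 expR0 mul1r H0 subr0 /C; field.
  by rewrite E1.
have := @derive0_cst R (fun s => expR (- b * s) * z s) _ x 0.
rewrite z0 mulr0 => /(_ _)/eqP; rewrite mulf_eq0 gt_eqF ?expR_gt0//=.
rewrite subr_eq0 => h; apply/eqP/h => s.
apply: (is_derive_eq (is_deriveM (is_derive_exp_lin (- b) s) (dz s))).
by rewrite /GRing.scale/=; ring.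
Qed.

(** For [p = 1 / r] the speed is [q p' + g / p].  The inequality
    [1 / p >= 2 - p] gives [1 / p] a mean at least 1, and [1 / (p + 1)] has mean
    at most 1, hence some [1 / (p + b)] with [0 <= b <= 1] has mean exactly 1;
    the shift by [b] leaves [p'] unchanged and decreases [g / p]. *)
Lemma profile_of_slope g (c eta q0 a : R) p dp :
  (forall s, 0 < g s) -> (forall s : R, is_derive s 1 p (dp s)) -> periodic p ->
  (forall s, 0 < p s) -> has_mean p a -> a <= 1 ->
  (forall q s, 0 <= q -> `|q - q0| <= eta * (1 + q0) -> q * dp s + g s / p s <= c) ->
  exists S r rho, profile g c eta q0 S r rho.
Proof.
move=> g0 dp_ pp p0 pm a1 H.
have cp : continuous p by move=> x; exact: is_derive_continuous (dp_ x).
have [d dM] := periodic_min cp pp.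
have p0d : 0 < p d by [].
have ci (b : R) : 0 <= b -> continuous (fun s => (p s + b)^-1).
  move=> b0 x; apply: cvgV; first by rewrite gt_eqF// ltr_pwDl.
  by apply: cvgD; [exact: cp|exact: cvg_cst].
pose I (b : R) : R := \int[lebesgue_measure]_(s in `[0, 1]) (p s + b)^-1.
have I_mean b (b0 : 0 <= b) : has_mean (fun s => (p s + b)^-1) (I b).
  exact: continuous_has_mean (ci b b0).
have I0 : 1 <= I 0.
  have h := has_meanD (has_mean_cst 2) (has_meanZ (- 1) pm).
  apply: le_trans (has_mean_le h (I_mean 0 (lexx 0)) _); first lra.
  move=> x; rewrite addr0 mulN1r.
  have : 0 <= (p x - 1) ^+ 2 / p x by rewrite divr_ge0 ?sqr_ge0// ltW.
  have -> : (p x - 1) ^+ 2 / p x = p x + (p x)^-1 - 2.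
    by field; rewrite gt_eqF.
  lra.
have I1 : I 1 <= 1.
  apply: (has_mean_le (I_mean 1 ler01) (has_mean_cst 1)) => x.
  by rewrite invf_le1 ?addr_gt0// lerDr ltW.
have I_lip u v : 0 <= u -> 0 <= v -> I u <= I v + (p d) ^- 2 * `|u - v|.
  move=> u0 v0.
  have h := has_meanD (I_mean v v0) (has_mean_cst ((p d) ^- 2 * `|u - v|)).
  apply: (has_mean_le (I_mean u u0) h) => x.
  have pu : 0 < p x + u by rewrite ltr_pwDl.
  have pv : 0 < p x + v by rewrite ltr_pwDl.
  rewrite -lerBlDl.
  have -> : (p x + u)^-1 - (p x + v)^-1 = ((p x + u) * (p x + v))^-1 * (v - u).
    by field; rewrite !gt_eqF.
  rewrite (le_trans (ler_norm _))// normrM distrC ler_wpM2r//.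
  rewrite gtr0_norm ?invr_gt0 ?mulr_gt0// lef_pV2 ?posrE ?mulr_gt0 ?exprn_gt0//.
  by rewrite expr2 ler_pM// ?(ltW p0d)//; have := dM x; lra.
have cI : continuous (fun b : R => I `|b|).
  apply: (@dist_le_continuous _ _ (fun b : R => I `|b|) ((p d) ^- 2)) => u v.
  have half a' b : I `|a'| - I `|b| <= (p d) ^- 2 * `|a' - b|.
    rewrite lerBlDl; apply: (le_trans (I_lip _ _ (normr_ge0 a') (normr_ge0 b))).
    by rewrite lerD2l ler_wpM2l ?invr_ge0 ?exprn_ge0 ?ler_dist_dist// ltW.
  by rewrite ler_norml lerNl opprB half distrC half.
have [b b0 Ib] : exists2 b, 0 <= b & I b = 1.
  have [] := @IVT _ (fun b : R => I `|b|) 0 1 1 ler01.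
  - exact: continuous_subspaceT.
  - by rewrite normr0 normr1 ge_min le_max I1 I0 orbT.
  - by move=> b _ Ib; exists `|b|.
have pb s : 0 < p s + b by rewrite ltr_pwDl.
suff [S HS] : exists S, profile g c eta q0 S (fun s => (p s + b)^-1) (fun s => - (p s + b) ^- 2 * dp s) by exists S, (fun s => (p s + b)^-1), (fun s => - (p s + b) ^- 2 * dp s).
apply: profile_of_density.
- move=> s.
  have h := is_deriveD (dp_ s) (is_derive_cst b s 1); rewrite addr0 in h.
  have h2 := @is_deriveV R (fun z => p z + b) s _ 1 (lt0r_neq0 (pb s)) h.
  by apply: (is_derive_eq h2).
- by move=> x i; rewrite pp.
- by rewrite -Ib; exact: I_mean.
- by move=> s; rewrite invr_gt0.
move=> q s q_ge0 Hq; apply: le_trans (H q s q_ge0 Hq).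
have -> : (p s + b)^-1 * g s - q * (- (p s + b) ^- 2 * dp s / (p s + b)^-1 ^+ 2) =
   q * dp s + g s / (p s + b).
  by field; rewrite gt_eqF.
rewrite lerD2l ler_pM2l// lef_pV2 ?posrE//; lra.
Qed.


(** For vanishing [q] the speed [g / p + q p'] is nearly constant for [p]
    proportional to [g].  As [g] is only Lipschitz, it is replaced by its
    resolvent, which is differentiable and close to [g]. *)
Lemma flat_profile g (m sigma : R) : lipschitz g -> periodic g -> (forall s, 0 < g s) ->
  has_mean g m -> 0 < sigma -> exists eta qmin : R, [/\ 0 < eta, 0 < qmin &
    forall q0, 0 <= q0 <= qmin -> exists S r rho, profile g (m + sigma) eta q0 S r rho].
Proof.
move=> lg gp g0 gm s0.
have [l l0 gl] := lipschitz_le lg.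
have cg : continuous g by exact: dist_le_continuous gl.
have [d dM] := periodic_min cg gp.
have gd := g0 d.
pose c := m + sigma / 2.
have m0 : 0 < m.
  by apply: lt_le_trans gd _; exact: (has_mean_le (has_mean_cst (g d)) gm).
have c0 : 0 < c by rewrite /c; lra.
pose nu := sigma * g d / (4 * c * l).
have nu0 : 0 < nu by rewrite divr_gt0 ?mulr_gt0.
have [y ry] := resolves_exists nu0 cg gp.
have [yp dy] := ry.
have yd := resolves_ge nu0 ry dM.
have dyl s : `|(y s - g s) / nu| <= l.
  rewrite leNgt; apply/negP => abs.
  have e0 : 0 < `|(y s - g s) / nu| - l by rewrite subr_gt0.
  have [r r0 rP] := is_derive_approx (dy s) (divr_gt0 e0 (ltr0Sn R 1)).
  have h0 : 0 < r / 2 by rewrite divr_gt0.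
  have hr : r / 2 < r by rewrite ltr_pdivrMr// ltr_pMr// ltr1n.
  have := rP (r / 2); rewrite gtr0_norm// => /(_ hr).
  have rs : resolves nu (fun x => g (x + r / 2)) (fun x => y (x + r / 2)).
    split=> [x i|x]; first by rewrite addrAC yp.
    exact: is_derive_comp_shift.
  have gs x : `|g (x + r / 2) - g x| <= l * (r / 2).
    by rewrite (le_trans (gl _ _))// addrC addKr gtr0_norm.
  have := resolves_dist nu0 rs ry gs s.
  set D := (y s - g s) / nu in abs e0 *; set E := y (s + _) - y s => h1 h2.
  have : `|D * (r / 2)| <= `|E| + `|E - D * (r / 2)|.
    rewrite [in leLHS](_ : D * (r / 2) = E - (E - D * (r / 2))); last by ring.
    exact: ler_normB.
  rewrite normrM [`|r / 2|]gtr0_norm// => h3.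
  have : 0 < (`|D| - l) / 2 * (r / 2) by rewrite !mulr_gt0.
  lra.
have ym : has_mean y m.
  have := has_meanD (has_meanZ nu (has_mean_derive yp dy)) gm.
  rewrite mulr0 add0r; rewrite (_ : (fun x => _) = y)//; apply/funext => x.
  by field; rewrite gt_eqF.
pose qmin := Num.min 1 (sigma * c / (8 * l)).
pose eta := qmin / 2.
have qmin0 : 0 < qmin by rewrite lt_min ltr01 divr_gt0 ?mulr_gt0.
have qmin1 : qmin <= 1 by rewrite ge_min lexx.
have qmin2 : 2 * qmin * l <= sigma / 4 * c.
  have : qmin <= sigma * c / (8 * l) by rewrite ge_min lexx orbT.
  by rewrite ler_pdivlMr ?mulr_gt0//; lra.
have eta0 : 0 < eta by rewrite divr_gt0.
exists eta, qmin; split => // q0 /andP[q00 q0m].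
apply: (@profile_of_slope g (m + sigma) eta q0 (m / c) (fun x => y x / c) (fun x => (y x - g x) / nu / c)) => //.
- move=> s; apply: (is_derive_eq (is_deriveM (dy s) (is_derive_cst c^-1 s 1))).
  by rewrite /GRing.scale/= mulr0 add0r mulrC.
- by move=> x i; rewrite yp.
- by move=> s; rewrite divr_gt0// (lt_le_trans gd).
- by have := has_meanZ c^-1 ym; rewrite mulrC; congr has_mean; apply/funext => x; rewrite mulrC.
- by rewrite ler_pdivrMr// mul1r /c lerDl divr_ge0// ltW.
move=> q s q_ge0 Hq.
have q2 : q <= 2 * qmin.
  move: Hq; rewrite ler_norml => /andP[_ Hq].
  have : eta * q0 <= eta * 1 by rewrite ler_pM2l//; lra.
  rewrite mulr1 /eta => h; move: Hq; rewrite mulrDr mulr1 -/eta; rewrite /eta in h *; lra.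
have t1 : q * ((y s - g s) / nu / c) <= sigma / 4.
  have -> : q * ((y s - g s) / nu / c) = q * ((y s - g s) / nu) / c by ring.
  rewrite ler_pdivrMr//; apply: le_trans qmin2.
  have : q * ((y s - g s) / nu) <= q * l by rewrite ler_wpM2l// (le_trans (ler_norm _)).
  have : q * l <= 2 * qmin * l by rewrite ler_wpM2r// ltW.
  lra.
have t2 : g s / (y s / c) <= c + sigma / 4.
  rewrite invf_div mulrA ler_pdivrMr; last exact: lt_le_trans gd (yd s).
  have : g s <= y s + nu * l.
    have := dyl s; rewrite normrM [`|nu^-1|]gtr0_norm ?invr_gt0// ler_pdivrMr//.
    by rewrite ler_norml => /andP[]; lra.
  have nul : nu * l * c = sigma / 4 * g d by rewrite /nu; field; rewrite !gt_eqF.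
  move=> h; have : (g s) * c <= (y s + nu * l) * c by rewrite ler_wpM2r// ltW.
  have : sigma / 4 * g d <= sigma / 4 * y s by rewrite ler_wpM2l ?divr_ge0// ltW.
  lra.
rewrite /c in t2 *; lra.
Qed.

End PositiveProfiles.

(** * Profiles for positive reactions: arbitrary gradients *)

Section MiddleProfiles.
Context {R : realType}.
Implicit Types (g : R -> R).

Lemma expr_small (th a tau : R) : 0 <= th < 1 -> 0 < tau -> exists j : nat, th ^+ j * a <= tau.
Proof.
move=> /andP[t0 t1] tau0.
have : (fun j : nat => th ^+ j * a) @ \oo --> 0 * a.
  by apply: cvgMl; apply: cvg_expr; rewrite ger0_norm.
rewrite mul0r => /cvgrPdist_le/(_ tau tau0)[j _ jP]; exists j.
have := jP j (leqnn j); rewrite sub0r normrN; exact: le_trans (ler_norm _).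
Qed.

(** A fixed point [w = p] solves [nu Lam p' = c - g / p].  The map from [w] to
    the right-hand side that is resolved is nondecreasing in [w] and a contraction
    on the functions with values in [lo, hi], uniformly in [nu], and the resolvent
    does not increase distances: finitely many iterations suffice. *)
Lemma near_fixpoint g (c lo hi Lam gd tau nu : R) : continuous g -> periodic g ->
  0 < lo -> lo <= hi -> 0 < Lam -> 0 < gd -> (forall s, gd <= g s) ->
  (forall s, c * lo <= g s <= c * hi) -> (forall s, g s <= Lam * lo ^+ 2) ->
  0 < tau -> 0 < nu ->
  exists w p : R -> R, [/\ forall s, lo <= w s <= hi, forall s, lo <= p s <= hi,
    forall s, `|p s - w s| <= tau & resolves nu (fun s => w s - (c - g s / w s) / Lam) p].
Proof.
move=> cg gp lo0 lohi Lam0 gd0 gdP gc gL tau0 nu0.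
have hi0 : 0 < hi by exact: lt_le_trans lohi.
pose N (w : R -> R) s := w s - (c - g s / w s) / Lam.
(* The contraction factor. *)
pose th := 1 - gd / (Lam * hi ^+ 2).
have fac s (a b : R) : lo <= a <= hi -> lo <= b <= hi -> 0 <= 1 - g s / (Lam * (a * b)) <= th.
  move=> /andP[a1 a2] /andP[b1 b2].
  have a0 : 0 < a by exact: lt_le_trans a1.
  have b0 : 0 < b by exact: lt_le_trans b1.
  have Lab : 0 < Lam * (a * b) by rewrite !mulr_gt0.
  rewrite subr_ge0 ler_pdivrMr// mul1r lerD2l lerN2; apply/andP; split.
    by rewrite (le_trans (gL s))// ler_wpM2l ?(ltW Lam0)// expr2 ler_pM// ltW.
  rewrite ler_pM ?(ltW gd0) ?invr_ge0 ?mulr_ge0 ?exprn_ge0 ?(ltW Lam0) ?(ltW hi0)//.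
  rewrite lef_pV2 ?posrE// ?mulr_gt0 ?exprn_gt0//.
  by rewrite ler_wpM2l ?(ltW Lam0)// expr2 ler_pM// ltW.
have th01 : 0 <= th < 1.
  have hh : lo <= hi <= hi by rewrite lohi lexx.
  have /andP[h1 h2] := fac 0 hi hi hh hh.
  by rewrite (le_trans h1 h2)/= /th gtrBl divr_gt0 ?mulr_gt0 ?exprn_gt0.
(* Differences of [N] are differences of the arguments times a factor in
   [0, th]: this gives both the monotonicity and the contraction. *)
have NE (s a b : R) : 0 < a -> 0 < b ->
   (a - (c - g s / a) / Lam) - (b - (c - g s / b) / Lam) = (a - b) * (1 - g s / (Lam * (a * b))).
  by move=> a0 b0; field; rewrite !gt_eqF.
have Nrange w s : lo <= w s <= hi -> lo <= N w s <= hi.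
  move=> ws; have /andP[w1 w2] := ws.
  have w0 : 0 < w s by exact: lt_le_trans w1.
  have /andP[h1 h2] := gc s.
  apply/andP; split.
    have lolo : lo <= lo <= hi by rewrite lexx.
    have /andP[f0 _] := fac s _ _ ws lolo.
    have : 0 <= (w s - lo) * (1 - g s / (Lam * (w s * lo))) by rewrite mulr_ge0// subr_ge0.
    rewrite -NE// -/(N w s).
    suff : (c - g s / lo) / Lam <= 0 by lra.
    by rewrite ler_pdivrMr// mul0r subr_le0 ler_pdivlMr.
  have hh : lo <= hi <= hi by rewrite lohi lexx.
  have /andP[f0 _] := fac s _ _ hh ws.
  have : 0 <= (hi - w s) * (1 - g s / (Lam * (hi * w s))) by rewrite mulr_ge0// subr_ge0.
  rewrite -NE// -/(N w s).
  suff : 0 <= (c - g s / hi) / Lam by lra.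
  by rewrite divr_ge0 ?(ltW Lam0)// subr_ge0 ler_pdivrMr.
have Ncont w : continuous w -> (forall s, lo <= w s <= hi) -> continuous (N w).
  move=> cw wr x; rewrite /N; apply: cvgB; first exact: cw.
  apply: cvgMl; apply: cvgB; first exact: cvg_cst.
  apply: cvgM; first exact: cg.
  apply: cvgV; last exact: cw.
  by rewrite gt_eqF// (lt_le_trans lo0)//; have /andP[] := wr x.
have step w : continuous w -> periodic w -> (forall s, lo <= w s <= hi) ->
    exists p, [/\ resolves nu (N w) p, continuous p, periodic p & forall s, lo <= p s <= hi].
  move=> cw pw wr.
  have Np : periodic (N w) by move=> x i; rewrite /N pw gp.
  have [p rp] := resolves_exists nu0 (Ncont w cw wr) Np.
  exists p; split => //; first exact: resolves_continuous rp.
    by have [] := rp.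
  have NB s := Nrange w s (wr s).
  move=> s; apply/andP; split.
    by apply: (resolves_ge nu0 rp) => x; have /andP[] := NB x.
  by apply: (resolves_le nu0 rp) => x; have /andP[] := NB x.
have [j jP] := expr_small hi th01 tau0.
suff [w [p [wr pr pw rp]]] : exists w p : R -> R, [/\ forall s, lo <= w s <= hi,
    forall s, lo <= p s <= hi, forall s, `|p s - w s| <= th ^+ j * hi &
    resolves nu (N w) p].
  by exists w, p; split => // s; exact: le_trans (pw s) jP.
elim: j {jP} => [|j [w [p [wr pr pw rp]]]].
  have lor (s : R) : lo <= lo <= hi by rewrite lexx.
  have [p [rp cp pp pr]] := step (fun=> lo) (fun x => cvg_cst lo) (fun _ _ => erefl) lor.
  exists (fun=> lo), p; split => // s; rewrite expr0 mul1r.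
  have /andP[h1 h2] := pr s; rewrite ger0_norm ?subr_ge0// lerBlDr.
  by rewrite (le_trans h2)// lerDl ltW.
have [p' [rp' cp' pp' pr']] := step p (resolves_continuous rp) rp.1 pr.
exists p, p'; split => //.
apply: (resolves_dist nu0 rp' rp) => s.
have /andP[w1 _] := wr s; have /andP[p1 _] := pr s.
rewrite /N NE; [|exact: lt_le_trans p1|exact: lt_le_trans w1].
rewrite normrM exprS -mulrA mulrC.
have /andP[f0 f1] := fac s _ _ (pr s) (wr s).
by rewrite ler_pM// ger0_norm.
Qed.

(** An approximate solution [p] of [q0 p' + g / p = c] with [c = m + sigma / 2].
    Multiplying by [p] and integrating over a period gives [c * mean p <= c] once
    the error of the approximation is small, which is the condition needed in
    [profile_of_slope].  Since [q0 p'] is bounded, moving [q] by a small multiple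
    of [q0] changes the speed little. *)
Lemma middle_profile g (m sigma qmin : R) : continuous g -> periodic g ->
  (forall s, 0 < g s) -> has_mean g m -> 0 < sigma -> 0 < qmin ->
  exists eta : R, 0 < eta /\
    forall q0, qmin <= q0 -> exists S r rho, profile g (m + sigma) eta q0 S r rho.
Proof.
move=> cg gp g0 gm s0 qm0.
have [d dM] := periodic_min cg gp.
have [D DM] := periodic_max cg gp.
have gd := g0 d; have gD := g0 D.
pose c := m + sigma / 2.
have m0 : 0 < m.
  by apply: lt_le_trans gd _; exact: (has_mean_le (has_mean_cst (g d)) gm).
have c0 : 0 < c by rewrite /c; lra.
pose lo := g d / c; pose hi := g D / c.
have lo0 : 0 < lo by rewrite divr_gt0.
have hi0 : 0 < hi by rewrite divr_gt0.
have lohi : lo <= hi by rewrite ler_pM2r ?invr_gt0.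
pose Lam := g D / lo ^+ 2.
have Lam0 : 0 < Lam by rewrite divr_gt0 ?exprn_gt0.
have gc s : c * lo <= g s <= c * hi.
  by rewrite /lo /hi ![c * _]mulrC !divfK ?gt_eqF// dM DM.
have gL s : g s <= Lam * lo ^+ 2 by rewrite /Lam divfK ?DM// gt_eqF// exprn_gt0.
pose M := Lam + g D / lo ^+ 2.
have M0 : 0 < M by rewrite addr_gt0// divr_gt0 ?exprn_gt0.
pose e := Num.min (sigma / 4) (sigma / (2 * hi)).
have e0 : 0 < e by rewrite lt_min !divr_gt0// mulr_gt0.
have e1 : e <= sigma / 4 by rewrite ge_min lexx.
have e2 : hi * e <= sigma / 2.
  have h : e <= sigma / (2 * hi) by rewrite ge_min lexx orbT.
  apply: (le_trans (ler_wpM2l (ltW hi0) h)).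
  by rewrite le_eqVlt; apply/orP; left; apply/eqP; field; rewrite gt_eqF.
pose tau := e / M.
have tau0 : 0 < tau by rewrite divr_gt0.
pose C1 := c + g D / lo + e.
have C10 : 0 < C1 by rewrite !addr_gt0// divr_gt0.
pose eta := sigma / (4 * (C1 * (1 + qmin^-1))).
have iq0 : 0 < 1 + qmin^-1 by rewrite addr_gt0// invr_gt0.
exists eta; split; first by rewrite divr_gt0 ?mulr_gt0.
move=> q0 q0m; have q00 : 0 < q0 by exact: lt_le_trans q0m.
have nu0 : 0 < q0 / Lam by rewrite divr_gt0.
have [w [p [wr pr pw rp]]] := near_fixpoint cg gp lo0 lohi Lam0 gd dM gc gL tau0 nu0.
have [pp dp] := rp.
pose dp' s := (p s - (w s - (c - g s / w s) / Lam)) / (q0 / Lam).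
have w0 s : 0 < w s by apply: lt_le_trans lo0 _; have /andP[] := wr s.
have p0 s : 0 < p s by apply: lt_le_trans lo0 _; have /andP[] := pr s.
have err s : `|q0 * dp' s + g s / p s - c| <= e.
  have -> : q0 * dp' s + g s / p s - c = (p s - w s) * (Lam - g s / (p s * w s)).
    by rewrite /dp'; field; rewrite !gt_eqF.
  rewrite normrM; apply: (@le_trans _ _ (tau * M)); last by rewrite /tau divfK// gt_eqF.
  apply: ler_pM => //; apply: (le_trans (ler_normB _ _)).
  rewrite (gtr0_norm Lam0) lerD2l gtr0_norm ?divr_gt0 ?mulr_gt0//.
  have lo2 : lo ^+ 2 <= p s * w s.
    by have /andP[? _] := pr s; have /andP[? _] := wr s; rewrite expr2 ler_pM ?(ltW lo0).
  apply: ler_pM; [exact: ltW|by rewrite invr_ge0 mulr_ge0 ?ltW|exact: DM|].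
  by rewrite lef_pV2 ?posrE ?exprn_gt0 ?(mulr_gt0 (p0 s) (w0 s)).
have [p_m pm] : exists pm, has_mean p pm.
  by exists (\int[lebesgue_measure]_(s in `[0, 1]) p s); apply: continuous_has_mean; exact: resolves_continuous rp.
have pm1 : p_m <= 1.
  have p2m : has_mean (fun s => p s * dp' s + dp' s * p s) 0.
    apply: (@has_mean_derive _ (fun s => p s * p s)).
      by move=> x i; rewrite pp.
    move=> x; apply: (is_derive_eq (is_deriveM (dp x) (dp x))).
    by rewrite /GRing.scale/= [dp' x * _]mulrC.
  have h1 := has_meanD (has_meanZ (q0 / 2) p2m) gm.
  have h2 := has_meanD (has_meanZ c pm) (has_mean_cst (hi * e)).
  have : c * p_m - hi * e <= q0 / 2 * 0 + m.
    have h3 := has_meanD (has_meanZ c pm) (has_mean_cst (- (hi * e))).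
    apply: (has_mean_le h3 h1) => s.
    have -> : q0 / 2 * (p s * dp' s + dp' s * p s) + g s = p s * (q0 * dp' s + g s / p s - c) + c * p s.
      by field; rewrite gt_eqF.
    rewrite addrC lerD2r -[leLHS]mulrN ; apply: le_trans (_ : p s * - e <= _).
      by rewrite !mulrN lerN2 ler_wpM2r ?(ltW e0)//; have /andP[] := pr s.
    by rewrite ler_wpM2l ?(ltW (p0 s))//; have := err s; rewrite ler_norml => /andP[].
  rewrite mulr0 add0r => h.
  have : c * p_m <= c * 1 by rewrite mulr1 {2}/c; lra.
  by rewrite ler_pM2l.
apply: (@profile_of_slope _ g (m + sigma) eta q0 p_m p dp') => //.
move=> q s q_ge0 Hq.
have := err s; rewrite ler_norml => /andP[er1 er2].
have gp_le : g s / p s <= g D / lo.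
  rewrite ler_pM ?(ltW (g0 s)) ?invr_ge0 ?(ltW (p0 s))//.
  by rewrite lef_pV2 ?posrE//; have /andP[] := pr s.
have gp0 : 0 < g s / p s by rewrite divr_gt0.
have dpC : `|dp' s| <= C1 / q0.
  rewrite ler_pdivlMr// -{1}(gtr0_norm q00) -normrM mulrC ler_norml /C1.
  by apply/andP; split; lra.
have : (q - q0) * dp' s <= sigma / 4.
  apply: (le_trans (ler_norm _)); rewrite normrM.
  apply: (@le_trans _ _ (eta * (1 + q0) * (C1 / q0))); first by rewrite ler_pM.
  have -> : eta * (1 + q0) * (C1 / q0) = eta * (C1 * (1 + q0^-1)).
    by field; rewrite gt_eqF.
  apply: (@le_trans _ _ (eta * (C1 * (1 + qmin^-1)))).
    by rewrite !ler_wpM2l ?(ltW C10)// ?lerD2l ?lef_pV2 ?posrE// divr_ge0 ?mulr_ge0 ?(ltW s0) ?(ltW C10) ?(ltW iq0).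
  rewrite le_eqVlt; apply/orP; left; apply/eqP.
  by rewrite /eta; field; rewrite !gt_eqF// addr_gt0// ?ltW.
rewrite mulrBl /c in er1 er2 *; lra.
Qed.

(** Unlike [steep_profile], this includes the flat regime [q0 = 0]; the
    positivity of [g] is what allows it. *)
Lemma positive_profile g (m sigma : R) : lipschitz g -> periodic g ->
  (forall s, 0 < g s) -> has_mean g m -> 0 < sigma ->
  exists eta : R, 0 < eta /\
    forall q0, 0 <= q0 -> exists S r rho, profile g (m + sigma) eta q0 S r rho.
Proof.
move=> lg gp g0 gm s0.
have [l _ gl] := lipschitz_le lg.
have cg : continuous g by exact: dist_le_continuous gl.
have [e1 [qm [e10 qm0 H1]]] := flat_profile lg gp g0 gm s0.
have [e2 [e20 H2]] := middle_profile cg gp g0 gm s0 qm0.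
have mono e e' q0 S r rho : 0 <= q0 -> e <= e' -> profile g (m + sigma) e' q0 S r rho ->
    profile g (m + sigma) e q0 S r rho.
  move=> q00 ee [h1 h2 h3 h4 h5]; split => // q s qq Hq; apply: h5 => //.
  by apply: le_trans Hq _; rewrite ler_wpM2r// addr_ge0.
exists (Num.min e1 e2); split; first by rewrite lt_min e10.
move=> q0 q00; have [q0m|/ltW q0m] := leP q0 qm.
  have [|S [r [rho H]]] := H1 q0; first by rewrite q00.
  by exists S, r, rho; apply: mono H => //; rewrite ge_min lexx.
have [S [r [rho H]]] := H2 q0 q0m.
by exists S, r, rho; apply: mono H => //; rewrite ge_min lexx orbT.
Qed.

End MiddleProfiles.

(** * Euclidean geometry and maxima on time strips *)

Section Dot.
Context {R : realType} {n : nat}.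
Implicit Types (x y z a b : 'rV[R]_n).

Lemma dotC x y : dot x y = dot y x.
Proof. by apply: eq_bigr => i _; rewrite mulrC. Qed.

Lemma dotDl x y z : dot (x + y) z = dot x z + dot y z.
Proof. by rewrite /dot -big_split; apply: eq_bigr => i _; rewrite mxE mulrDl. Qed.

Lemma dotZl (c : R) x z : dot (c *: x) z = c * dot x z.
Proof. by rewrite /dot mulr_sumr; apply: eq_bigr => i _; rewrite mxE mulrA. Qed.

Lemma dotNl x z : dot (- x) z = - dot x z.
Proof. by rewrite -scaleN1r dotZl mulN1r. Qed.

Lemma dotDr x y z : dot z (x + y) = dot z x + dot z y.
Proof. by rewrite dotC dotDl ![dot _ z]dotC. Qed.

Lemma dotZr (c : R) x z : dot z (c *: x) = c * dot z x.
Proof. by rewrite dotC dotZl dotC. Qed.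

Lemma dotNr x z : dot z (- x) = - dot z x.
Proof. by rewrite dotC dotNl dotC. Qed.

Definition dotE := (dotDl, dotDr, dotZl, dotZr, dotNl, dotNr).

Lemma dot0l x : dot 0 x = 0.
Proof. by rewrite -(scale0r x) dotZl mul0r. Qed.

Lemma dot_ge0 x : 0 <= dot x x.
Proof. by apply: sumr_ge0 => i _; rewrite -expr2 sqr_ge0. Qed.

Lemma dot_basis x (i : 'I_n) : dot x (basis_vec i) = x 0 i.
Proof.
rewrite /dot (bigD1 i)//= big1 => [|j ji]; first by rewrite mxE !eqxx mulr1 addr0.
by rewrite mxE eqxx (negbTE ji) mulr0.
Qed.

Lemma dot_basis_basis (i : 'I_n) : dot (basis_vec i) (basis_vec i) = 1 :> R.
Proof. by rewrite dot_basis mxE !eqxx. Qed.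

Lemma dot_shift_basis x (i : 'I_n) (h : R) :
  dot (x + h *: basis_vec i) (x + h *: basis_vec i) = dot x x + 2 * h * x 0 i + h ^+ 2.
Proof. by rewrite !dotE [dot (basis_vec i) x]dotC dot_basis dot_basis_basis; ring. Qed.

Lemma cauchy_schwarz x y : dot x y ^+ 2 <= dot x x * dot y y.
Proof.
have [y0|y0] := eqVneq (dot y y) 0.
  suff -> : dot x y = 0 by rewrite expr0n mulr_ge0 ?dot_ge0.
  rewrite /dot big1 // => i _; move/eqP: y0; rewrite psumr_eq0; last first.
    by move=> j _; rewrite -expr2 sqr_ge0.
  by move=> /allP/(_ i); rewrite mem_index_enum => /(_ isT)/=; rewrite mulf_eq0 orbb => /eqP ->; rewrite mulr0.
have yp : 0 < dot y y by rewrite lt0r y0 dot_ge0.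
have := dot_ge0 (dot y y *: x - dot x y *: y).
rewrite !dotE [dot y x]dotC.
rewrite [leRHS](_ : _ = dot y y * (dot x x * dot y y - dot x y ^+ 2)); last by ring.
by rewrite pmulr_rge0// subr_ge0.
Qed.

Lemma sqr_norm_le_dot x : `|x| ^+ 2 <= dot x x.
Proof.
have [x0|x0] := eqVneq `|x| 0; first by rewrite x0 expr0n dot_ge0.
have [[k i] E] := mx_norm_neq0 x0.
have -> : `|x| = `|x 0 i| by rewrite [LHS]E/= (ord1 k).
rewrite real_normK ?num_real// /dot (bigD1 i)//= -expr2 lerDl.
by apply: sumr_ge0 => j _; rewrite -expr2 sqr_ge0.
Qed.

Lemma dot_continuous (T : topologicalType) (f g : T -> 'rV[R]_n) :
  continuous f -> continuous g -> continuous (fun p => dot (f p) (g p)).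
Proof.
move=> cf cg; apply: continuous_big; first exact: add_continuous.
move=> i _ p; apply: cvgM.
  by apply: (@cvg_comp _ _ _ f (fun M : 'rV[R]_n => M 0 i)); [exact: cf|exact: coord_continuous].
by apply: (@cvg_comp _ _ _ g (fun M : 'rV[R]_n => M 0 i)); [exact: cg|exact: coord_continuous].
Qed.

Lemma continuous_cmul (T : topologicalType) (f : T -> R) (c : R) :
  continuous f -> continuous (fun p => c * f p).
Proof. by move=> cf x; apply: cvgMr; exact: cf. Qed.

End Dot.

Section SpaceTimeCalculus.
Context {R : realType} {n : nat}.
Implicit Types (x y : 'rV[R]_n) (f z : 'rV[R]_n * R -> R).

(** Only the pure second derivatives are recorded: they are all that the
    Laplacian and the test for a maximum along coordinate lines use. *)
Definition classical f (ft : 'rV[R]_n -> R -> R) (fx fxx : 'I_n -> 'rV[R]_n -> R -> R) :=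
  {within closed_halfspace, continuous f} /\
  forall x (t : R), 0 < t -> is_derive t 1 (fun s : R => f (x, s)) (ft x t) /\
    forall i, is_derive (0 : R) 1 (fun h : R => f (x + h *: basis_vec i, t)) (fx i x t) /\
      is_derive (0 : R) 1 (fun h : R => fx i (x + h *: basis_vec i) t) (fxx i x t).

Lemma line_is_derive (F : 'rV[R]_n -> R) (G : 'rV[R]_n -> R) (v : 'rV[R]_n) x (h : R) :
  (forall y, is_derive (0 : R) 1 (fun k : R => F (y + k *: v)) (G y)) ->
  is_derive h 1 (fun k : R => F (x + k *: v)) (G (x + h *: v)).
Proof.
move=> H; apply/is_derive_shiftP; have := H (x + h *: v).
rewrite (_ : (fun k => F (x + h *: v + k *: v)) = (fun k => F (x + (h + k) *: v)))//.
by apply/funext => k; rewrite scalerDl addrA.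
Qed.

Lemma is_derive_line (F : 'rV[R]_n -> R) x v : derivable F x v ->
  is_derive (0 : R) 1 (fun h : R => F (x + h *: v)) ('D_v F x).
Proof.
move=> dF; have E : (fun h : R => h^-1 *: ((fun k : R => F (x + k *: v)) (h *: 1 + 0) - F (x + 0 *: v)))
   = (fun h => h^-1 *: ((F \o shift x) (h *: v) - F x)).
  by apply/funext => h /=; rewrite scale0r !addr0 [h%:A]mulr1 [x + _]addrC.
split; first by move: dF; rewrite /derivable /= -E.
by rewrite /derive /= -[in RHS]E.
Qed.

(** The strip is not compact; the last hypothesis confines the maximization to
    a ball. *)
Lemma strip_max z (t0 t1 rho : R) p0 :
  0 <= t0 -> {within closed_halfspace, continuous z} ->
  t0 <= p0.2 <= t1 ->
  (forall p, t0 <= p.2 <= t1 -> rho <= dot p.1 p.1 -> z p <= z p0) ->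
  exists2 c, t0 <= c.2 <= t1 & forall p, t0 <= p.2 <= t1 -> z p <= z c.
Proof.
move=> t00 cz p0s far.
pose r := `|rho| + 1 + `|p0.1|.
pose A := [set x : 'rV[R]_n | `|x| <= r] `*` `[t0, t1]%classic.
have cA : compact A.
  apply: compact_setX; last by exact: segment_compact.
  apply: bounded_closed_compact => /=.
    by exists r; split; [exact: num_real|move=> M rM x /= /le_trans; apply; exact: ltW].
  by apply: closed_comp (@closed_le _ r) => x _; exact: norm_continuous.
have Ap0 : A p0.
  by split => //=; rewrite /r lerDr addr_ge0.
have cz' : {within A, continuous z}.
  by apply: continuous_subspaceW cz => p [_ /=]; rewrite in_itv/= => /andP[h _]; exact: le_trans h.
have [c] := compact_EVT_max (ex_intro _ p0 Ap0) cA cz'.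
rewrite inE => -[_ /=]; rewrite in_itv/= => c01 cM.
exists c => // p p01.
have [pr|pr] := leP `|p.1| r.
  by apply: cM; rewrite inE; split => //=; rewrite in_itv.
apply: (@le_trans _ _ (z p0)); last by apply: cM; rewrite inE.
apply: far => //; apply: le_trans (sqr_norm_le_dot _).
have r1 : 1 <= `|p.1| by apply: le_trans (ltW pr); rewrite /r -addrA addrCA lerDl addr_ge0.
apply: (@le_trans _ _ `|p.1|).
  apply: le_trans (ltW pr); rewrite /r -addrA; apply: le_trans (ler_norm rho) _.
  by rewrite lerDl addr_ge0.
by rewrite expr2 ler_peMr.
Qed.

End SpaceTimeCalculus.

(** * The maximum principle for the heat equation on the whole space *)

Section HeatMaximumPrinciple.
Context {R : realType} {n : nat}.
Implicit Types (x y : 'rV[R]_n) (f : 'rV[R]_n * R -> R).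

Lemma within_continuous_comp f (F : R -> R) :
  {within closed_halfspace, continuous f} -> continuous F ->
  {within closed_halfspace, continuous (fun p => F (f p))}.
Proof. by move=> cf cF p; apply: (@cvg_comp _ _ _ f F); [exact: cf|exact: cF]. Qed.

Lemma is_derive_expR_comp (q : R -> R) (dq h : R) : is_derive h 1 q dq ->
  is_derive h 1 (fun s => expR (q s)) (dq * expR (q h)).
Proof. by move=> H; apply: (is_derive_eq (is_derive1_comp (is_derive_expR _) H)); rewrite mulrC. Qed.

Lemma is_derive_cmul (c : R) (q : R -> R) (h dq : R) : is_derive h 1 q dq ->
  is_derive h 1 (fun s => c * q s) (c * dq).
Proof. by move=> H; exact: (is_deriveZ c H). Qed.

Lemma is_derive_quad (c0 c1 c2 h : R) :
  is_derive h 1 (fun s : R => c0 + c1 * s + c2 * s ^+ 2) (c1 + 2 * c2 * h).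
Proof.
have h1 := is_deriveZ c1 (is_derive_id h (1 : R)).
have h2 := is_deriveZ c2 (is_deriveX 2 (is_derive_id h (1 : R))).
have := is_deriveD (is_deriveD (is_derive_cst c0 h (1 : R)) h1) h2.
move=> HH; apply: (is_derive_eq HH); rewrite /GRing.scale/= expr1; ring.
Qed.

(** On a time interval of length [1 / (16 kappa b)] the function
    [exp (b (1 + lam (t - t0)) |x| ^ 2 + N (t - t0))] is a supersolution of the
    heat equation: the time derivative of the exponent contains
    [b lam |x| ^ 2], and with [lam = 16 kappa b] this is at least the term
    [4 kappa (2 b) ^ 2 |x| ^ 2] that bounds the one of the Laplacian.  It dominates [f] at infinity,
    so that any small multiple of it, plus a small multiple of time, dominates
    [f] everywhere. *)
Lemma heat_slab f ft fx fxx (kappa t0 t1 A a b : R) :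
  classical f ft fx fxx -> 0 < kappa -> 0 < b -> a + 1 <= b -> 0 <= t0 -> t1 <= t0 + (16 * kappa * b)^-1 ->
  (forall x t, 0 < t -> ft x t <= kappa * \sum_i fxx i x t) ->
  (forall x, f (x, t0) <= 0) ->
  (forall p, t0 <= p.2 <= t1 -> f p <= A * expR (a * dot p.1 p.1)) ->
  forall p, t0 <= p.2 <= t1 -> f p <= 0.
Proof.
move=> [cf df] k0 b0 ab t00 t1b sub f0 fA.
(* [1 / lam] is the length of the slab, so that the coefficient of [|x| ^ 2] in
   the barrier stays below [2 b]; [N] pays for the first order part of its
   Laplacian. *)
pose lam := 16 * kappa * b; pose N := 4 * n%:R * kappa * b.
have lam0 : 0 < lam by rewrite !mulr_gt0.
have N0 : 0 <= N by rewrite !mulr_ge0// ?ltW.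
pose q x := dot x x.
pose bb t := b * (1 + lam * (t - t0)).
pose B (p : 'rV[R]_n * R) := expR (bb p.2 * q p.1 + N * (p.2 - t0)).
suff H d : 0 < d -> forall p, t0 <= p.2 <= t1 -> f p - d * B p - d * (p.2 - t0) <= 0.
  move=> p p01; have := H; move=> {}H.
  apply/ler_addgt0Pr => e e0; rewrite add0r.
  have C0 : 0 < B p + (p.2 - t0) by rewrite ltr_wpDr ?expR_gt0// subr_ge0; case/andP: p01.
  have := H (e / (B p + (p.2 - t0))) (divr_gt0 e0 C0) p p01.
  rewrite -addrA -opprD -mulrDr divfK ?gt_eqF// subr_le0; exact.
move=> d0 p1 p1s; pose z p := f p - d * B p - d * (p.2 - t0).
rewrite leNgt; apply/negP => zp1.
have cz : {within closed_halfspace, continuous z}.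
  have cg : continuous (fun p : 'rV[R]_n * R => d * B p + d * (p.2 - t0)).
    have c2 : continuous (fun p : 'rV[R]_n * R => p.2 - t0).
      by move=> p; apply: cvgB; [exact: cvg_snd|exact: cvg_cst].
    move=> p; apply: cvgD; last by apply: cvgMr; exact: c2.
    apply: cvgMr; apply: (@cvg_comp _ _ _ (fun p : 'rV[R]_n * R => bb p.2 * q p.1 + N * (p.2 - t0)) expR);
      last exact: continuous_expR.
    apply: cvgD; last by apply: cvgMr; exact: c2.
    apply: cvgM; last by apply: dot_continuous; move=> ?; exact: cvg_fst.
    by apply: cvgMr; apply: cvgD; [exact: cvg_cst|apply: cvgMr; exact: c2].
  have -> : z = f - (fun p : 'rV[R]_n * R => d * B p + d * (p.2 - t0)).
    by apply/funext => p; rewrite /z !fctE opprD addrA.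
  apply: within_continuousB => //; exact: continuous_subspaceT.
have far p : t0 <= p.2 <= t1 -> `|A| / d <= dot p.1 p.1 -> z p <= z p1.
  move=> p01 Hp; apply: le_trans (ltW zp1); rewrite /z.
  have /andP[pt0 pt1] := p01.
  have q0 : 0 <= q p.1 by exact: dot_ge0.
  have hb : expR (a * q p.1) * (1 + q p.1) <= B p.
    apply: (@le_trans _ _ (expR (a * q p.1) * expR (q p.1))).
      by rewrite ler_wpM2l ?expR_ge0// expR_ge1Dx.
    rewrite -expRD ler_expR /bb -[a * _ + _]addr0 lerD ?mulr_ge0 ?subr_ge0 ?(ltW k0) ?(ltW b0)//.
    rewrite -[X in _ + X]mul1r -mulrDl ler_wpM2r//.
    by rewrite (le_trans ab)// mulrDr mulr1 lerDl !mulr_ge0 ?subr_ge0 ?(ltW b0) ?(ltW k0).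
  have : f p <= d * B p.
    apply: (le_trans (fA p p01)); apply: le_trans (ler_wpM2l (ltW d0) hb).
    rewrite mulrCA [X in X <= _]mulrC ler_wpM2l ?expR_ge0// (le_trans (ler_norm A))//.
    move: Hp; rewrite ler_pdivrMr// => Hp; apply: (le_trans Hp).
    by rewrite mulrC ler_pM2l// lerDr.
  have : 0 <= d * (p.2 - t0) by rewrite mulr_ge0 ?subr_ge0// ltW.
  lra.
have [[x t] /= ts cM] := strip_max t00 cz p1s far.
have zc : 0 < z (x, t) by exact: lt_le_trans (cM _ p1s).
have t0t : t0 < t.
  rewrite lt_neqAle; case/andP: ts => -> _; rewrite andbT; apply/eqP => E.
  move: zc; rewrite -E /z/= subrr mulr0 subr0; apply/negP; rewrite -leNgt subr_le0.
  by rewrite (le_trans (f0 x))// mulr_ge0 ?expR_ge0// ltW.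
have tp : 0 < t by exact: le_lt_trans t0t.
have [dft dfx] := df x t tp.
have dzt : is_derive t 1 (fun s => z (x, s)) (ft x t - d * (b * lam * q x + N) * B (x, t) - d).
  have h1 : is_derive t 1 (fun s => bb s * q x + N * (s - t0)) (b * lam * q x + N).
    have := is_derive_quad (b * (1 - lam * t0) * q x - N * t0) (b * lam * q x + N) 0 t.
    rewrite mulr0 mul0r addr0; rewrite (_ : (fun s => _) = (fun s => bb s * q x + N * (s - t0)))//.
    by apply/funext => s; rewrite /bb; ring.
  have h2 := is_derive_expR_comp h1.
  have h3 := is_derive_quad (- (d * t0)) d 0 t.
  have := is_deriveB (is_deriveB dft (is_derive_cmul d h2)) h3.
  rewrite (_ : (fun s => z (x, s)) = (fun s => f (x, s)) - (fun s => d * expR (bb s * q x + N * (s - t0))) - (fun s => - (d * t0) + d * s + 0 * s ^+ 2)); last first.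
    by apply/funext => s; rewrite /z /B/= !fctE /GRing.scale/=; ring.
  by move=> HH; apply: (is_derive_eq HH); rewrite /B /GRing.scale/=; ring.
have Et : d <= ft x t - d * (b * lam * q x + N) * B (x, t).
  rewrite -subr_ge0; apply: (derive_at_right_end_max t0t dzt) => s /andP[s0 s1].
  by apply: cM => /=; rewrite s0 (le_trans s1)//; case/andP: ts.
have Ex i : fxx i x t <= d * (4 * (bb t) ^+ 2 * (x 0 i) ^+ 2 + 2 * bb t) * B (x, t).
  pose qq h := bb t * (q x + 2 * h * x 0 i + h ^+ 2) + N * (t - t0).
  have dqq (h : R) : is_derive h 1 qq (2 * bb t * x 0 i + 2 * bb t * h).
    have := is_derive_quad (bb t * q x + N * (t - t0)) (2 * bb t * x 0 i) (bb t) h.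
    rewrite (_ : (fun s => _) = qq)//.
    by apply/funext => s; rewrite /qq; ring.
  have dE (h : R) := is_derive_expR_comp (dqq h).
  have z1 (h : R) : is_derive h 1 (fun h => z (x + h *: basis_vec i, t))
       (fx i (x + h *: basis_vec i) t - d * ((2 * bb t * x 0 i + 2 * bb t * h) * expR (qq h))).
    have h1 := @line_is_derive _ _ (fun y => f (y, t)) (fun y => fx i y t) (basis_vec i) x h (fun y => ((df y t tp).2 i).1).
    have := is_deriveB (is_deriveB h1 (is_derive_cmul d (dE h))) (is_derive_cst (d * (t - t0)) h 1).
    rewrite (_ : (fun h => z _) = (fun k => f (x + k *: basis_vec i, t)) - (fun s => d * expR (qq s)) - cst (d * (t - t0))); last first.
      by apply/funext => s; rewrite /z /B/= /q dot_shift_basis.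
    by move=> HH; apply: (is_derive_eq HH); rewrite subr0.
  have [] := @second_derivative_max _ _ _ (fxx i x t - d * ((4 * bb t ^+ 2 * x 0 i ^+ 2 + 2 * bb t) * expR (qq 0))) z1.
  - have h3 : is_derive (0 : R) 1 (fun h : R => 2 * bb t * x 0 i + 2 * bb t * h) (2 * bb t).
      have := @is_derive_quad (2 * bb t * x 0 i) (2 * bb t) 0 0.
      rewrite mulr0 addr0 (_ : (fun s => _) = (fun h : R => 2 * bb t * x 0 i + 2 * bb t * h))//.
      by apply/funext => s; rewrite mul0r addr0.
    have := is_deriveB (dfx i).2 (is_derive_cmul d (is_deriveM h3 (dE 0))).
    by move=> HH; apply: (is_derive_eq HH); rewrite /GRing.scale/= mulr0 addr0; ring.
  - by move=> h; rewrite scale0r addr0; exact: cM.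
  have -> : expR (qq 0) = B (x, t) by rewrite /qq /B mulr0 mul0r expr0n/= !addr0.
  by move=> _; rewrite subr_le0 mulrA.
have S1 : \sum_i fxx i x t <= d * (4 * bb t ^+ 2 * q x + 2 * n%:R * bb t) * B (x, t).
  apply: (le_trans (ler_sum _ (fun i _ => Ex i))).
  rewrite -mulr_suml -mulr_sumr big_split/= -mulr_sumr sumr_const card_ord.
  have -> : \sum_(i < n) x 0 i ^+ 2 = q x by apply: eq_bigr => i _; rewrite expr2.
  by rewrite -[_ *+ n]mulr_natr [2 * n%:R * _]mulrAC.
have b2 : b <= bb t <= 2 * b.
  rewrite /bb mulrDr mulr1 lerDl !mulr_ge0 ?(ltW b0) ?(ltW k0) ?subr_ge0 ?(ltW t0t)//=.
  have : lam * (t - t0) <= 1.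
    rewrite mulrC -ler_pdivlMr// div1r lerBlDl; apply: le_trans t1b.
    by case/andP: ts.
  rewrite -(ler_pM2l b0) mulr1 => h; rewrite mulr_natl mulr2n.
  by rewrite lerD2l.
have key : kappa * (4 * bb t ^+ 2 * q x + 2 * n%:R * bb t) <= b * lam * q x + N.
  case/andP: b2 => b2 b3; rewrite mulrDr; apply: lerD.
    have -> : kappa * (4 * bb t ^+ 2 * q x) = 4 * kappa * bb t ^+ 2 * q x by ring.
    rewrite ler_wpM2r ?dot_ge0//.
    have -> : b * lam = 4 * kappa * (2 * b) ^+ 2 by rewrite /lam; ring.
    have bb0 : 0 <= bb t by exact: le_trans (ltW b0) b2.
    by apply: ler_wpM2l; [rewrite !mulr_ge0// ltW|rewrite !expr2; exact: ler_pM].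
  have -> : N = kappa * (2 * n%:R * (2 * b)) by rewrite /N; ring.
  by rewrite !ler_wpM2l ?mulr_ge0 ?(ltW k0).
have := sub x t tp.
have B0 : 0 < B (x, t) by exact: expR_gt0.
have : kappa * \sum_i fxx i x t <= d * (b * lam * q x + N) * B (x, t).
  apply: (le_trans (ler_wpM2l (ltW k0) S1)).
  have -> : kappa * (d * (4 * bb t ^+ 2 * q x + 2 * n%:R * bb t) * B (x, t)) =
    d * B (x, t) * (kappa * (4 * bb t ^+ 2 * q x + 2 * n%:R * bb t)) by ring.
  rewrite [leRHS]mulrAC ler_wpM2l// mulr_ge0 ?(ltW d0) ?(ltW B0)//.
lra.
Qed.

(** The slabs of [heat_slab] have a fixed length, so finitely many of them
    reach time [T]. *)
Lemma heat_max f ft fx fxx (kappa T : R) :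
  classical f ft fx fxx -> 0 < kappa ->
  (forall x t, 0 < t -> ft x t <= kappa * \sum_i fxx i x t) ->
  (forall x, f (x, 0) <= 0) ->
  (exists A a : R, forall p, 0 <= p.2 <= T -> f p <= A * expR (a * dot p.1 p.1)) ->
  forall p, 0 <= p.2 <= T -> f p <= 0.
Proof.
move=> cf k0 sub f0 [A [a fA]].
pose b := `|a| + 1.
have b0 : 0 < b by rewrite ltr_wpDl.
have ab : a + 1 <= b by rewrite lerD2r ler_norm.
pose s := (16 * kappa * b)^-1.
have s0 : 0 < s by rewrite invr_gt0 !mulr_gt0.
have H (k : nat) : forall p, 0 <= p.2 <= T -> p.2 <= k%:R * s -> f p <= 0.
  elim: k => [|k IH] [x t] /= /andP[t0 tT].
    by rewrite mul0r => t0'; have -> : t = 0 by apply/eqP; rewrite eq_le t0 t0'.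
  move=> tk; have [tk'|tk'] := leP t (k%:R * s).
    by apply: IH => //=; rewrite t0.
  have ks0 : 0 <= k%:R * s by rewrite mulr_ge0// ltW.
  apply: (@heat_slab f ft fx fxx kappa (k%:R * s) t A a b) => //=.
  - by apply: (le_trans tk); rewrite -natr1 mulrDl mul1r.
  - by move=> y; apply: IH => //=; rewrite ks0 (le_trans (ltW tk')).
  - move=> p /andP[p0 p1]; apply: fA; rewrite (le_trans ks0 p0) (le_trans p1)//.
  - by rewrite (ltW tk') lexx.
move=> p p0; apply: (H (Num.truncn (p.2 / s)).+1) => //.
by rewrite -ler_pdivrMr// ltW// truncnS_gt.
Qed.

End HeatMaximumPrinciple.

(** * Comparison by doubling the spatial variable *)

Section Comparison.
Context {R : realType} {n : nat}.
Implicit Types (x y : 'rV[R]_n) (f : 'rV[R]_n * R -> R) (phi : 'rV[R]_n -> R).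

Definition smooth phi (G : 'rV[R]_n -> 'rV[R]_n) (H : 'I_n -> 'rV[R]_n -> R) :=
  continuous phi /\ forall x i,
    is_derive (0 : R) 1 (fun h : R => phi (x + h *: basis_vec i)) (G x 0 i) /\
    is_derive (0 : R) 1 (fun h : R => G (x + h *: basis_vec i) 0 i) (H i x).

(** [y] is chosen first, as an almost maximizer; the maximum in [(x, t)] for
    this [y] is then attained, and competing with [y = x] shows that
    [D |x - y| ^ 2 <= 3 eps].  At the maximum, with [w = u / eps],
    [r grad u = G x + 2 D (x - y)], and the second order conditions turn the
    equation into [speed <= r g - q rho / r ^ 2 + kappa (2 n D + Lap phi)], against
    the profile inequality. *)
Lemma doubling_comparison (g : R -> R) f ft fx fxx phi G H
    (eps kappa theta T K D eta c sigma speed : R)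
    (S r rho : 'rV[R]_n -> R -> R) :
  classical f ft fx fxx -> smooth phi G H -> 0 < eps -> 0 < kappa -> theta = kappa / eps ->
  0 < D ->
  (forall x t, 0 < t -> ft x t = kappa * \sum_i fxx i x t + g (f (x, t) / eps)) ->
  (forall x, f (x, 0) <= phi x) ->
  (forall x t, 0 <= t <= T -> f (x, t) <= phi x + K) ->
  (forall y, profile g c eta (theta * dot (G y) (G y)) (S y) (r y) (rho y)) ->
  (forall x y, D * dot (x - y) (x - y) <= 3 * eps ->
    `|theta * dot (G x + (2 * D) *: (x - y)) (G x + (2 * D) *: (x - y)) - theta * dot (G y) (G y)|
      <= eta * (1 + theta * dot (G y) (G y))) ->
  (forall x, kappa * (2 * n%:R * D + \sum_i H i x) <= sigma) ->
  c + sigma < speed ->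
  forall x t, 0 <= t <= T -> f (x, t) <= phi x + speed * t + 3 * eps.
Proof.
move=> [cf df] [cphi dphi] e0 k0 thE D0 eqn f0 fK prof band lap sp x0 s0 s0T.
pose v y (p : 'rV[R]_n * R) := eps * S y (f p / eps) - D * dot (p.1 - y) (p.1 - y) - phi p.1 - speed * p.2.
have Sle y p : `|eps * S y (f p / eps) - f p| <= eps.
  have [_ _ _ Sb _] := prof y.
  have -> : eps * S y (f p / eps) - f p = eps * (S y (f p / eps) - f p / eps).
    by field; rewrite gt_eqF.
  by rewrite normrM gtr0_norm// ler_piMr// ltW.
have T0 : 0 <= T by case/andP: s0T; exact: le_trans.
pose W := K + eps + `|speed| * T.
have vW y p : 0 <= p.2 <= T -> v y p <= W - D * dot (p.1 - y) (p.1 - y).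
  move=> pT; have := Sle y p; rewrite ler_norml => /andP[_ h1].
  have := fK p.1 p.2 pT; rewrite -surjective_pairing => h2.
  have h3 : - (`|speed| * T) <= speed * p.2.
    case/andP: pT => p0 p1; rewrite lerNl -mulNr.
    apply: (@le_trans _ _ (`|speed| * p.2)); last by rewrite ler_wpM2l.
    by rewrite ler_wpM2r// -normrN ler_norm.
  by rewrite /v /W; lra.
have xx0 z : dot (z - z) (z - z) = 0 by rewrite subrr dot0l.
suff Hv : v x0 (x0, s0) <= 2 * eps.
  move: Hv; rewrite /v/= xx0 mulr0 subr0.
  by have := Sle x0 (x0, s0); rewrite ler_norml => /andP[h1 _]; lra.
rewrite leNgt; apply/negP => big.
(* Almost optimal in all variables: within [eps] of the supremum, which
   exceeds [2 eps], while the values at time 0 do not exceed [eps]. *)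
pose E := [set w | exists y p, 0 <= p.2 <= T /\ w = v y p].
have Esup : has_sup E.
  split; first by exists (v x0 (x0, s0)), x0, (x0, s0).
  exists W => _ [y [p [pT ->]]]; apply: (le_trans (vW y p pT)).
  by rewrite gerBl mulr_ge0 ?dot_ge0// ltW.
have msb : 2 * eps < sup E.
  by apply: (lt_le_trans big); apply: sup_upper_bound => //; exists x0, (x0, s0).
have [_ [y [p [pT ->]]] vp] := sup_adherent e0 Esup.
have cv : {within closed_halfspace, continuous (v y)}.
  have cg : continuous (fun p : 'rV[R]_n * R => D * dot (p.1 - y) (p.1 - y) + phi p.1 + speed * p.2).
    have c1 : continuous (fun p : 'rV[R]_n * R => p.1 - y).
      by move=> q; apply: cvgB; [exact: cvg_fst|exact: cvg_cst].
    move=> q; apply: cvgD; last by apply: cvgMr; exact: cvg_snd.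
    apply: cvgD; first by apply: cvgMr; exact: (dot_continuous c1 c1).
    by apply: (@cvg_comp _ _ _ fst phi); [exact: cvg_fst|exact: cphi].
  have -> : v y = (fun p => eps * S y (f p / eps)) - (fun p : 'rV[R]_n * R => D * dot (p.1 - y) (p.1 - y) + phi p.1 + speed * p.2).
    by apply/funext => q; rewrite /v !fctE; ring.
  apply: within_continuousB; last exact: continuous_subspaceT.
  apply: (@within_continuous_comp _ _ f (fun w => eps * S y (w / eps)) cf).
  move=> w; apply: cvgMr.
  have [dS _ _ _ _] := prof y.
  apply: (@cvg_comp _ _ _ (fun w => w / eps) (S y)); last exact: (is_derive_continuous (dS _)).
  by apply: cvgMl; exact: cvg_id.
have far q : 0 <= q.2 <= T -> 2 * (dot y y + (W - v y p) / D) <= dot q.1 q.1 -> v y q <= v y p.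
  move=> qT Hq; apply: (le_trans (vW y q qT)).
  have h1 : dot q.1 q.1 <= 2 * dot (q.1 - y) (q.1 - y) + 2 * dot y y.
    have := dot_ge0 (q.1 - y - y); rewrite !dotE [dot y q.1]dotC; lra.
  have : (W - v y p) / D <= dot (q.1 - y) (q.1 - y) by lra.
  by rewrite ler_pdivrMr//; lra.
have [[x t] /= ts cM] := strip_max (lexx 0) cv pT far.
have vc : sup E - eps < v y (x, t) by exact: lt_le_trans (cM _ pT).
have near_xy : D * dot (x - y) (x - y) <= 3 * eps.
  have vx : v x (x, t) <= sup E by apply: sup_upper_bound => //; exists x, (x, t).
  have := Sle x (x, t); have := Sle y (x, t); rewrite !ler_norml => /andP[_ h1] /andP[h2 _].
  by move: vc vx; rewrite /v/= xx0; lra.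
have t0 : 0 < t.
  case/andP: ts => t00 _; rewrite lt_neqAle t00 andbT; apply/eqP => tE.
  have := Sle y (x, t); rewrite ler_norml => /andP[_ h1].
  move: vc h1; rewrite -tE /v/= mulr0 subr0 => vc h1.
  have := f0 x; have : 0 <= D * dot (x - y) (x - y) by rewrite mulr_ge0 ?dot_ge0// ltW.
  lra.
have [dft dfx] := df x t t0.
have [dS dr r0 _ ineq] := prof y.
set w := f (x, t) / eps in ineq *.
have dvt : is_derive t 1 (fun s => v y (x, s)) (r y w * ft x t - speed).
  have h1 : is_derive t 1 (fun s => eps * S y (eps^-1 * f (x, s))) (eps * (r y w * (eps^-1 * ft x t))).
    apply: is_derive_cmul.
    have h := is_derive_cmul eps^-1 dft.
    have -> : w = eps^-1 * f (x, t) by rewrite /w mulrC.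
    exact: (is_derive1_comp (dS _) h).
  have h2 := is_derive_quad (D * dot (x - y) (x - y) + phi x) speed 0 t.
  have HH := is_deriveB h1 h2.
  rewrite (_ : (fun s => v y (x, s)) = (fun s => eps * S y (eps^-1 * f (x, s))) -
     (fun s => D * dot (x - y) (x - y) + phi x + speed * s + 0 * s ^+ 2)); last first.
    by apply/funext => s; rewrite /v/= !fctE [eps^-1 * _]mulrC; ring.
  by apply: (is_derive_eq HH); field; rewrite gt_eqF.
have Et : speed <= r y w * ft x t.
  rewrite -subr_ge0; apply: (derive_at_right_end_max t0 dvt) => s /andP[s1 s2].
  by apply: cM => /=; rewrite s1 (le_trans s2)//; case/andP: ts.
pose Gs := G x + (2 * D) *: (x - y).
have Ex i : r y w * fx i x t = Gs 0 i /\
    r y w * fxx i x t <= 2 * D + H i x - rho y w * (fx i x t) ^+ 2 / eps.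
  pose F h := f (x + h *: basis_vec i, t).
  have dF (h : R) : is_derive h 1 F (fx i (x + h *: basis_vec i) t).
    exact: (@line_is_derive _ _ (fun y => f (y, t)) (fun y => fx i y t) (basis_vec i) x h (fun y => ((df y t t0).2 i).1)).
  have dph (h : R) : is_derive h 1 (fun k => phi (x + k *: basis_vec i)) (G (x + h *: basis_vec i) 0 i).
    exact: (@line_is_derive _ _ phi (fun y => G y 0 i) (basis_vec i) x h (fun y => (dphi y i).1)).
  have dSF (h : R) : is_derive h 1 (fun k => S y (eps^-1 * F k)) (r y (eps^-1 * F h) * (eps^-1 * fx i (x + h *: basis_vec i) t)).
    exact: (is_derive1_comp (dS _) (is_derive_cmul eps^-1 (dF h))).
  have drF (h : R) : is_derive h 1 (fun k => r y (eps^-1 * F k)) (rho y (eps^-1 * F h) * (eps^-1 * fx i (x + h *: basis_vec i) t)).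
    exact: (is_derive1_comp (dr _) (is_derive_cmul eps^-1 (dF h))).
  pose a := (x - y) 0 i.
  have dq (h : R) := is_derive_quad (D * dot (x - y) (x - y) + speed * t) (2 * D * a) D h.
  have z1 (h : R) : is_derive h 1 (fun h => v y (x + h *: basis_vec i, t))
      (eps * (r y (eps^-1 * F h) * (eps^-1 * fx i (x + h *: basis_vec i) t))
       - (2 * D * a + 2 * D * h) - G (x + h *: basis_vec i) 0 i).
    have HH := is_deriveB (is_deriveB (is_derive_cmul eps (dSF h)) (dq h)) (dph h).
    rewrite (_ : (fun h => v y _) = (fun h => eps * S y (eps^-1 * F h)) -
       (fun h => D * dot (x - y) (x - y) + speed * t + 2 * D * a * h + D * h ^+ 2) -
       (fun h => phi (x + h *: basis_vec i)))//.
    apply/funext => s; rewrite /v/= !fctE [x + _ - y]addrAC dot_shift_basis -/a [eps^-1 * _]mulrC -/(F s); ring.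
  have [] := @second_derivative_max _ _ _ (rho y w * fx i x t ^+ 2 / eps + r y w * fxx i x t - 2 * D - H i x) z1.
  - have F0 : eps^-1 * F 0 = w by rewrite /w /F scale0r addr0 mulrC.
    have d1 := is_deriveM (drF 0) (is_derive_cmul eps^-1 (dfx i).2).
    have d2 := is_derive_quad (2 * D * a) (2 * D) 0 0.
    have HH := is_deriveB (is_deriveB (is_derive_cmul eps d1) d2) (dphi x i).2.
    rewrite (_ : (fun h => _) = (fun h => eps * (r y (eps^-1 * F h) * (eps^-1 * fx i (x + h *: basis_vec i) t))) -
       (fun h => 2 * D * a + 2 * D * h + 0 * h ^+ 2) -
       (fun h => G (x + h *: basis_vec i) 0 i)); last first.
      by apply/funext => s; rewrite !fctE mul0r addr0.
    apply: (is_derive_eq HH); rewrite scale0r addr0 F0 /GRing.scale/=.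
    by field; rewrite gt_eqF.
  - by move=> h; rewrite scale0r addr0; exact: cM.
  rewrite scale0r addr0 mulr0 addr0.
  have -> : eps^-1 * F 0 = w by rewrite /w /F scale0r addr0 mulrC.
  have -> : eps * (r y w * (eps^-1 * fx i x t)) = r y w * fx i x t by field; rewrite gt_eqF.
  move=> h1 h2; split; last lra.
  by rewrite /Gs !mxE -/a; move: h1; rewrite /a !mxE; lra.
have rw := r0 w.
have q0 : 0 <= theta * dot Gs Gs by rewrite thE mulr_ge0 ?dot_ge0// divr_ge0// ltW.
have I := ineq _ w q0 (band x y near_xy).
have SumE : r y w * (kappa * \sum_i fxx i x t) <= kappa * (2 * n%:R * D + \sum_i H i x) - theta * dot Gs Gs * (rho y w / r y w ^+ 2).
  rewrite mulrCA mulr_sumr.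
  have GE : dot Gs Gs = r y w ^+ 2 * \sum_i fx i x t ^+ 2.
    by rewrite /dot mulr_sumr; apply: eq_bigr => i _; have [<- _] := Ex i; ring.
  have -> : kappa * (2 * n%:R * D + \sum_i H i x) - theta * dot Gs Gs * (rho y w / r y w ^+ 2) =
    kappa * \sum_i (2 * D + H i x - rho y w * (fx i x t) ^+ 2 / eps).
    rewrite GE thE !big_split/= sumr_const card_ord sumrN -mulr_suml -mulr_sumr -[_ *+ n]mulr_natr.
    by field; rewrite !gt_eqF.
  rewrite ler_wpM2l ?(ltW k0)//; apply: ler_sum => i _.
  by have [] := Ex i.
have := lap x; move: Et; rewrite eqn// mulrDr -/w; lra.
Qed.

End Comparison.

(** * Solutions and smooth comparison functions *)

Section Solutions.
Context {R : realType} {n : nat}.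
Implicit Types (x y : 'rV[R]_n) (f : 'rV[R]_n * R -> R) (phi : 'rV[R]_n -> R).

Definition solves (g : R -> R) (eps kappa : R) (u0 : 'rV[R]_n -> R) f ft fx fxx :=
  [/\ classical f ft fx fxx,
      forall x t, 0 < t -> ft x t = kappa * \sum_i fxx i x t + g (f (x, t) / eps),
      forall x, f (x, 0) = u0 x &
      forall T, 0 < T -> exists A a : R, forall p, 0 <= p.2 <= T ->
        `|f p| <= A * expR (a * dot p.1 p.1)].

Lemma is_solution_solves g alpha eps (u0 : 'rV[R]_n -> R) f : is_solution g alpha eps u0 f ->
  solves g eps (eps `^ alpha) u0 f (fun x t => dt f (x, t))
    (fun i x t => dx i f (x, t)) (fun i x t => dx i (dx i f) (x, t)).
Proof.
move=> [C2 cf eqn f0 gr].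
have [ex _ _ _ _] := C2 (1 / 2) (ltac:(apply/andP; split; lra)).
split.
- split; first exact: cf.
  move=> x t t0; have [d1 d2 d3] := ex (x, t) t0; split.
    by split; [exact: d1|rewrite /dt derive1E].
  by move=> i; split; apply: is_derive_line; [exact: d2|exact: d3].
- by move=> x t t0; have := eqn (x, t) t0; rewrite /laplacian; lra.
- exact: f0.
- move=> T T0; have [A [a H]] := gr T T0; exists A, a => p pT.
  by have := H p pT; rewrite sqr_sqrtr// dot_ge0.
Qed.

Lemma solves_opp g eps kappa (u0 : 'rV[R]_n -> R) f ft fx fxx : solves g eps kappa u0 f ft fx fxx ->
  solves (fun s => - g (- s)) eps kappa (fun x => - u0 x) (fun p => - f p)
    (fun x t => - ft x t) (fun i x t => - fx i x t) (fun i x t => - fxx i x t).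
Proof.
move=> [[cf df] eqn f0 gr]; split.
- split; first by apply: (@within_continuous_comp _ _ f (fun w : R => - w) cf); exact: opp_continuous.
  move=> x t t0; have [d1 d2] := df x t t0; split; first exact: (is_deriveN d1).
  move=> i; have [d3 d4] := d2 i.
  by split; [exact: (is_deriveN d3)|exact: (is_deriveN d4)].
- by move=> x t t0; rewrite eqn// sumrN mulrN opprD mulNr opprK.
- by move=> x; rewrite f0.
- by move=> T T0; have [A [a H]] := gr T T0; exists A, a => p pT; rewrite normrN; exact: H.
Qed.

Lemma smoothD phi1 G1 H1 phi2 G2 H2 : smooth phi1 G1 H1 -> smooth phi2 G2 H2 ->
  smooth (fun x => phi1 x + phi2 x) (fun x => G1 x + G2 x) (fun i x => H1 i x + H2 i x).
Proof.
move=> [c1 d1] [c2 d2]; split; first by move=> x; exact: (cvgD (c1 x) (c2 x)).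
move=> x i; split.
  by rewrite mxE; exact: (is_deriveD (d1 x i).1 (d2 x i).1).
rewrite (_ : (fun h => _) = (fun h => G1 (x + h *: basis_vec i) 0 i) + (fun h => G2 (x + h *: basis_vec i) 0 i)).
  exact: (is_deriveD (d1 x i).2 (d2 x i).2).
by apply/funext => h; rewrite mxE.
Qed.

Lemma continuous_translate x0 : continuous (fun x : 'rV[R]_n => x - x0).
Proof.
move=> q; have c0 : (fun=> x0) @ nbhs q --> x0 by exact: cvg_cst.
have ci : (fun x : 'rV[R]_n => x) @ nbhs q --> q by move=> ?.
exact: (cvgB ci c0).
Qed.

Lemma smooth_sqdist (C : R) x0 :
  smooth (fun x => C * dot (x - x0) (x - x0)) (fun x => (2 * C) *: (x - x0)) (fun _ _ => 2 * C).
Proof.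
split.
  have c1 := @continuous_translate x0.
  exact: (continuous_cmul (dot_continuous c1 c1)).
move=> x i; split.
  have h := is_derive_quad (C * dot (x - x0) (x - x0)) (2 * C * (x - x0) 0 i) C 0.
  rewrite (_ : (fun h => _) = (fun s => C * dot (x - x0) (x - x0) + 2 * C * (x - x0) 0 i * s + C * s ^+ 2)).
    by apply: (is_derive_eq h); rewrite mulr0 addr0 [RHS]mxE.
  by apply/funext => s; rewrite [x + _ - x0]addrAC dot_shift_basis; ring.
have h := is_derive_quad (2 * C * (x - x0) 0 i) (2 * C) 0 0.
rewrite (_ : (fun h => _) = (fun s => 2 * C * (x - x0) 0 i + 2 * C * s + 0 * s ^+ 2)).
  by apply: (is_derive_eq h); rewrite mulr0 addr0.
by apply/funext => s; rewrite !mxE !eqxx mulr1; ring.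
Qed.

(** A function of a single direction; [eta = 0] gives the constants. *)
Lemma smooth_ridge (psi dpsi ddpsi : R -> R) x0 (eta : 'rV[R]_n) :
  (forall s : R, is_derive s 1 psi (dpsi s)) -> (forall s : R, is_derive s 1 dpsi (ddpsi s)) ->
  smooth (fun x => psi (dot (x - x0) eta)) (fun x => dpsi (dot (x - x0) eta) *: eta)
    (fun i x => ddpsi (dot (x - x0) eta) * eta 0 i ^+ 2).
Proof.
move=> d1 d2; split.
  have c1 := @continuous_translate x0.
  move=> x; apply: (@cvg_comp _ _ _ (fun x => dot (x - x0) eta) psi).
    exact: (dot_continuous c1 (@cst_continuous _ _ eta)).
  exact: (is_derive_continuous (d1 _)).
move=> x i.
have shift (s : R) : dot (x + s *: basis_vec i - x0) eta = dot (x - x0) eta + s * eta 0 i.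
  by rewrite [x + _ - x0]addrAC [LHS]dotDl dotZl [dot (basis_vec i) _]dotC dot_basis.
have lin : is_derive (0 : R) 1 (fun s : R => dot (x - x0) eta + s * eta 0 i) (eta 0 i).
  have := is_derive_quad (dot (x - x0) eta) (eta 0 i) 0 0.
  rewrite mulr0 addr0 (_ : (fun s => _) = (fun s : R => dot (x - x0) eta + s * eta 0 i))//.
  by apply/funext => s; rewrite mul0r addr0 mulrC.
have lin0 : dot (x - x0) eta + 0 * eta 0 i = dot (x - x0) eta by rewrite mul0r addr0.
split.
  rewrite (_ : (fun h => _) = psi \o (fun s : R => dot (x - x0) eta + s * eta 0 i)); last first.
    by apply/funext => s /=; rewrite shift.
  rewrite mxE; apply: is_derive1_comp => //; rewrite lin0; exact: d1.
have h : is_derive (0 : R) 1 (dpsi \o (fun s : R => dot (x - x0) eta + s * eta 0 i)) (ddpsi (dot (x - x0) eta) * eta 0 i).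
  by apply: is_derive1_comp => //; rewrite lin0; exact: d2.
rewrite (_ : (fun h => _) = (fun s => eta 0 i * (dpsi \o (fun s : R => dot (x - x0) eta + s * eta 0 i)) s)); last first.
  by apply/funext => s /=; rewrite !mxE shift mulrC.
by apply: (is_derive_eq (is_derive_cmul _ h)); ring.
Qed.

Lemma classical_sub f ft fx fxx phi G H (K : R) : classical f ft fx fxx -> smooth phi G H ->
  classical (fun p => f p - phi p.1 - K * p.2) (fun x t => ft x t - K)
    (fun i x t => fx i x t - G x 0 i) (fun i x t => fxx i x t - H i x).
Proof.
move=> [cf df] [cphi dphi]; split.
  rewrite (_ : (fun p => _) = f - (fun p => phi p.1 + K * p.2)); last first.
    by apply/funext => p; rewrite !fctE; ring.
  apply: within_continuousB => //; apply: continuous_subspaceT => p; apply: cvgD.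
    by apply: (@cvg_comp _ _ _ fst phi); [exact: cvg_fst|exact: cphi].
  by apply: cvgMr; exact: cvg_snd.
move=> x t t0; have [d1 d2] := df x t t0; split.
  rewrite (_ : (fun s => _) = (fun s => f (x, s)) - (fun s => phi x + K * s + 0 * s ^+ 2)); last first.
    by apply/funext => s; rewrite !fctE/=; ring.
  by apply: (is_derive_eq (is_deriveB d1 (is_derive_quad (phi x) K 0 t))); ring.
move=> i; have [d3 d4] := d2 i; have [d5 d6] := dphi x i; split.
  have HH := is_deriveB (is_deriveB d3 d5) (is_derive_cst (K * t) (0 : R) 1).
  by apply: (is_derive_eq HH); rewrite subr0.
exact: (is_deriveB d4 d6).
Qed.

(** Since [g] is bounded, the solution minus a paraboloid that is above the
    datum, and close to it at one point, minus a large multiple of time, is a subsolution of the heat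
    equation. *)
Lemma solves_growth g eps kappa (u0 : 'rV[R]_n -> R) f ft fx fxx (B L T : R) : 0 < kappa -> 0 < T -> 0 <= L ->
  solves g eps kappa u0 f ft fx fxx -> (forall s, `|g s| <= B) ->
  (forall x y, `|u0 x - u0 y| <= L * `|x - y|) ->
  exists K, forall x t, 0 <= t <= T -> f (x, t) <= u0 x + K.
Proof.
move=> k0 T0 L0 [cf eqn f0 gr] gB uL.
have B0 : 0 <= B by exact: le_trans (gB 0).
pose C := L ^+ 2 / 4; pose K1 := kappa * (2 * C * n%:R) + B.
have C0 : 0 <= C by rewrite divr_ge0// exprn_ge0.
have K10 : 0 <= K1 by rewrite addr_ge0// !mulr_ge0// ltW.
exists (1 + K1 * T) => x0 t0 t0T.
have cw := classical_sub K1 cf (smooth_sqdist C x0).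
have cw' := classical_sub 0 cw (@smooth_ridge (fun=> u0 x0 + 1) (fun=> 0) (fun=> 0) 0 0
   (fun s => is_derive_cst (u0 x0 + 1) s (1 : R)) (fun s => is_derive_cst (0 : R) s (1 : R))).
have [A [a gA]] := gr T T0.
have xx0 : dot (x0 - x0) (x0 - x0) = 0 by rewrite subrr dot0l.
have : f (x0, t0) - C * dot (x0 - x0) (x0 - x0) - K1 * t0 - (u0 x0 + 1) - 0 * t0 <= 0.
  apply: (heat_max (T := T) cw' k0 _ _ _ (p := (x0, t0)) t0T).
  - move=> x t t_gt0; rewrite eqn// subr0.
    have -> : \sum_i (fxx i x t - 2 * C - 0 * (0 : 'rV[R]_n) 0 i ^+ 2) = \sum_i fxx i x t - 2 * C * n%:R.
      rewrite (eq_bigr (fun i => fxx i x t + - (2 * C))); last by move=> i _; rewrite mul0r subr0.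
      by rewrite big_split/= sumr_const card_ord -[_ *+ n]mulr_natr mulNr.
    have := gB (f (x, t) / eps); rewrite ler_norml => /andP[_].
    by rewrite /K1; lra.
  - move=> x; rewrite /= mulr0 mul0r !subr0 f0.
    have h1 := uL x x0; have h2 := sqr_norm_le_dot (x - x0).
    have : L * `|x - x0| <= 1 + C * dot (x - x0) (x - x0).
      (* [C = L ^ 2 / 4] is what completes the square. *)
      apply: (@le_trans _ _ (1 + C * `|x - x0| ^+ 2)); last by rewrite lerD2l ler_wpM2l.
      have := sqr_ge0 (1 - L * `|x - x0| / 2); rewrite /C; lra.
    move: h1; rewrite ler_norml => /andP[_]; lra.
  - exists (`|A| + `|u0 x0|), `|a| => p pT; rewrite /= mul0r subr0.
    have q0 := dot_ge0 p.1.
    have e1 : 1 <= expR (`|a| * dot p.1 p.1) by rewrite -expR0 ler_expR mulr_ge0.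
    have h1 : f p <= `|A| * expR (`|a| * dot p.1 p.1).
      apply: (le_trans (ler_norm _)); apply: (le_trans (gA p pT)).
      apply: (@le_trans _ _ (`|A| * expR (a * dot p.1 p.1))).
        by rewrite ler_wpM2r ?expR_ge0// ler_norm.
      by rewrite ler_wpM2l// ler_expR ler_wpM2r// ler_norm.
    have h2 : `|u0 x0| <= `|u0 x0| * expR (`|a| * dot p.1 p.1) by rewrite ler_peMr.
    have h3 : 0 <= C * dot (p.1 - x0) (p.1 - x0) by rewrite mulr_ge0 ?dot_ge0.
    have h4 : 0 <= K1 * p.2 by rewrite mulr_ge0//; case/andP: pT.
    have h5 := lerNnormlW (lexx `|u0 x0|).
    rewrite [leRHS]mulrDl; lra.
rewrite xx0; have : K1 * t0 <= K1 * T by rewrite ler_wpM2l//; case/andP: t0T.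
lra.
Qed.

End Solutions.

(** * The comparison estimate for small parameters *)

Section Estimates.
Context {R : realType} {n : nat}.
Implicit Types (x y : 'rV[R]_n) (f : 'rV[R]_n * R -> R) (phi : 'rV[R]_n -> R).

Lemma near0_powR (a d : R) : 0 < a -> 0 < d -> \forall e \near 0^'+, e `^ a <= d.
Proof.
move=> a0 d0; near=> e.
have e0 : 0 < e by near: e; exact: nbhs_right_gt.
have ed : e <= d `^ a^-1.
  by near: e; apply: nbhs_right_le; rewrite powR_gt0.
have := ge0_ler_powR (ltW a0) _ _ ed; rewrite !nnegrE (ltW e0) powR_ge0 => /(_ isT isT).
by rewrite -powRrM mulVf ?gt_eqF// powRr1 ?(ltW d0).
Unshelve. all: by end_near. Qed.

(** Where the profile belongs to the squared gradient of [phi] at [y], this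
    puts the squared gradient at the maximum point inside its band. *)
Lemma dot_close (a d : 'rV[R]_n) (theta w : R) : 0 <= theta -> 0 < w <= 1 -> theta * dot d d <= w ^+ 2 ->
  `|theta * dot (a + d) (a + d) - theta * dot a a| <= 2 * w * (1 + theta * dot a a).
Proof.
move=> th0 /andP[w0 w1] H.
have A0 := mulr_ge0 th0 (dot_ge0 a).
have D0 := mulr_ge0 th0 (dot_ge0 d).
have P1 := mulr_ge0 th0 (dot_ge0 (w *: a + d)).
have P2 := mulr_ge0 th0 (dot_ge0 (w *: a - d)).
move: P1 P2; rewrite !dotE [dot d a]dotC.
set p := dot a d; set X := dot a a in A0 *; set Y := dot d d in H D0 *.
move=> P1 P2.
have -> : theta * (X + p + (p + Y)) - theta * X = theta * (2 * p + Y) by ring.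
have w2 : w ^+ 2 <= w by rewrite expr2 ler_piMl// ltW.
have B1 : w * (2 * (theta * p)) <= w * (w * (theta * X) + w) by lra.
have B2 : - (w * (w * (theta * X) + w)) <= w * (2 * (theta * p)) by lra.
rewrite ler_pM2l// in B1; rewrite -mulrN ler_pM2l// in B2.
have : 0 <= w * (theta * X) by rewrite mulr_ge0// ltW.
rewrite ler_norml => wX; apply/andP; split; lra.
Qed.

(** With [D = A kappa] the condition [D |x - y| ^ 2 <= 3 eps] of
    [doubling_comparison] reads [theta |x - y| ^ 2 <= 3 / A]: a large [A] makes the
    rescaled gradients at [x] and [y] close, and the second derivatives
    [kappa D] of the penalization are negligible.  When the profiles exist only
    from [Q] on, the gradient bound [gam] is needed, as [theta] is large. *)
Lemma upper_estimate g (m alpha sigma eta Q M L gam : R) :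
  0 < alpha < 1 -> 0 < sigma -> 0 < eta -> 0 <= Q -> 0 <= M -> 0 <= L ->
  0 < gam \/ (gam = 0 /\ Q = 0) ->
  (forall q0, Q <= q0 -> exists S r rho, profile g (m + sigma) eta q0 S r rho) ->
  \forall eps \near 0^'+, forall (v0 : 'rV[R]_n -> R) f ft fx fxx (T K : R) phi G H,
    solves g eps (eps `^ alpha) v0 f ft fx fxx ->
    (forall x t, 0 <= t <= T -> f (x, t) <= v0 x + K) ->
    smooth phi G H -> (forall x, v0 x <= phi x) ->
    (forall x y, dot (G x - G y) (G x - G y) <= M * dot (x - y) (x - y)) ->
    (forall x, \sum_i H i x <= L) -> (forall x, gam <= dot (G x) (G x)) ->
    forall x t, 0 <= t <= T -> f (x, t) <= phi x + (m + 3 * sigma) * t + 3 * eps.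
Proof.
move=> /andP[al0 al1] s0 eta0 Q0 M0 L0 gamQ prof.
pose w := Num.min 1 (eta / 2).
have w0 : 0 < w by rewrite lt_min ltr01 divr_gt0.
have w1 : w <= 1 by rewrite ge_min lexx.
have w2 : 2 * w <= eta.
  have : w <= eta / 2 by rewrite ge_min lexx orbT.
  by move: (w) => w'; lra.
(* [A] handles the variation of the gradient of [phi], the smallness of
   [kappa] that of the penalization. *)
pose A := 12 * M / w ^+ 2 + 1.
have A1 : 1 <= A by rewrite lerDr divr_ge0 ?mulr_ge0 ?exprn_ge0// ltW.
have A0 : 0 < A by exact: lt_le_trans A1.
pose d1 := Num.min 1 (Num.min (sigma / (2 * n%:R * A + L + 1)) (w ^+ 2 / (48 * A))).
have nA : 0 <= 2 * n%:R * A by rewrite !mulr_ge0// ltW.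
have d10 : 0 < d1.
  rewrite !lt_min ltr01 !divr_gt0 ?mulr_gt0 ?exprn_gt0//.
  by rewrite -addrA ltr_wpDl// ltr_wpDl.
have gapQ : \forall eps \near 0^'+, Q * eps `^ (1 - alpha) <= gam.
  case: gamQ => [gam0|[-> ->]]; last by apply: nearW => eps; rewrite mul0r.
  have Q1 : 0 < Q + 1 by rewrite ltr_wpDl.
  have a1 : 0 < 1 - alpha by rewrite subr_gt0.
  apply: filterS (near0_powR a1 (divr_gt0 gam0 Q1)) => eps.
  rewrite ler_pdivlMr//; apply: le_trans; rewrite mulrC.
  by rewrite ler_wpM2l ?powR_ge0// lerDl.
near=> eps => v0 f ft fx fxx T K phi G H sol gr sm v0phi GL HL Gg.
have e0 : 0 < eps by near: eps; exact: nbhs_right_gt.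
have kd : eps `^ alpha <= d1 by near: eps; exact: near0_powR.
have gQ : Q * eps `^ (1 - alpha) <= gam by near: eps.
set kappa := eps `^ alpha in sol kd *.
have k0 : 0 < kappa by exact: powR_gt0.
have k1 : kappa <= 1 by rewrite (le_trans kd)// ge_min lexx.
have ks : kappa * (2 * n%:R * A + L + 1) <= sigma.
  rewrite -ler_pdivlMr; last by rewrite -addrA ltr_wpDl// ltr_wpDl.
  by rewrite (le_trans kd)// !ge_min lexx orbT.
have kw : kappa * (48 * A) <= w ^+ 2.
  rewrite -ler_pdivlMr; last by rewrite mulr_gt0.
  by rewrite (le_trans kd)// !ge_min lexx !orbT.
pose theta := kappa / eps.
have th0 : 0 < theta by rewrite divr_gt0.
have thQ : Q <= theta * gam.
  rewrite /theta mulrAC ler_pdivlMr//.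
  have {1}-> : eps = kappa * eps `^ (1 - alpha).
    rewrite /kappa -powRD; last by rewrite (gt_eqF e0) implybT.
    have -> : alpha + (1 - alpha) = 1 by ring.
    by rewrite powRr1// ltW.
  by rewrite mulrCA ler_wpM2l ?(ltW k0).
have [cf eqn f0 _] := sol.
have profy y : exists Sr : (R -> R) * (R -> R) * (R -> R),
    profile g (m + sigma) eta (theta * dot (G y) (G y)) Sr.1.1 Sr.1.2 Sr.2.
  have [|S [r [rho h]]] := prof (theta * dot (G y) (G y)).
    by rewrite (le_trans thQ)// ler_wpM2l// ltW.
  by exists (S, r, rho).
have [SS SP] := choice profy.
pose D := A * kappa.
have D0 : 0 < D by rewrite mulr_gt0.
have fK x t : 0 <= t <= T -> f (x, t) <= phi x + K.
  by move=> tT; rewrite (le_trans (gr x t tT))// lerD2r.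
apply: (doubling_comparison (D := D) (K := K) (eta := eta) (c := m + sigma) (sigma := sigma)
   cf sm e0 k0 (erefl theta) D0 eqn _ fK SP).
- by move=> x; rewrite f0.
- move=> x y near_xy.
  have -> : G x + (2 * D) *: (x - y) = G y + ((G x - G y) + (2 * D) *: (x - y)).
    by rewrite addrA addrCA subrr addr0.
  set d := G x - G y + _.
  have dd : dot d d <= 2 * dot (G x - G y) (G x - G y) + 8 * D ^+ 2 * dot (x - y) (x - y).
    have := dot_ge0 (G x - G y - (2 * D) *: (x - y)).
    rewrite /d; move: (G x - G y) (x - y) => a b; rewrite !dotE [dot b a]dotC; lra.
  have xy : theta * A * dot (x - y) (x - y) <= 3.
    have -> : theta * A * dot (x - y) (x - y) = D * dot (x - y) (x - y) / eps.
      by rewrite /theta /D; ring.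
    by rewrite ler_pdivrMr.
  have th_dd : theta * dot d d <= w ^+ 2.
    have : theta * dot d d <= theta * ((2 * M + 8 * D ^+ 2) * dot (x - y) (x - y)).
      rewrite ler_wpM2l ?(ltW th0)//; apply: (le_trans dd).
      have := GL x y; lra.
    have -> : theta * ((2 * M + 8 * D ^+ 2) * dot (x - y) (x - y)) =
      (2 * M / A + 8 * A * kappa ^+ 2) * (theta * A * dot (x - y) (x - y)).
      by rewrite /D; field; rewrite gt_eqF.
    have c0 : 0 <= 2 * M / A + 8 * A * kappa ^+ 2.
      by rewrite addr_ge0 ?divr_ge0 ?mulr_ge0 ?exprn_ge0 ?(ltW A0) ?(ltW k0).
    have := ler_wpM2l c0 xy.
    have MA : 12 * M / A <= w ^+ 2.
      rewrite ler_pdivrMr// /A mulrDr mulr1 mulrCA divff ?gt_eqF ?exprn_gt0//.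
      by rewrite mulr1 lerDl exprn_ge0// ltW.
    have kA : 48 * A * kappa ^+ 2 <= w ^+ 2.
      apply: le_trans kw; rewrite mulrC expr2 -mulrA [X in _ <= X]mulrC.
      by rewrite -[X in _ <= X]mulr1 mulrC ler_pM ?mulr_ge0 ?(ltW k0) ?(ltW A0) // [kappa * _]mulrC.
    lra.
  apply: (le_trans (dot_close _ (ltW th0) _ th_dd)); first by rewrite w0.
  by rewrite ler_wpM2r// addr_ge0// mulr_ge0 ?dot_ge0// ltW.
- move=> x; apply: le_trans ks; rewrite ler_wpM2l ?(ltW k0)// -addrA lerD//.
    rewrite /D mulrA -[leRHS]mulr1; rewrite ler_wpM2l//.
  by rewrite (le_trans (HL x))// lerDl.
- lra.
Unshelve. all: by end_near. Qed.

End Estimates.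

(** * Upper and lower bounds *)

Section Bounds.
Context {R : realType} {n : nat}.
Implicit Types (x y : 'rV[R]_n) (f : 'rV[R]_n * R -> R).

Lemma young (l z K : R) : 0 < K -> l * z <= K / 2 * z ^+ 2 + l ^+ 2 / (2 * K).
Proof.
move=> K0; have : 0 <= K / 2 * (z - l / K) ^+ 2 by rewrite mulr_ge0 ?sqr_ge0 ?divr_ge0// ltW.
have -> : K / 2 * (z - l / K) ^+ 2 = K / 2 * z ^+ 2 + l ^+ 2 / (2 * K) - l * z.
  by field; rewrite gt_eqF.
by rewrite subr_ge0.
Qed.

Lemma young_paraboloid (l z d : R) : 0 < l -> 0 < d ->
  l * z <= d + l ^+ 2 / (4 * d) * z ^+ 2.
Proof.
move=> l0 d0; have K0 : 0 < l ^+ 2 / (2 * d) by rewrite divr_gt0 ?mulr_gt0 ?exprn_gt0.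
apply: le_trans (young l z K0) _; rewrite le_eqVlt; apply/orP; left; apply/eqP.
by field; rewrite !gt_eqF.
Qed.

(** At each point a paraboloid touches the datum from above up to a small
    error; its critical point is harmless as all [q >= 0] have profiles. *)
Lemma upper_bound (g : R -> R) (m alpha l T e : R) (v0 : 'rV[R]_n -> R)
    (u : R -> 'rV[R]_n * R -> R) ut ux uxx :
  lipschitz g -> periodic g -> (forall s, 0 < g s) -> has_mean g m -> 0 < alpha < 1 ->
  0 < l -> (forall x y, `|v0 x - v0 y| <= l * `|x - y|) ->
  (forall eps, 0 < eps -> solves g eps (eps `^ alpha) v0 (u eps) (ut eps) (ux eps) (uxx eps)) ->
  0 < T -> 0 < e ->
  \forall eps \near 0^'+, forall x t, 0 <= t <= T -> u eps (x, t) <= v0 x + m * t + e.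
Proof.
move=> lg gp g0 gm al l0 vl sol T0 e0.
have [lp _ glp] := lipschitz_le lg.
have cg : continuous g by exact: dist_le_continuous glp.
have [B _ gB] := periodic_bounded cg gp.
pose sigma := e / (9 * T); pose d := e / 3; pose C := l ^+ 2 / (4 * d).
have s0 : 0 < sigma by rewrite divr_gt0 ?mulr_gt0.
have d0 : 0 < d by rewrite divr_gt0.
have C0 : 0 < C by rewrite divr_gt0 ?mulr_gt0 ?exprn_gt0.
have [eta [eta0 prof]] := positive_profile lg gp g0 gm s0.
have M0 : 0 <= (2 * C) ^+ 2 by rewrite exprn_ge0// mulr_ge0// ltW.
have L0 : 0 <= 2 * C * n%:R by rewrite mulr_ge0// mulr_ge0// ltW.
near=> eps => x0 t0 tT.
have eps0 : 0 < eps by near: eps; exact: nbhs_right_gt.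
have eps_e : eps <= e / 9 by near: eps; apply: nbhs_right_le; rewrite divr_gt0.
have [K HK] := solves_growth (powR_gt0 alpha eps0) T0 (ltW l0) (sol eps eps0) gB vl.
have sm := smoothD (smooth_sqdist C x0) (@smooth_ridge _ _ (fun=> v0 x0 + d) (fun=> 0) (fun=> 0) x0 0
   (fun s => is_derive_cst (v0 x0 + d) s (1 : R)) (fun s => is_derive_cst (0 : R) s (1 : R))).
have est : forall (v0 : 'rV[R]_n -> R) f ft fx fxx (T K : R) phi G H,
    solves g eps (eps `^ alpha) v0 f ft fx fxx ->
    (forall x t, 0 <= t <= T -> f (x, t) <= v0 x + K) ->
    smooth phi G H -> (forall x, v0 x <= phi x) ->
    (forall x y, dot (G x - G y) (G x - G y) <= (2 * C) ^+ 2 * dot (x - y) (x - y)) ->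
    (forall x, \sum_i H i x <= 2 * C * n%:R) -> (forall x, 0 <= dot (G x) (G x)) ->
    forall x t, 0 <= t <= T -> f (x, t) <= phi x + (m + 3 * sigma) * t + 3 * eps.
  near: eps; apply: upper_estimate al s0 eta0 (lexx 0) M0 L0 (or_intror (conj erefl erefl)) prof.
have xx0 : dot (x0 - x0) (x0 - x0) = 0 by rewrite subrr dot0l.
have : u eps (x0, t0) <= C * dot (x0 - x0) (x0 - x0) + (v0 x0 + d) + (m + 3 * sigma) * t0 + 3 * eps.
  apply: (est _ _ _ _ _ _ _ _ _ _ (sol eps eps0) HK sm _ _ _ _ x0 t0 tT).
  - move=> x; have := vl x x0; rewrite ler_norml => /andP[_ h1].
    have h2 := sqr_norm_le_dot (x - x0).
    have : l * `|x - x0| <= d + C * `|x - x0| ^+ 2.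
      exact: young_paraboloid.
    have : C * `|x - x0| ^+ 2 <= C * dot (x - x0) (x - x0) by rewrite ler_wpM2l// ltW.
    lra.
  - move=> x y; rewrite !scale0r !addr0 -scalerBr opprB addrA subrK dotZl dotZr.
    by rewrite le_eqVlt; apply/orP; left; apply/eqP; ring.
  - move=> x; rewrite (eq_bigr (fun=> 2 * C)); last by move=> i _; rewrite mul0r addr0.
    by rewrite sumr_const card_ord mulr_natr.
  - by move=> x; exact: dot_ge0.
have : sigma * t0 <= e / 9.
  have -> : e / 9 = sigma * T by rewrite /sigma; field; rewrite gt_eqF.
  by rewrite ler_wpM2l ?(ltW s0)//; case/andP: tT.
rewrite xx0 /d; lra.
Unshelve. all: by end_near. Qed.

(** Split [x - x0] into [s eta] and a part orthogonal to [eta].  As [s] may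
    have either sign, the minimum is the growth rate [del] for [s >= 0] and the
    Lipschitz bound [Lam] for [s < 0]. *)
Definition tilted (v0 : 'rV[R]_n -> R) x0 (d del Lam : R) (eta : 'rV[R]_n) :=
  dot eta eta = 1 /\ forall x, let s := dot (x - x0) eta in
    v0 x0 - d + Num.min (del * s) (Lam * s) - Lam * euclidean_norm (x - x0 - s *: eta) <= v0 x.

(** A smooth convex function above the absolute value, close to it for small
    [mu]. *)
Lemma round_abs_calculus (mu : R) : 0 < mu ->
  let w s := Num.sqrt (mu ^+ 2 + s ^+ 2) in
  [/\ forall s : R, is_derive s 1 w (s / w s),
      forall s : R, is_derive s 1 (fun s => s / w s) (mu ^+ 2 / w s ^+ 3),
      forall s, mu <= w s, forall s, `|s| <= w s & w 0 = mu].
Proof.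
move=> mu0 w.
have q0 s : 0 < mu ^+ 2 + s ^+ 2 by rewrite ltr_pwDl ?sqr_ge0// exprn_gt0.
have w0 s : 0 < w s by rewrite sqrtr_gt0.
have wsq s : w s ^+ 2 = mu ^+ 2 + s ^+ 2 by rewrite sqr_sqrtr// ltW.
have dw (s : R) : is_derive s 1 w (s / w s).
  have h : is_derive s 1 (fun s : R => mu ^+ 2 + s ^+ 2) (2 * s).
    have := is_derive_quad (mu ^+ 2) 0 1 s.
    rewrite (_ : (fun s => _) = (fun s : R => mu ^+ 2 + s ^+ 2)) => [HH|].
      by apply: (is_derive_eq HH); ring.
    by apply/funext => z; ring.
  have HH := is_derive1_comp (g := fun s : R => mu ^+ 2 + s ^+ 2) (is_derive1_sqrt (q0 s)) h.
  apply: (is_derive_eq HH); rewrite -/(w s); by field; rewrite gt_eqF.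
split => //.
- move=> s; have h := @is_deriveV R w s _ 1 (lt0r_neq0 (w0 s)) (dw s).
  have HH := is_deriveM (is_derive_id s (1 : R)) h.
  apply: (is_derive_eq HH); rewrite /GRing.scale/=.
  have -> : mu ^+ 2 = w s ^+ 2 - s ^+ 2 by rewrite wsq addrK.
  by field; rewrite gt_eqF.
- by move=> s; rewrite -(@ler_pXn2r _ 2) ?nnegrE ?(ltW mu0) ?(ltW (w0 s))// wsq lerDl sqr_ge0.
- move=> s; rewrite -(@ler_pXn2r _ 2) ?nnegrE ?(ltW (w0 s))// wsq real_normK ?num_real//.
  by rewrite lerDr sqr_ge0.
- by rewrite /w expr0n addr0 sqrtr_sqr gtr0_norm.
Qed.

(** The estimate is applied to [- u].  The comparison function smooths the
    negative of the surface in [tilted]: [min (del s) (Lam s) = a s - b |s|] with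
    [a - b = del] and [a + b = Lam], the absolute value is rounded off, and the
    cone orthogonal to [eta] is replaced by a paraboloid.  Its derivative along
    [eta] is at most [b - a = - del], so that its gradient never vanishes. *)
Lemma lower_bound (X : set 'rV[R]_n) (g : R -> R) (m alpha l T e : R) (v0 : 'rV[R]_n -> R)
    (u : R -> 'rV[R]_n * R -> R) ut ux uxx :
  lipschitz g -> periodic g -> has_mean g m -> 0 < alpha < 1 ->
  0 < l -> (forall x y, `|v0 x - v0 y| <= l * `|x - y|) ->
  (forall d, 0 < d -> exists del Lam, [/\ 0 < del, del <= Lam &
     forall x, X x -> exists eta, tilted v0 x d del Lam eta]) ->
  (forall eps, 0 < eps -> solves g eps (eps `^ alpha) v0 (u eps) (ut eps) (ux eps) (uxx eps)) ->
  0 < T -> 0 < e ->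
  \forall eps \near 0^'+, forall x t, X x -> 0 <= t <= T -> v0 x + m * t - e <= u eps (x, t).
Proof.
move=> lg gp gm al l0 vl tilt sol T0 e0.
have [lp _ glp] := lipschitz_le lg.
have cg : continuous g by exact: dist_le_continuous glp.
have [B _ gB] := periodic_bounded cg gp.
pose gr s := - g (- s).
have cgr : continuous gr.
  move=> s; apply: cvgN; apply: (@cvg_comp _ _ _ (fun w : R => - w) g); [exact: opp_continuous|exact: cg].
have gB' s : `|gr s| <= B by rewrite normrN.
have pgr : periodic gr.
  by move=> s i; rewrite /gr opprD -mulrNz gp.
have gmr : has_mean gr (- m).
  have [K dK Km] := gm; exists (fun s => K (- s)).
    move=> s; have h := is_derive_cmul (-1) (is_derive_id s (1 : R)).
    have dK' : is_derive (-1 * s) 1 K (g (- s)) by rewrite mulN1r; exact: dK.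
    have HH := is_derive1_comp (g := fun s => -1 * s) dK' h.
    rewrite (_ : (fun s => _) = K \o (fun s => -1 * s)).
      by apply: (is_derive_eq HH); rewrite /gr; ring.
    by apply/funext => z /=; rewrite mulN1r.
  have KE : periodic (fun s => K s - m * s).
    apply: (@periodic_primitive _ (fun s => g s - m)).
    - by move=> x i; rewrite gp.
    - by have := has_meanD gm (has_mean_cst (- m)); rewrite subrr.
    - move=> x; have HH := is_deriveB (dK x) (is_derive_cmul m (is_derive_id x (1 : R))).
      by apply: (is_derive_eq HH); rewrite mulr1.
  have := KE (-1) 1%:Z; rewrite addNr mulr0 subr0 mulrN1 opprK oppr0; lra.
have vl' x y : `|- v0 x - - v0 y| <= l * `|x - y| by rewrite -opprD normrN; exact: vl.
pose sigma := e / (12 * T); pose d := e / 6.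
have s0 : 0 < sigma by rewrite divr_gt0 ?mulr_gt0.
have d0 : 0 < d by rewrite divr_gt0.
have [eta [Q [eta0 Q0 prof]]] := steep_profile cgr pgr gmr s0.
have [del [Lam [del0 delLam tiltX]]] := tilt d d0.
have Lam0 : 0 < Lam by exact: lt_le_trans delLam.
pose C := Lam ^+ 2 / (4 * d).
have C0 : 0 < C by rewrite divr_gt0 ?mulr_gt0 ?exprn_gt0.
pose a := (Lam + del) / 2; pose b := (Lam - del) / 2.
have b0 : 0 <= b by rewrite divr_ge0// subr_ge0.
(* Rounding off [b |s|] costs at most [b mu <= d]. *)
pose mu := d / (b + 1).
have mu0 : 0 < mu by rewrite divr_gt0// ltr_wpDl.
have bmu : b * mu <= d.
  by rewrite /mu mulrA ler_pdivrMr ?ltr_wpDl// mulrC ler_pM2l// lerDl.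
have [] := round_abs_calculus mu0; set w := fun s => _ => dw ddw wmu wabs w00.
have w0 s : 0 < w s by exact: lt_le_trans (wmu s).
have kmu s : mu ^+ 2 / w s ^+ 3 <= mu^-1.
  rewrite ler_pdivrMr ?exprn_gt0// mulrC ler_pdivlMr// -exprSr.
  by apply: lerXn2r; rewrite ?nnegrE ?(ltW mu0) ?(ltW (w0 s)) ?wmu.
pose M := 8 * C ^+ 2 + 2 * (b / mu) ^+ 2.
pose L := 2 * C * n%:R + b / mu.
have M0 : 0 <= M by rewrite addr_ge0// mulr_ge0// sqr_ge0.
have C2n : 0 <= 2 * C * n%:R by rewrite mulr_ge0// mulr_ge0// ltW.
have b_mu0 : 0 <= b / mu by rewrite divr_ge0// ltW.
have L0 : 0 <= L by exact: addr_ge0.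
have del2 : 0 < del ^+ 2 by rewrite exprn_gt0.
near=> eps => x0 t0 Xx0 tT.
have eps0 : 0 < eps by near: eps; exact: nbhs_right_gt.
have eps_e : eps <= e / 12 by near: eps; apply: nbhs_right_le; rewrite divr_gt0.
have solr := solves_opp (sol eps eps0).
have [K HK] := solves_growth (powR_gt0 alpha eps0) T0 (ltW l0) solr gB' vl'.
have est : forall (v0 : 'rV[R]_n -> R) f ft fx fxx (T K : R) phi G H,
    solves gr eps (eps `^ alpha) v0 f ft fx fxx ->
    (forall x t, 0 <= t <= T -> f (x, t) <= v0 x + K) ->
    smooth phi G H -> (forall x, v0 x <= phi x) ->
    (forall x y, dot (G x - G y) (G x - G y) <= M * dot (x - y) (x - y)) ->
    (forall x, \sum_i H i x <= L) -> (forall x, del ^+ 2 <= dot (G x) (G x)) ->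
    forall x t, 0 <= t <= T -> f (x, t) <= phi x + (- m + 3 * sigma) * t + 3 * eps.
  near: eps; exact: (upper_estimate (n := n) al s0 eta0 (ltW Q0) M0 L0 (or_introl del2) prof).
have [et [et1 tl]] := tiltX x0 Xx0.
pose psi s := - v0 x0 + 2 * d + (- a) * s + (- C) * s ^+ 2 + b * w s.
pose dpsi s := (- a + 2 * (- C) * s) + b * (s / w s).
pose ddpsi s := 2 * (- C) + b * (mu ^+ 2 / w s ^+ 3).
have d1 (s : R) : is_derive s 1 psi (dpsi s).
  exact: (is_deriveD (is_derive_quad _ _ _ s) (is_derive_cmul b (dw s))).
have d2 (s : R) : is_derive s 1 dpsi (ddpsi s).
  have HH := is_deriveD (is_derive_quad (- a) (2 * (- C)) 0 s) (is_derive_cmul b (ddw s)).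
  rewrite (_ : dpsi = (fun s => - a + 2 * (- C) * s + 0 * s ^+ 2) + (fun s => b * (s / w s))); last first.
    by apply/funext => z; rewrite /dpsi !fctE mul0r addr0.
  by apply: (is_derive_eq HH); rewrite mulr0 mul0r addr0.
have sm := smoothD (smooth_sqdist C x0) (@smooth_ridge _ _ psi dpsi ddpsi x0 et d1 d2).
have dot0 z : dot (x0 - x0) z = 0 by rewrite subrr dot0l.
have proj z : dot (z - dot z et *: et) (z - dot z et *: et) = dot z z - dot z et ^+ 2.
  by rewrite !dotE [dot et z]dotC et1; ring.
have : - u eps (x0, t0) <= C * dot (x0 - x0) (x0 - x0) + psi (dot (x0 - x0) et) + (- m + 3 * sigma) * t0 + 3 * eps.
  apply: (est _ _ _ _ _ _ _ _ _ _ solr HK sm _ _ _ _ x0 t0 tT).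
  - move=> x; have := tl x; rewrite /=; set s := dot (x - x0) et; set y := x - x0 - s *: et.
    have yy : dot y y = dot (x - x0) (x - x0) - s ^+ 2.
      exact: proj.
    have yd : Lam * euclidean_norm y <= d + C * dot y y.
      rewrite -(sqr_sqrtr (dot_ge0 y)) -/(euclidean_norm y).
      exact: young_paraboloid.
    have mn : a * s - b * w s <= Num.min (del * s) (Lam * s).
      have := wabs s; rewrite ler_norml => /andP[h1 h2].
      have h3 : b * s <= b * w s by rewrite ler_wpM2l.
      have h4 : b * - w s <= b * s by rewrite ler_wpM2l.
      have e1 : a * s = b * s + del * s by rewrite /a /b; field.
      have e2 : a * s = - (b * s) + Lam * s by rewrite /a /b; field.
      rewrite le_min; apply/andP; split.
        by rewrite e1 addrAC gerDr subr_le0.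
      by rewrite e2 addrAC gerDr subr_le0 lerNl -mulrN.
    rewrite yy in yd; rewrite /psi; clear -yd mn; lra.
  - move=> x y.
    have -> : (2 * C) *: (x - x0) + dpsi (dot (x - x0) et) *: et - ((2 * C) *: (y - x0) + dpsi (dot (y - x0) et) *: et)
      = (2 * C) *: (x - y) + (dpsi (dot (x - x0) et) - dpsi (dot (y - x0) et)) *: et.
      by rewrite opprD addrACA -scalerBr -scalerBl opprB addrA subrK.
    have := MVT_global (dot (y - x0) et) (dot (x - x0) et) ddw.
    have -> : dot (x - x0) et - dot (y - x0) et = dot (x - y) et.
      by rewrite -dotNl -dotDl opprB addrA subrK.
    move=> [c hc].
    have -> : dpsi (dot (x - x0) et) - dpsi (dot (y - x0) et) =
       - (2 * C) * dot (x - y) et + b * (mu ^+ 2 / w c ^+ 3) * dot (x - y) et.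
      have -> : b * (mu ^+ 2 / w c ^+ 3) * dot (x - y) et = b * (mu ^+ 2 / w c ^+ 3 * dot (x - y) et) by ring.
      rewrite -hc /dpsi.
      have -> : dot (x - y) et = dot (x - x0) et - dot (y - x0) et.
        by rewrite -dotNl -dotDl opprB addrA subrK.
      ring.
    have h1 : 0 <= mu ^+ 2 / w c ^+ 3 <= mu^-1 by rewrite kmu divr_ge0 ?exprn_ge0 ?(ltW mu0) ?(ltW (w0 c)).
    move: h1 {hc}; set k := mu ^+ 2 / _ => /andP[k0 k1].
    have bk : (b * k) ^+ 2 <= (b / mu) ^+ 2.
      by apply: lerXn2r; rewrite ?nnegrE ?(mulr_ge0 b0 k0) ?b_mu0// ler_wpM2l.
    move: (x - y) => z; set p := dot z et.
    have cs : p ^+ 2 <= dot z z by have := cauchy_schwarz z et; rewrite et1 mulr1.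
    rewrite !dotE [dot et z]dotC et1 -/p /M.
    have h2 : (b * k) ^+ 2 * p ^+ 2 <= (b / mu) ^+ 2 * dot z z.
      by rewrite ler_pM ?sqr_ge0.
    have h3 : 0 <= (C ^+ 2) * p ^+ 2 by rewrite mulr_ge0 ?sqr_ge0.
    have h4 : 0 <= (b / mu) ^+ 2 * dot z z by rewrite mulr_ge0 ?sqr_ge0 ?dot_ge0.
    have h5 : 0 <= (C ^+ 2) * dot z z by rewrite mulr_ge0 ?sqr_ge0 ?dot_ge0.
    clear -h2 h3 h4 h5; lra.
  - move=> x; set s := dot (x - x0) et.
    rewrite big_split/= sumr_const card_ord -mulr_sumr.
    have -> : \sum_i et 0 i ^+ 2 = 1 by rewrite -et1; apply: eq_bigr => i _; rewrite expr2.
    rewrite -[_ *+ n]mulr_natr mulr1 /L lerD2l /ddpsi.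
    move: (kmu s) => /(ler_wpM2l b0); clear -C0; lra.
  - move=> x; set s := dot (x - x0) et; set Gx := _ + _.
    have cs : dot Gx et ^+ 2 <= dot Gx Gx by have := cauchy_schwarz Gx et; rewrite et1 mulr1.
    apply: le_trans cs.
    have -> : dot Gx et = - a + b * (s / w s).
      by rewrite /Gx dotDl !dotZl et1 -/s /dpsi; ring.
    have : b * (s / w s) <= b * 1.
      rewrite ler_wpM2l// ler_pdivrMr// mul1r; exact: le_trans (ler_norm s) (wabs s).
    rewrite mulr1 => h.
    have : del <= a - b * (s / w s) by move: h; clear; rewrite /a /b; lra.
    move=> hd; rewrite -[leRHS]sqrrN opprD opprK.
    by apply: lerXn2r; rewrite ?nnegrE ?(ltW del0)// (le_trans (ltW del0)).
have : sigma * t0 <= e / 12.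
  have -> : e / 12 = sigma * T by rewrite /sigma; field; rewrite gt_eqF.
  by rewrite ler_wpM2l ?(ltW s0)//; case/andP: tT.
rewrite !dot0.
have -> : psi 0 = - v0 x0 + 2 * d + b * mu.
  by rewrite /psi (w00 : w 0 = mu); ring.
move: bmu eps_e; rewrite /d; clear -e0; lra.
Unshelve. all: by end_near. Qed.

End Bounds.

(** * Data that grow in some direction *)

Section Convex.
Context {R : realType} {n : nat}.
Implicit Types (x y p : 'rV[R]_n).

Lemma coord_le_norm x i : `|x 0 i| <= `|x|.
Proof.
rewrite -[leRHS]/(mx_norm x) mx_normrE.
exact: (@le_bigmax_cond _ _ _ 0 (0, i) xpredT (fun ij : 'I_1 * 'I_n => `|x ij.1 ij.2|)).
Qed.

Lemma dot_le_norm x : dot x x <= n%:R * `|x| ^+ 2.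
Proof.
rewrite mulr_natl -[X in _ *+ X](card_ord n) -sumr_const; apply: ler_sum => i _.
by rewrite -expr2 -real_normK ?num_real// lerXn2r ?nnegrE// coord_le_norm.
Qed.

(** A minimizer [b] of [v + K |x - x0| ^ 2] exists, and the first order
    condition together with convexity makes [- 2 K (b - x0)] a subgradient at
    [b]; for large [K], [b] is close to [x0]. *)
Lemma convex_approx_subgradient (v : 'rV[R]_n -> R) (l d : R) x0 :
  (forall (t : R) x y, 0 < t < 1 -> v (y + t *: (x - y)) <= v y + t * (v x - v y)) ->
  0 < l -> (forall x y, `|v x - v y| <= l * `|x - y|) -> 0 < d ->
  exists p, forall x, v x0 - d + dot (x - x0) p <= v x.
Proof.
move=> cvx l0 vl d0.
have cv : continuous v by exact: dist_le_continuous vl.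
(* The loss [l ^ 2 / (2 K)] from Young's inequality is then [d / 2]. *)
pose K := l ^+ 2 / d.
have K0 : 0 < K by rewrite divr_gt0 ?exprn_gt0.
have K20 : 0 <= K / 2 by rewrite divr_ge0// ltW.
(* A function of [x] alone, maximized on the strip reduced to time 0. *)
pose z (q : 'rV[R]_n * R) := - (v q.1 + K * dot (q.1 - x0) (q.1 - x0)).
have cz : {within closed_halfspace, continuous z}.
  apply: continuous_subspaceT => q; apply: cvgN; apply: cvgD.
    by apply: (@cvg_comp _ _ _ fst v); [exact: cvg_fst|exact: cv].
  have c1 : continuous (fun p : 'rV[R]_n * R => p.1 - x0).
    by move=> q'; apply: cvgB; [exact: cvg_fst|exact: cvg_cst].
  exact: (continuous_cmul (dot_continuous c1 c1)).
have xx0 : dot (x0 - x0) (x0 - x0) = 0 by rewrite subrr dot0l.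
have vlow x : v x0 - l * `|x - x0| <= v x.
  by have := vl x x0; rewrite ler_norml => /andP[]; lra.
have far (q : 'rV[R]_n * R) : 0 <= q.2 <= 0 -> 2 * (dot x0 x0 + l ^+ 2 / K ^+ 2) <= dot q.1 q.1 -> z q <= z (x0, 0).
  move=> _ Hq; rewrite /z/= xx0 mulr0 addr0 lerN2.
  have h1 : dot q.1 q.1 <= 2 * dot (q.1 - x0) (q.1 - x0) + 2 * dot x0 x0.
    have := dot_ge0 (q.1 - x0 - x0); rewrite !dotE [dot x0 q.1]dotC; lra.
  have h2 : l ^+ 2 / K ^+ 2 <= dot (q.1 - x0) (q.1 - x0) by lra.
  have h3 := young l `|q.1 - x0| K0.
  have h4 : K / 2 * `|q.1 - x0| ^+ 2 <= K / 2 * dot (q.1 - x0) (q.1 - x0).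
    by rewrite ler_wpM2l// sqr_norm_le_dot.
  have h5 : l ^+ 2 / (2 * K) <= K / 2 * dot (q.1 - x0) (q.1 - x0).
    have -> : l ^+ 2 / (2 * K) = K / 2 * (l ^+ 2 / K ^+ 2) by field; rewrite gt_eqF.
    by rewrite ler_wpM2l.
  have := vlow q.1; lra.
have p00 : 0 <= ((x0, 0) : 'rV[R]_n * R).2 <= 0 by rewrite /= lexx.
have [[b tb] /= _ bM] := strip_max (lexx 0) cz p00 far.
have bmin x : v b + K * dot (b - x0) (b - x0) <= v x + K * dot (x - x0) (x - x0).
  by have := bM (x, 0); rewrite /z/= lexx lerN2; apply.
pose p := (- (2 * K)) *: (b - x0).
have sub x : v b + dot (x - b) p <= v x.
  rewrite -subr_ge0; apply/ler_addgt0Pr => e e0; set w := x - b.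
  pose t := Num.min (1 / 2) (e / (K * dot w w + 1)).
  have Kw : 0 <= K * dot w w by rewrite mulr_ge0 ?dot_ge0// ltW.
  have t0 : 0 < t by rewrite lt_min !divr_gt0 ?ltr_wpDl.
  have t1 : t < 1 by rewrite gt_min; apply/orP; left; lra.
  have te : t * (K * dot w w) <= e.
    have : t <= e / (K * dot w w + 1) by rewrite ge_min lexx orbT.
    by rewrite ler_pdivlMr ?ltr_wpDl//; lra.
  have h1 := cvx t x b; rewrite t0 t1 -/w in h1.
  have h2 := bmin (b + t *: w).
  have E : dot (b + t *: w - x0) (b + t *: w - x0) = dot (b - x0) (b - x0) + 2 * t * dot w (b - x0) + t ^+ 2 * dot w w.
    by rewrite [b + _ - x0]addrAC; move: (b - x0) (w) => c w'; rewrite !dotE [dot c w']dotC; ring.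
  rewrite E in h2.
  have h3 : 0 <= t * (v x - (v b + dot w p) + e).
    have -> : dot w p = - (2 * K) * dot w (b - x0) by rewrite /p dotZr.
    have := ler_wpM2l (ltW t0) te; have := h1 isT; lra.
  by move: h3; rewrite pmulr_rge0// add0r.
exists p => x; apply: le_trans (sub x).
have -> : dot (x - b) p = dot (x - x0) p + 2 * K * dot (b - x0) (b - x0).
  have -> : x - b = (x - x0) - (b - x0) by rewrite opprB addrA subrK.
  by rewrite dotDl dotNl /p; move: (x - x0) (b - x0) => a c; rewrite !dotZr; ring.
have h3 := young l `|b - x0| K0.
have h4 : K / 2 * `|b - x0| ^+ 2 <= K / 2 * dot (b - x0) (b - x0).
  by rewrite ler_wpM2l// sqr_norm_le_dot.
have h5 : l ^+ 2 / (2 * K) = d / 2 by rewrite /K; field; rewrite !gt_eqF.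
have h6 : 0 <= K * dot (b - x0) (b - x0) by rewrite mulr_ge0 ?dot_ge0// ltW.
have := vlow b; lra.
Qed.

(** Compare the minorant with the Lipschitz bound at [x0 + p]. *)
Lemma affine_minorant_slope (v : 'rV[R]_n -> R) (l d : R) x0 p :
  0 < l -> (forall x y, `|v x - v y| <= l * `|x - y|) ->
  (forall x, v x0 - d + dot (x - x0) p <= v x) -> dot p p <= 2 * d + l ^+ 2.
Proof.
move=> l0 vl H; have := H (x0 + p); have := vl (x0 + p) x0.
have -> : x0 + p - x0 = p by rewrite addrC addKr.
rewrite ler_norml => /andP[_ h1] h2.
have := young l `|p| ltr01; have := sqr_norm_le_dot p; lra.
Qed.

Lemma tilted_of_affine (v : 'rV[R]_n -> R) (d del Lam : R) x0 p :
  0 < del -> 0 <= Lam -> del ^+ 2 <= dot p p <= Lam ^+ 2 ->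
  (forall x, v x0 - d + dot (x - x0) p <= v x) -> exists eta, tilted v x0 d del Lam eta.
Proof.
move=> del0 Lam0 /andP[p1 p2] H.
pose r := euclidean_norm p.
have r2 : r ^+ 2 = dot p p by rewrite sqr_sqrtr ?dot_ge0.
have r0 : 0 <= r by exact: sqrtr_ge0.
have r1 : del <= r by rewrite -(@ler_pXn2r _ 2) ?nnegrE ?(ltW del0)// r2.
have rL : r <= Lam by rewrite -(@ler_pXn2r _ 2) ?nnegrE// r2.
have rp : 0 < r by exact: lt_le_trans r1.
exists (r^-1 *: p); split.
  by rewrite dotZl dotZr -r2; field; rewrite gt_eqF.
move=> x; set s := dot (x - x0) _; cbv zeta.
apply: le_trans (H x).
have -> : dot (x - x0) p = r * s by rewrite /s dotZr mulrA divff ?mul1r// gt_eqF.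
have e0 : 0 <= Lam * euclidean_norm (x - x0 - s *: (r^-1 *: p)) by rewrite mulr_ge0// sqrtr_ge0.
suff : Num.min (del * s) (Lam * s) <= r * s by lra.
rewrite ge_min; have [s0|s0] := leP 0 s; first by rewrite ler_wpM2r.
by rewrite [X in _ || X]ler_nM2r// rL orbT.
Qed.

(** A nonconstant convex function has an affine minorant of nonzero slope
    [p1].  At a given point take an approximate supporting affine function of
    slope [p0], and its convex combination with the former with a small
    weight [th], of slope [q].  As [q - (1 - th) p0 = th p1], the slopes [p0] and
    [q] are not both small; the bound is uniform over a ball because the gap
    between the function and the fixed minorant is bounded there. *)
Lemma convex_tilted (v : 'rV[R]_n -> R) (l rad : R) :
  (forall (t : R) x y, 0 < t < 1 -> v (y + t *: (x - y)) <= v y + t * (v x - v y)) ->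
  0 < l -> (forall x y, `|v x - v y| <= l * `|x - y|) ->
  ~ (exists c : R, forall x, v x = c) ->
  forall d, 0 < d -> exists del Lam, [/\ 0 < del, del <= Lam &
    forall x, `|x| <= rad -> exists eta, tilted v x d del Lam eta].
Proof.
move=> cvx l0 vl ncst d d0.
have [a [b ab]] : exists a b, v a < v b.
  apply: contrapT => H; apply: ncst; exists (v 0) => x; apply/eqP; rewrite eq_le; apply/andP.
  by split; rewrite leNgt; apply/negP => h; apply: H; [exists 0, x|exists x, 0].
have d1 : 0 < (v b - v a) / 2 by rewrite divr_gt0// subr_gt0.
have [p1 H1] := convex_approx_subgradient b cvx l0 vl d1.
have p10 : 0 < dot p1 p1.
  rewrite lt0r dot_ge0 andbT; apply/eqP => p10.
  have := H1 a; have := cauchy_schwarz (a - b) p1; rewrite p10 mulr0 => h.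
  have : dot (a - b) p1 = 0 by apply/eqP; rewrite -sqrf_eq0 eq_le h sqr_ge0.
  by move=> ->; lra.
pose c1 := v b - (v b - v a) / 2 - dot b p1.
have H1' x : c1 + dot x p1 <= v x.
  by have := H1 x; rewrite /c1 dotDl dotNl; lra.
pose Dm := `|v 0| + l * rad + `|c1| + (n%:R * rad ^+ 2 + dot p1 p1) / 2 + 1.
pose th := d / (2 * (`|Dm| + d)).
have Dd0 : 0 < `|Dm| + d by rewrite ltr_wpDl.
have th0 : 0 < th by rewrite divr_gt0// mulr_gt0.
have th1 : th <= 1 / 2.
  by rewrite ler_pdivrMr ?mulr_gt0//; have := normr_ge0 Dm; lra.
have thD : th * Dm <= d / 2.
  apply: (@le_trans _ _ (th * (`|Dm| + d))).
    by rewrite ler_wpM2l ?(ltW th0)//; have := ler_norm Dm; lra.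
  by rewrite le_eqVlt; apply/orP; left; apply/eqP; rewrite /th; field; rewrite gt_eqF.
pose del := th * euclidean_norm p1 / 2.
have np1 : 0 < euclidean_norm p1 by rewrite sqrtr_gt0.
have del0 : 0 < del by rewrite divr_gt0// mulr_gt0.
have del2 : del ^+ 2 = th ^+ 2 * dot p1 p1 / 4.
  by rewrite /del -(sqr_sqrtr (dot_ge0 p1)) -/(euclidean_norm p1); field.
pose Lam := 2 * d + l ^+ 2 + 1 + del.
have l2 := sqr_ge0 l.
have Lam1 : 1 <= Lam by rewrite /Lam; lra.
exists del, Lam; split => //; first by rewrite /Lam; lra.
move=> x0 x0r.
have d2 : 0 < d / 2 by rewrite divr_gt0.
have [p0 H0] := convex_approx_subgradient x0 cvx l0 vl d2.
pose q := (1 - th) *: p0 + th *: p1.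
have Hp0 x : v x0 - d + dot (x - x0) p0 <= v x by have := H0 x; lra.
have Hq x : v x0 - d + dot (x - x0) q <= v x.
  have gap : v x0 - c1 - dot x0 p1 <= Dm.
    have h1 : v x0 <= `|v 0| + l * rad.
      have := vl x0 0; rewrite subr0 ler_norml => /andP[_ h].
      have := ler_wpM2l (ltW l0) x0r; have := ler_norm (v 0); lra.
    have h2 : - dot x0 p1 <= (n%:R * rad ^+ 2 + dot p1 p1) / 2.
      have h3 : dot x0 x0 <= n%:R * rad ^+ 2.
        apply: (le_trans (dot_le_norm x0)); rewrite ler_wpM2l//.
        by apply: lerXn2r; rewrite ?nnegrE// (le_trans _ x0r).
      have := dot_ge0 (x0 + p1); rewrite !dotE [dot p1 x0]dotC; lra.
    have h4 := lerNnormlW (lexx `|c1|).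
    rewrite /Dm; lra.
  have h1 := ler_wpM2l (ltW th0) (H1' x).
  have h2 : 0 <= (1 - th) * (v x - (v x0 - d / 2 + dot (x - x0) p0)).
    by rewrite mulr_ge0 ?subr_ge0//; lra.
  have h3 := ler_wpM2l (ltW th0) gap.
  rewrite /q dotDr !dotZr.
  have -> : dot (x - x0) p1 = dot x p1 - dot x0 p1 by rewrite dotDl dotNl.
  have h4 : 0 <= th * d by rewrite mulr_ge0// ltW.
  lra.
have up p : (forall x, v x0 - d + dot (x - x0) p <= v x) -> dot p p <= Lam ^+ 2.
  move=> /(affine_minorant_slope l0 vl) h; apply: (le_trans h).
  apply: (@le_trans _ _ Lam); first by rewrite /Lam; lra.
  by rewrite expr2 ler_peMl// (le_trans ler01).
have Lam0 : 0 <= Lam by lra.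
have : th ^+ 2 * dot p1 p1 <= 2 * dot q q + 2 * dot p0 p0.
  have -> : th ^+ 2 * dot p1 p1 = dot (q - (1 - th) *: p0) (q - (1 - th) *: p0).
    by rewrite /q addrC addKr dotZl dotZr; ring.
  have := dot_ge0 (q + (1 - th) *: p0).
  have h : (1 - th) ^+ 2 * dot p0 p0 <= dot p0 p0.
    by rewrite ler_piMl ?dot_ge0// expr_le1//; lra.
  by move: h; move: q {Hq} => q'; rewrite !dotE [dot p0 q']dotC; lra.
move=> h; have [dq|dq] := leP (del ^+ 2) (dot q q).
  by apply: (tilted_of_affine del0 Lam0 _ Hq); rewrite dq up.
apply: (tilted_of_affine del0 Lam0 _ Hp0); rewrite up// andbT.
by move: dq; rewrite del2; lra.
Qed.

Lemma monotone_tilted (v : 'rV[R]_n -> R) (l del : R) eta :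
  0 < l -> (forall x y, `|v x - v y| <= l * `|x - y|) -> dot eta eta = 1 -> 0 < del ->
  (forall x (s : R), 0 <= s -> v x + del * s <= v (x + s *: eta)) ->
  forall d, 0 < d -> exists del Lam, [/\ 0 < del, del <= Lam &
    forall x, exists eta, tilted v x d del Lam eta].
Proof.
move=> l0 vl eta1 del0 mono d d0; pose Lam := Num.max l del.
have Ll : l <= Lam by rewrite le_max lexx.
have Lam0 : 0 < Lam by exact: lt_le_trans Ll.
have vE x y : v x - Lam * euclidean_norm (y - x) <= v y.
  have := vl y x; rewrite ler_norml => /andP[h _].
  have h1 : `|y - x| <= euclidean_norm (y - x).
    by rewrite -(@ler_pXn2r _ 2) ?nnegrE ?sqrtr_ge0// sqr_sqrtr ?dot_ge0 ?sqr_norm_le_dot.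
  have := ler_pM (ltW l0) (normr_ge0 _) Ll h1; lra.
exists del, Lam; split => //; first by rewrite le_max lexx orbT.
move=> x0; exists eta; split => // x; cbv zeta; set s := dot (x - x0) eta; set y := x - x0 - s *: eta.
have := vE x0 (x0 + y); have -> : x0 + y - x0 = y by rewrite addrC addKr.
move=> h1.
suff : v (x0 + y) + Num.min (del * s) (Lam * s) <= v x by lra.
have [s0|s0] := leP 0 s.
  have := mono (x0 + y) s s0.
  have -> : x0 + y + s *: eta = x by rewrite /y -addrA subrK addrC subrK.
  by apply: le_trans; rewrite lerD2l ge_min lexx.
have := vE (x0 + y) x.
have -> : x - (x0 + y) = s *: eta by rewrite /y opprD addrA opprB addrC subrK.
rewrite /euclidean_norm dotZl dotZr eta1 mulr1 -expr2 sqrtr_sqr ltr0_norm//.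
by apply: le_trans; rewrite mulrN opprK lerD2l ge_min lexx orbT.
Qed.

End Convex.

(** * Choosing a translate of a countable family of slabs *)

Section Selection.
Context {R : realType}.
Local Open Scope ereal_scope.
Let mu := @lebesgue_measure R.

Lemma slab_measurable (z th c d : R) :
  measurable [set p : measurableTypeR R * measurableTypeR R | (c <= z + p.1 + th * p.2 <= d)%R].
Proof.
have mf : measurable_fun [set: measurableTypeR R * measurableTypeR R] (fun p => z + p.1 + th * p.2)%R.
  apply: measurable_funD; last by apply: measurable_funM; [exact: measurable_cst|exact: measurable_snd].
  by apply: measurable_funD; [exact: measurable_cst|exact: measurable_fst].
have := mf measurableT _ (measurable_itv `[c, d]); rewrite setTI.
by congr measurable; apply/seteqP; split => p /=; rewrite in_itv.
Qed.

Lemma slab_section_measurable (z th c d : R) :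
  measurable ([set t | (c <= z + th * t <= d)%R] : set (measurableTypeR R)).
Proof.
have := measurable_xsection (0%R : measurableTypeR R) (slab_measurable z th c d).
by congr measurable; apply/seteqP; split => t /=; rewrite /xsection/= inE /= addr0.
Qed.

(** By Tonelli, the weighted sum of measures, integrated over the translation
    [y], is at most the sum in the hypothesis, hence at most [E]; so it cannot
    exceed [2 E / r] for all [y] in [0, r]. *)
Lemma translate_selection (A : nat -> set (measurableTypeR R)) (w c d : nat -> R) (z th r E : R) :
  (forall k, measurable (A k)) -> (forall k, (0 <= w k)%R) -> (forall k, (c k <= d k)%R) ->
  (0 < r)%R -> (0 < E)%R ->
  \sum_(0 <= k <oo) (w k * (d k - c k))%:E * mu (A k) <= E%:E ->
  exists2 y : R, (0 <= y <= r)%R &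
    \sum_(0 <= k <oo) (w k)%:E * mu (A k `&` [set t | (c k <= z + y + th * t <= d k)%R])
      <= (2 * E / r)%:E.
Proof.
move=> mA w0 cd r0 E0 sumE.
pose S k : set (measurableTypeR R * measurableTypeR R) :=
  (`[0%R, r]%classic `*` A k) `&` [set p | (c k <= z + p.1 + th * p.2 <= d k)%R].
have mS k : measurable (S k).
  by apply: measurableI; [exact: measurableX|exact: slab_measurable].
pose F k y := mu (xsection (S k) y).
have mF k : measurable_fun setT (F k) by exact: measurable_fun_xsection.
have F0 k y : 0 <= F k y by exact: measure_ge0.
have intF k : \int[mu]_y F k y <= (d k - c k)%:E * mu (A k).
  have -> : \int[mu]_y F k y = \int[mu]_t mu (ysection (S k) t).
    have := @indic_fubini_tonelli _ _ _ _ _ mu mu (S k) (mS k).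
    by rewrite indic_fubini_tonelli_FE// indic_fubini_tonelli_GE.
  have dc : (0 <= d k - c k)%R by rewrite subr_ge0.
  rewrite -[leRHS](_ : \int[mu]_t ((d k - c k)%:E * (\1_(A k) t)%:E) = _); last first.
    rewrite ge0_integralZl//= ?lee_fin//; first by rewrite integral_indic// setIT.
    by apply/measurable_EFinP; exact: measurable_indic.

  apply: ge0_le_integral => //.
  - exact: measurable_fun_ysection.
  - by apply: measurable_funeM; apply/measurable_EFinP; exact: measurable_indic.
  move=> t _; rewrite indicE; have [tA|tA] := boolP (t \in A k).
    rewrite mule1; apply: (@le_trans _ _ (mu `[(c k - z - th * t)%R, (d k - z - th * t)%R]%classic)).
      apply: le_measure; rewrite ?inE; [exact: measurable_ysection|exact: measurable_itv|].
      move=> y; rewrite /ysection/= inE => -[_ /= /andP[h1 h2]].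
      by rewrite in_itv/=; apply/andP; split; lra.
    rewrite /mu lebesgue_measure_itv/= -EFinD; case: ifP => _; last by rewrite lee_fin.
    by rewrite lee_fin; lra.
  have -> : ysection (S k) t = set0.
    apply/seteqP; split => // y; rewrite /ysection/= inE => -[[_ /= At] _].
    by move: tA; rewrite notin_setE.
  by rewrite /mu measure0 mule0.
apply: contrapT => H.
have big y : (0 <= y <= r)%R -> (2 * E / r)%:E <= \sum_(0 <= k <oo) (w k)%:E * F k y.
  move=> yr; rewrite leNgt; apply/negP => lt; apply: H; exists y => //.
  apply: (le_trans _ (ltW lt)); apply: lee_nneseries => [k _ _|k _].
    by rewrite mule_ge0 ?lee_fin.
  rewrite lee_wpmul2l ?lee_fin//; apply: le_measure; rewrite ?inE.
  - by apply: measurableI => //; exact: slab_section_measurable.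
  - exact: measurable_xsection.
  by move=> t [At ct]; rewrite /xsection/= inE; split => //; split => //=; rewrite in_itv.
have wF0 k y : 0 <= (w k)%:E * F k y by rewrite mule_ge0 ?lee_fin.
have mwF k : measurable_fun setT (fun y => (w k)%:E * F k y) by exact: measurable_funeM.
have I1 : \int[mu]_y (\sum_(0 <= k <oo) (w k)%:E * F k y) <= E%:E.
  rewrite integral_nneseries//; apply: le_trans sumE; apply: lee_nneseries => [k _ _|k _].
    exact: integral_ge0.
  rewrite ge0_integralZl ?lee_fin//; apply: (le_trans (lee_wpmul2l _ (intF k))); first by rewrite lee_fin.
  by rewrite muleA -EFinM.
have mSum : measurable_fun setT (fun y => \sum_(0 <= k <oo) (w k)%:E * F k y).
  exact: ge0_emeasurable_sum.
have I2 : (2 * E)%:E <= \int[mu]_y (\sum_(0 <= k <oo) (w k)%:E * F k y).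
  apply: (@le_trans _ _ (\int[mu]_(y in `[0%R, r]) (\sum_(0 <= k <oo) (w k)%:E * F k y))); last first.
    by apply: ge0_subset_integral => // y _; exact: nneseries_ge0.
  have -> : (2 * E)%:E = \int[mu]_(y in `[0%R, r]) (2 * E / r)%:E.
    rewrite integral_cst//= /mu lebesgue_measure_itv/= lte_fin r0 sube0 -EFinM divfK// gt_eqF//.
  have mSum' : measurable_fun `[0%R, r]%classic (fun y => \sum_(0 <= k <oo) (w k)%:E * F k y).
    exact: measurable_funTS.
  have lb y : `[0%R, r]%classic y -> (2 * E / r)%:E <= \sum_(0 <= k <oo) (w k)%:E * F k y.
    by move=> yr; apply: big; move: yr; rewrite /= in_itv.
  have E2 : (0 <= 2 * E / r)%R by rewrite divr_ge0 ?mulr_ge0// ltW.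
  by apply: ge0_le_integral => //= y _; rewrite lee_fin.
have := le_trans I2 I1; rewrite lee_fin; lra.
Qed.

End Selection.

(** * Growth along a direction from the almost everywhere gradient *)

Section AlmostEverywhereMonotone.
Context {R : realType}.
Let mu := @lebesgue_measure R.

(** Cover [N] by boxes of small total volume and fix the coordinates of [y] one
    after the other by [translate_selection]: each step trades the side length
    of every box in this coordinate for a constraint on the time [t] spent on the
    line.  In the end the total time spent in the boxes is small, and outer
    regularity makes the exceptional set open. *)
Lemma line_avoiding_null n (N : set 'rV[R]_n) (x eta : 'rV[R]_n) (s r e : R) :
  Defs.null_set N -> 0 < s -> 0 < r -> 0 < e ->
  exists2 y : 'rV[R]_n, forall i, 0 <= y 0 i <= r &
  exists U : set R, [/\ open U, (mu U <= e%:E)%E &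
    forall t, 0 <= t <= s -> N (x + y + t *: eta) -> U t].
Proof.
move=> N0 s0 r0 e0.
(* Each of the [n] coordinates costs a factor [2 / r], and the bare line a
   factor [s]. *)
pose e1 := e / 2 / (s * (2 / r) ^+ n).
have e10 : 0 < e1 by rewrite !divr_gt0// mulr_gt0// exprn_gt0// divr_gt0.
have [a [b [ab Nab vol]]] := N0 e1 e10.
pose w m k := \prod_(i < n | (m <= i)%N) (b k 0 i - a k 0 i).
have w0 m k : 0 <= w m k by apply: prodr_ge0 => i _; rewrite subr_ge0.
pose A m (y : 'rV[R]_n) k : set (measurableTypeR R) :=
  [set t | 0 <= t <= s /\ forall i : 'I_n, (i < m)%N -> a k 0 i <= (x + y + t *: eta) 0 i <= b k 0 i].
have main m : (m <= n)%N -> exists y : 'rV[R]_n, [/\ forall i, 0 <= y 0 i <= r,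
    forall k, measurable (A m y k) &
    (\sum_(0 <= k <oo) (w m k)%:E * mu (A m y k) <= (s * e1 * (2 / r) ^+ m)%:E)%E].
  elim: m => [_|m IH mn].
    have A0 k : A 0%N 0 k = `[0, s]%classic.
      by apply/seteqP; split => t /=; [case=> ts _; rewrite in_itv|rewrite in_itv/= => ts; split].
    exists 0; split.
    - by move=> i; rewrite mxE lexx ltW.
    - by move=> k; rewrite A0; exact: measurable_itv.
    rewrite expr0 mulr1.
    rewrite (eq_eseriesr (g := fun k => (s%:E * (box_volume (a k) (b k))%:E)%E)); last first.
      move=> k _; rewrite A0 /mu lebesgue_measure_itv/= lte_fin s0 sube0 muleC.
      by congr (_ * _%:E)%E; apply: eq_bigl => i.
    rewrite nneseriesZl ?lee_fin//; last first.
      by move=> k _; rewrite lee_fin prodr_ge0// => i _; rewrite subr_ge0.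
    by rewrite EFinM lee_wpmul2l// lee_fin ltW.
  have [y [yr mA sA]] := IH (ltnW mn).
  pose im := Ordinal mn.
  have wE k : w m k = w m.+1 k * (b k 0 im - a k 0 im).
    rewrite /w (bigD1 im)//= mulrC; congr (_ * _); apply: eq_bigl => i.
    by rewrite ltn_neqAle andbC -val_eqE/= eq_sym.
  have E0 : 0 < s * e1 * (2 / r) ^+ m.
    by apply: mulr_gt0; [exact: mulr_gt0|rewrite exprn_gt0// divr_gt0].
  have sA' : (\sum_(0 <= k <oo) (w m.+1 k * (b k 0 im - a k 0 im))%:E * mu (A m y k) <= (s * e1 * (2 / r) ^+ m)%:E)%E.
    by apply: le_trans sA; rewrite le_eqVlt; apply/orP; left; apply/eqP; apply: eq_eseriesr => k _; rewrite wE.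
  have [y1 y1r sel] := @translate_selection R (A m y) (w m.+1) (fun k => a k 0 im) (fun k => b k 0 im)
     (x 0 im) (eta 0 im) r _ mA (w0 m.+1) (fun k => ab k im) r0 E0 sA'.
  pose y' : 'rV[R]_n := \row_i if i == im then y1 else y 0 i.
  have AE k : A m.+1 y' k = A m y k `&` [set t | a k 0 im <= x 0 im + y1 + eta 0 im * t <= b k 0 im].
    apply/seteqP; split => t /=.
      move=> [ts H]; split; last first.
        by have := H im (ltnSn m); rewrite !mxE eqxx [t * _]mulrC.
      split => // i im'; have := H i (ltnW im'); rewrite !mxE.
      by case: eqP => // ii; move: im'; rewrite ii ltnn.
    move=> [[ts H] Him]; split => // i; rewrite ltnS leq_eqVlt => /orP[/eqP ii|im'].
      have -> : i = im by exact: val_inj.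
      by rewrite !mxE eqxx [t * _]mulrC.
    have := H i im'; rewrite !mxE.
    by case: eqP => // ii; move: im'; rewrite ii ltnn.
  exists y'; split.
  - by move=> i; rewrite mxE; case: ifP.
  - by move=> k; rewrite AE; apply: measurableI => //; exact: slab_section_measurable.
  apply: (@le_trans _ _ (2 * (s * e1 * (2 / r) ^+ m) / r)%:E).
    apply: le_trans sel; rewrite le_eqVlt; apply/orP; left; apply/eqP.
    by apply: eq_eseriesr => k _; rewrite AE.
  rewrite lee_fin exprS le_eqVlt; apply/orP; left; apply/eqP.
  by ring.
have [y [yr mA sA]] := main n (leqnn n).
exists y => //.
pose D := \bigcup_k A n y k.
have mD : measurable D by exact: bigcup_measurable.
have muD : (mu D <= (e / 2)%:E)%E.
  apply: (le_trans (measure_sigma_subadditive mu mA mD (@subset_refl _ D))).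
  apply: (@le_trans _ _ (s * e1 * (2 / r) ^+ n)%:E).
    apply: le_trans sA; rewrite le_eqVlt; apply/orP; left; apply/eqP; apply: eq_eseriesr => k _.
    by rewrite /w big_pred0 ?mul1e// => i; rewrite leqNgt ltn_ord.
  rewrite lee_fin le_eqVlt; apply/orP; left; apply/eqP.
  have sX : 0 < s * (2 / r) ^+ n by apply: mulr_gt0 => //; rewrite exprn_gt0// divr_gt0.
  have -> : s * e1 * (2 / r) ^+ n = e1 * (s * (2 / r) ^+ n) by ring.
  by rewrite /e1 divfK// gt_eqF.
have e2 : 0 < e / 2 by rewrite divr_gt0.
have muDoo : (mu D < +oo)%E by exact: le_lt_trans muD (ltry _).
have [U [oU DU muU]] := lebesgue_regularity_outer mD muDoo e2.
exists U; split => //.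
  have mU : measurable U by exact: open_measurable.
  have -> : U = D `|` (U `\` D) by rewrite setDUK.
  apply: (le_trans (measureU2 mu mD (measurableD mU mD))).
  have -> : e%:E = ((e / 2)%:E + (e / 2)%:E)%E by rewrite -EFinD; congr EFin; field.
  by rewrite leeD// ltW.
move=> t ts /Nab[k _ Bk]; apply: DU; exists k => //.
Qed.

(** The function [k t = h t + l mu (U `&` [0, t]) + ep t] cannot decrease: off
    [U] the derivative of [h] is nonnegative, so [ep t] makes up for the
    remainder, and on the open set [U] the measure
    grows at rate 1, which makes up for the Lipschitz bound.  Hence the supremum of
    the times at which [k] is at least [k 0] is [s]. *)
Lemma lipschitz_growth (h : R -> R) (l s e : R) (U : set R) : 0 < s -> 0 < l -> 0 < e ->
  (forall t t', `|h t - h t'| <= l * `|t - t'|) ->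
  open U -> (mu U <= e%:E)%E ->
  (forall t, 0 <= t < s -> ~ U t -> exists2 d : R, 0 <= d & is_derive t 1 h d) ->
  h 0 <= h s + l * e.
Proof.
move=> s0 l0 e0 hl oU muU dh.
have mU : measurable U by exact: open_measurable.
pose V t : set (measurableTypeR R) := U `&` `[0, t]%classic.
have mV t : measurable (V t) by apply: measurableI => //; exact: measurable_itv.
have VU t : (mu (V t) <= mu U)%E by apply: le_measure; rewrite ?inE//; exact: subIsetl.
have fV t : mu (V t) \is a fin_num.
  rewrite ge0_fin_numE ?measure_ge0//.
  by apply: (le_lt_trans (VU t)); apply: (le_lt_trans muU); exact: ltry.
pose Lam t := fine (mu (V t)).
have LamE t : mu (V t) = (Lam t)%:E by rewrite /Lam fineK.
have Lam0 t : 0 <= Lam t by rewrite fine_ge0// measure_ge0.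
have Lame t : Lam t <= e by rewrite -lee_fin -LamE (le_trans (VU t)).
have Lam_mono t t' : t <= t' -> Lam t <= Lam t'.
  move=> tt; rewrite -lee_fin -!LamE; apply: le_measure; rewrite ?inE//.
  by move=> z [Uz /=]; rewrite !in_itv/= => /andP[z0 zt]; split => //=; rewrite in_itv/= z0 (le_trans zt).
have Lam_jump t t' : 0 <= t -> t <= t' -> (forall z, t < z <= t' -> U z) -> Lam t + (t' - t) <= Lam t'.
  move=> t0 tt Uz; rewrite -lee_fin EFinD -!LamE.
  have -> : (t' - t)%:E = mu `]t, t']%classic.
    rewrite /mu lebesgue_measure_itv/= lte_fin -EFinD; case: ltP => // tt'.
    by congr EFin; lra.
  rewrite -measureU//=; last 1 first.
  - apply/seteqP; split => // z [[_ /=]]; rewrite !in_itv/= => /andP[_ h1] /andP[h2 _].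
    by move: (lt_le_trans h2 h1); rewrite ltxx.
  apply: le_measure; rewrite ?inE//; first by apply: measurableU => //; exact: measurable_itv.
  move=> z [[Uz' /=]|/=]; rewrite !in_itv/= => /andP[h1 h2]; split => //=; rewrite ?in_itv/=.
  - by rewrite h1 (le_trans h2).
  - by apply: Uz; rewrite h1.
  - by rewrite h2 (le_trans t0 (ltW h1)).
apply/ler_addgt0Pr => eps eps0.
pose ep := eps / s; have ep0 : 0 < ep by rewrite divr_gt0.
pose k t := h t + l * Lam t + ep * t.
suff ks : k 0 <= k s.
  have h1 : l * Lam s <= l * e by rewrite ler_wpM2l// ltW.
  have h2 : 0 <= l * Lam 0 by rewrite mulr_ge0// ltW.
  have h3 : ep * s = eps by rewrite /ep divfK// gt_eqF.
  by move: ks; rewrite /k mulr0 h3; lra.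
pose P := [set t | 0 <= t <= s /\ k 0 <= k t].
have supP : has_sup P.
  split; first by exists 0; split; rewrite ?lexx ?ltW.
  by exists s => t [/andP[]].
have P0 : P 0 by split; rewrite ?lexx ?ltW.
pose sg := sup P.
have sg0 : 0 <= sg by exact: sup_upper_bound.
have sgs : sg <= s by apply: sup_le_ub; [exists 0|move=> t [/andP[]]].
have ksg : k 0 <= k sg.
  apply/ler_addgt0Pr => d d0.
  have dl : 0 < d / l by rewrite divr_gt0.
  have [t [/andP[t0 ts] kt] tsg] := sup_adherent dl supP.
  have tle : t <= sg by apply: sup_upper_bound => //; split; rewrite ?t0.
  have h1 := Lam_mono _ _ tle.
  have h2 := hl t sg; rewrite ler_norml distrC ger0_norm ?subr_ge0// in h2.
  have h3 : l * (sg - t) <= d.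
    have : (sg - t) <= d / l by rewrite -/sg in tsg; lra.
    by rewrite ler_pdivlMr// mulrC.
  have h4 : l * Lam t <= l * Lam sg by rewrite ler_wpM2l// ltW.
  have h5 : ep * t <= ep * sg by rewrite ler_wpM2l// ltW.
  case/andP: h2 => _ h2; move: kt; rewrite /k; lra.
move: sgs; rewrite le_eqVlt => /predU1P[<- //|sgs].
exfalso.
suff [t [tsg ts kt]] : exists t, [/\ sg < t, t <= s & k sg <= k t].
  have : t <= sg.
    apply: sup_upper_bound => //; split; last exact: le_trans kt.
    by rewrite (le_trans sg0 (ltW tsg)).
  by rewrite leNgt tsg.
have [Usg|nU] := pselect (U sg).
  have /nbhs_ballP[r /= r0 rU] : nbhs sg U by exact: open_nbhs_nbhs.
  pose t := Num.min s (sg + r / 2).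
  have tsg : sg < t by rewrite lt_min sgs ltrDl divr_gt0.
  exists t; split => //; first by rewrite ge_min lexx.
  have tr : t <= sg + r / 2 by rewrite ge_min lexx orbT.
  have := Lam_jump sg t sg0 (ltW tsg).
  have Uz z : sg < z <= t -> U z.
    move=> /andP[h1 h2]; apply: rU; rewrite /ball/= ltr0_norm; last by rewrite subr_lt0.
    have : r / 2 < r by rewrite ltr_pdivrMr// ltr_pMr// ltr1n.
    lra.
  move=> /(_ Uz) h1.
  have h2 := ler_wpM2l (ltW l0) h1.
  have := hl t sg; rewrite ler_norml [`|t - sg|]gtr0_norm ?subr_gt0// => /andP[h3 _].
  have h5 : ep * sg <= ep * t by rewrite ler_wpM2l// ltW.
  rewrite /k; lra.
have [|d d0 dsg] := dh sg _ nU; first by rewrite sg0.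
have [r r0 rP] := is_derive_approx dsg ep0.
pose t := Num.min (s - sg) (r / 2).
have t0 : 0 < t by rewrite lt_min subr_gt0 sgs divr_gt0.
have tr : t < r.
  have : t <= r / 2 by rewrite ge_min lexx orbT.
  by move/le_lt_trans; apply; rewrite ltr_pdivrMr// ltr_pMr// ltr1n.
exists (sg + t); split.
- by rewrite ltrDl.
- by rewrite -lerBrDl ge_min lexx.
have := rP t; rewrite gtr0_norm// => /(_ tr); rewrite ler_norml => /andP[h1 _].
have h2 : Lam sg <= Lam (sg + t) by rewrite Lam_mono// lerDl ltW.
have h3 : l * Lam sg <= l * Lam (sg + t) by rewrite ler_wpM2l// ltW.
have h4 : 0 <= d * t by rewrite mulr_ge0// ltW.
rewrite /k; lra.
Qed.

Lemma derive_dot_grad n (v : 'rV[R]_n -> R) (x eta : 'rV[R]_n) :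
  differentiable v x -> 'D_eta v x = dot (grad v x) eta.
Proof.
move=> dv; rewrite deriveE// {1}(row_sum_delta eta) linear_sum/=.
apply: eq_bigr => i _; rewrite linearZ/= mxE mulrC -deriveE//.
Qed.

(** On a line close to the given one the derivative along [eta] is at least
    [del] outside a set of small measure. *)
Lemma ae_monotone n (v : 'rV[R]_n -> R) (l del : R) (eta : 'rV[R]_n) : 0 < l -> 0 < del ->
  (forall x y, `|v x - v y| <= l * `|x - y|) ->
  almost_everywhere_Rn (fun x => differentiable v x /\ del <= dot (grad v x) eta) ->
  forall x (s : R), 0 <= s -> v x + del * s <= v (x + s *: eta).
Proof.
move=> l0 del0 vl ae x s; rewrite le_eqVlt => /predU1P[<-|s0].
  by rewrite mulr0 scale0r !addr0.
apply/ler_addgt0Pr => e e0.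
pose L := l * `|eta| + del.
have L0 : 0 < L by rewrite ltr_wpDl// mulr_ge0// ltW.
pose r := e / (4 * l); pose e1 := e / (2 * L).
have r0 : 0 < r by rewrite divr_gt0// mulr_gt0.
have e10 : 0 < e1 by rewrite divr_gt0// mulr_gt0.
have [y yr [U [oU muU NU]]] := line_avoiding_null x eta ae s0 r0 e10.
have ynorm : `|y| <= r.
  rewrite -[leLHS]/(mx_norm y) mx_normrE; apply/bigmax_leP; split; first exact: ltW.
  by move=> [i j] _ /=; rewrite (ord1 i); have /andP[h1 h2] := yr j; rewrite ger0_norm.
pose h t := v (x + y + t *: eta) - del * t.
have hl t t' : `|h t - h t'| <= L * `|t - t'|.
  have -> : h t - h t' = (v (x + y + t *: eta) - v (x + y + t' *: eta)) - del * (t - t') by rewrite /h; ring.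
  apply: (le_trans (ler_normB _ _)); rewrite /L mulrDl lerD//.
    apply: (le_trans (vl _ _)); rewrite opprD addrACA subrr add0r -scalerBl normrZ.
    by rewrite -mulrA [`|eta| * _]mulrC.
  by rewrite normrM gtr0_norm.
have dh t : 0 <= t < s -> ~ U t -> exists2 d : R, 0 <= d & is_derive t 1 h d.
  move=> /andP[t0 ts] nU.
  have [dv dd] : differentiable v (x + y + t *: eta) /\ del <= dot (grad v (x + y + t *: eta)) eta.
    by apply: contrapT => H; apply: nU; apply: NU => //; rewrite t0 ltW.
  exists (dot (grad v (x + y + t *: eta)) eta - del); first by rewrite subr_ge0.
  have d1 := is_derive_line (diff_derivable (v := eta) dv).
  have d2 : is_derive t 1 (fun k : R => v (x + y + k *: eta)) ('D_eta v (x + y + t *: eta)).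
    apply/is_derive_shiftP.
    rewrite (_ : (fun k => v (x + y + (t + k) *: eta)) = (fun k => v (x + y + t *: eta + k *: eta)))//.
    by apply/funext => k; rewrite scalerDl addrA.
  rewrite derive_dot_grad// in d2.
  have HH := is_deriveB d2 (is_derive_cmul del (is_derive_id t (1 : R))).
  by apply: (is_derive_eq HH); rewrite mulr1.
have := lipschitz_growth s0 L0 e10 hl oU muU dh.
rewrite /h scale0r mulr0 subr0 addr0.
have -> : L * e1 = e / 2 by rewrite /e1; field; rewrite gt_eqF.
have lr : l * `|y| <= e / 4.
  have -> : e / 4 = l * r by rewrite /r; field; rewrite gt_eqF.
  by rewrite ler_wpM2l// ltW.
have := vl x (x + y); rewrite opprD addrA subrr sub0r normrN ler_norml => /andP[_ h1].
have := vl (x + y + s *: eta) (x + s *: eta).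
have -> : x + y + s *: eta - (x + s *: eta) = y by rewrite opprD addrACA subrr addr0 [x + y]addrC addrK.
rewrite ler_norml => /andP[_ h2]; lra.
Qed.

End AlmostEverywhereMonotone.

(** * Convergence *)

Lemma convex_function_segment (R : realType) (n : nat) (v : 'rV[R]_n -> R) :
  convex_function setT v ->
  forall (t : R) x y, 0 < t < 1 -> v (y + t *: (x - y)) <= v y + t * (v x - v y).
Proof.
move=> cvx t x y /andP[t0 t1].
have := cvx (Itv01 (ltW t0) (ltW t1)) x y; rewrite !inE => /(_ I I).
have -> : conv (Itv01 (ltW t0) (ltW t1)) (x : convex_lmodType 'rV[R]_n) y = y + t *: (x - y).
  transitivity (t *: x + (1 - t) *: y) => //.
  by rewrite scalerBl scale1r scalerBr addrCA addrA.
have -> : conv (Itv01 (ltW t0) (ltW t1)) (v x : R^o) (v y) = t * v x + (1 - t) * v y by [].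
lra.
Qed.

Lemma uniform_cvg_of_dist (R : realType) (T : choiceType) (K : set T) (u : R -> T -> R) (f : T -> R) :
  (forall e, 0 < e -> \forall eps \near 0^'+, forall p, K p -> `|f p - u eps p| <= e) ->
  {uniform K, u @ 0^'+ --> f}.
Proof.
move=> H P /uniform_nbhs[E [entE EP]].
move: entE; rewrite -entourage_ballE => -[e /= e0 eE].
have e2 : 0 < e / 2 by rewrite divr_gt0.
apply: filterS (H _ e2) => eps Heps; apply: EP => p Kp; apply: eE => /=.
rewrite -ball_normE/=; apply: (le_lt_trans (Heps p Kp)).
by rewrite ltr_pdivrMr// ltr_pMr// ltr1n.
Qed.

Theorem corollary5p6 (R : realType) (n : nat) (g : R -> R) (alpha : R)
    (u0 : 'rV[R]_n -> R) (u : R -> 'rV[R]_n * R -> R)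
    (g_lip : lipschitz g)
    (g_per : forall (y : R) (k : int), g (y + k%:~R) = g y)
    (g_pos : forall y : R, 0 < g y)
    (alpha01 : 0 < alpha < 1)
    (u0_lip : lipschitz u0)
    (u_sol : forall eps : R, 0 < eps -> is_solution g alpha eps u0 (u eps))
    (u0_hyp :
      (convex_function setT u0 /\ ~ (exists c : R, forall x, u0 x = c)) \/
      (~ has_ubound (range u0) /\
       exists eta : 'rV[R]_n, euclidean_norm eta = 1 /\
       exists delta : R, 0 < delta /\
       almost_everywhere_Rn (fun x =>
         differentiable u0 x /\ delta <= dot (grad u0 x) eta))) :
  locally_uniform_cvg u
    (fun p => u0 p.1 + p.2 * \int[lebesgue_measure]_(s in `[0, 1]) g s).
Proof.
move=> K cK Khs; set m := Rintegral _ _ _.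
have [lg _ glg] := lipschitz_le g_lip.
have cg : continuous g by exact: dist_le_continuous glg.
have gm : has_mean g m by exact: continuous_has_mean.
have [l l0 ul] := lipschitz_le u0_lip.
have sol eps (eps0 : 0 < eps) := is_solution_solves (u_sol eps eps0).
have [M [Mreal KM]] := compact_bounded cK.
pose rad := `|M| + 1; have rad0 : 0 < rad by rewrite ltr_wpDl.
have Krad p : K p -> `|p| <= rad.
  by move=> Kp; apply: (KM rad) => //; rewrite (le_lt_trans (ler_norm M))// ltrDl.
have Kx p : K p -> `|p.1| <= rad.
  by move=> Kp; apply: le_trans (Krad p Kp); rewrite prod_normE le_max lexx.
have Kt p : K p -> 0 <= p.2 <= rad.
  move=> Kp; have h : 0 <= p.2 := Khs p Kp; rewrite h.
  by apply: le_trans (Krad p Kp); rewrite prod_normE le_max ger0_norm// lexx orbT.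
have tilt d : 0 < d -> exists del Lam, [/\ 0 < del, del <= Lam &
    forall x, [set x | `|x| <= rad] x -> exists eta, tilted u0 x d del Lam eta].
  move=> d0; case: u0_hyp => [[cvx ncst]|[_ [eta [eta1 [delta [delta0 ae]]]]]].
    exact: (convex_tilted rad (convex_function_segment cvx) l0 ul ncst d0).
  have etaeta : dot eta eta = 1 by rewrite -(sqr_sqrtr (dot_ge0 eta)) -/(euclidean_norm eta) eta1 expr1n.
  have [del [Lam [h1 h2 h3]]] := monotone_tilted l0 ul etaeta delta0 (ae_monotone l0 delta0 ul ae) d0.
  by exists del, Lam; split => // x _; exact: h3.
apply: uniform_cvg_of_dist => e e0.
have up := upper_bound g_lip g_per g_pos gm alpha01 l0 ul sol rad0 e0.
have lo := lower_bound g_lip g_per gm alpha01 l0 ul tilt sol rad0 e0.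
near=> eps => -[x t] Kp /=.
have U : forall x t, 0 <= t <= rad -> u eps (x, t) <= u0 x + m * t + e by near: eps.
have L : forall x t, [set x | `|x| <= rad] x -> 0 <= t <= rad -> u0 x + m * t - e <= u eps (x, t).
  by near: eps.
have := U x t (Kt _ Kp); have := L x t (Kx _ Kp) (Kt _ Kp).
rewrite ler_norml [t * m]mulrC => h1 h2; apply/andP; split; lra.
Unshelve. all: by end_near. Qed.
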